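(* Let $(M,F)$ be a Finsler manifold of dimension $m\ge 2$, with curvature components $R^i_{jk}$ of its Cartan nonlinear connection. Suppose that there exist a smooth function $\lambda$ on $T_0M$ and a tensor field $\{X^i_j(x,y);\ 1\le i,j\le m\}$ such that $$R^i_{jk}=\lambda\,(X^i_k y_j-X^i_j y_k)\quad\text{and}\quad y_iX^i_j=y_j$$ for all $i,j,k\in\{1,\dots,m\}$. Then the pair $(D_F,\ J_F=\Psi_F|_{D_F})$ is a CR-structure on $T_0M$.
   Context: Summation over repeated indices is used throughout. CR-structure: let $N$ be a smooth manifold of dimension $2n+s$ with $n,s\ge 1$, $D$ a distribution on $N$ of dimension $2n$, $\Gamma(D)$ the module of its sections, and $J:D\to D$ a vector bundle morphism with $J^2=-I$. The pair $(D,J)$ is a CR-structure on $N$ if for all $X,Y\in\Gamma(D)$: (i) $[JX,JY]-[X,Y]\in\Gamma(D)$, and (ii) $[JX,JY]-[X,Y]-J([X,JY]+[JX,Y])=0$. Here $N=T_0M$, $s=2$, $n=m-1$. Finsler setting: $M$ is a smooth $m$-dimensional manifold, $m\ge 2$, with tangent bundle $\pi:TM\to M$, induced local coordinates $(x^i,y^i)$ on $TM$, and slit tangent bundle $T_0M=TM\setminus O$, where $O$ is the null section. A Finsler fundamental function is a map $F:TM\to\mathbb{R}_+$ that is smooth on $T_0M$ and continuous on $O$, satisfies $F(x,\lambda y)=\lambda F(x,y)$ for all $\lambda>0$, and for which the matrix $g_{ij}=\frac12\frac{\partial^2F^2}{\partial y^i\partial y^j}$ is invertible with positive definite associated quadratic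 form (on $T_0M$). $(M,F)$ is then called a Finsler manifold. Put $y_i=g_{ij}y^j$, so $F^2=y_iy^i$. Cartan nonlinear connection: $\gamma^i_{jk}=\frac12 g^{ia}\left(\frac{\partial g_{ak}}{\partial x^j}+\frac{\partial g_{ja}}{\partial x^k}-\frac{\partial g_{jk}}{\partial x^a}\right)$, $\gamma^i_{00}=\gamma^i_{jk}y^jy^k$, $N^i_j=\frac12\frac{\partial\gamma^i_{00}}{\partial y^j}$, $\frac{\delta}{\delta x^i}=\frac{\partial}{\partial x^i}-N^j_i\frac{\partial}{\partial y^j}$, $\delta y^i=dy^i+N^i_jdx^j$. The fields $\{\frac{\delta}{\delta x^i},\frac{\partial}{\partial y^i}\}$ form a local frame on $T_0M$ with dual frame $\{dx^i,\delta y^i\}$. The curvature of the Cartan nonlinear connection is $R^i_{jk}=\frac{\delta N^i_j}{\delta x^k}-\frac{\delta N^i_k}{\delta x^j}$, so that $[\frac{\delta}{\delta x^j},\frac{\delta}{\delta x^k}]=R^i_{jk}\frac{\partial}{\partial y^i}$. Tensor fields such as $\{X^i_j(x,y)\}$ are smooth on $T_0M$ and, under changes of coordinates on $M$, have components transforming like those of a $(1,1)$-tensor field on $M$. The almost complex structure $\Psi_F$ on $T_0M$ is defined by $\Psi_F(\frac{\delta}{\delta x^i})=-\frac{\partial}{\partial y^i}$, $\Psi_F(\frac{\partial}{\partial y^i})=\frac{\delta}{\delta x^i}$. The structural distribution is $D_F=\ker\eta^1\cap\ker\eta^2$ on $T_0M$, where $\eta^1=\frac1{F^2}y_idx^i$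 and $\eta^2=\frac1{F^2}y_i\delta y^i$. It has dimension $2m-2$. Equivalently, $D_F$ is the orthogonal complement of $\mathrm{span}\{S_F,\Gamma\}$, with $S_F=y^i\frac{\delta}{\delta x^i}$ and $\Gamma=y^i\frac{\partial}{\partial y^i}$, with respect to the Sasaki type metric $G_F=g_{ij}dx^i\otimes dx^j+g_{ij}\delta y^i\otimes\delta y^j$. *)

(* Defs.v *)
From mathcomp Require Import all_boot all_order all_algebra.
From mathcomp Require Import all_classical all_reals all_analysis.

Set Implicit Arguments.
Unset Strict Implicit.
Unset Printing Implicit Defensive.

Import Order.TTheory GRing.Theory Num.Theory.
Import numFieldNormedType.Exports.

Local Open Scope classical_set_scope.
Local Open Scope ring_scope.

(* C^oo is taken as "Frechet differentiable to every order". *)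
Fixpoint differentiable_upto (R : realType) (d : nat) (V : normedModType R)
    (k : nat) (U : set 'rV[R]_d) (f : 'rV[R]_d -> V) : Prop :=
  if k is k'.+1 then
    (forall u, U u -> differentiable f u) /\
    (forall i : 'I_d,
       differentiable_upto k' U (fun u => 'D_(delta_mx 0 i) f u))
  else True.

(* Only meant for open [U]: the derivatives are those of [f] as a function on
   the whole of R^d. *)
Definition smooth_on (R : realType) (d : nat) (V : normedModType R)
    (U : set 'rV[R]_d) (f : 'rV[R]_d -> V) : Prop :=
  forall k, differentiable_upto k U f.

(* A set with charts; its topology and smooth structure are those induced by
   the charts.  [chart_map a] is only meaningful on [chart_dom a]. *)
Record atlas (R : realType) (d : nat) (N : Type) := Atlas {
  chart : Type;
  chart_dom : chart -> set N;
  chart_map : chart -> N -> 'rV[R]_d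
}.
Arguments chart {R d N} A : rename.
Arguments chart_dom {R d N} A a : rename.
Arguments chart_map {R d N} A a : rename.

Section Manifold.
Context {R : realType} {d : nat} {N : Type}.
Variable A : atlas R d N.

(* f read in the chart a, i.e. f \o (chart_map A a)^-1 on the image of the
   chart and 0 elsewhere. *)
Definition in_chart (V : zmodType) (a : chart A) (f : N -> V)
    (u : 'rV[R]_d) : V :=
  xget 0 [set f p | p in [set p | chart_dom A a p /\ chart_map A a p = u]].

Definition transition (a b : chart A) : 'rV[R]_d -> 'rV[R]_d :=
  in_chart a (chart_map A b).

Definition chart_open (U : set N) : Prop :=
  forall a, open (chart_map A a @` (U `&` chart_dom A a)).

(* Since each chart domain is homeomorphic to an open subset of R^d, the last
   clause is second countability of the induced topology. *)
Definition smooth_manifold : Prop :=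
  [/\ (forall p, exists a : chart A, chart_dom A a p),
      (forall (a : chart A) p q,
         chart_dom A a p -> chart_dom A a q ->
         chart_map A a p = chart_map A a q -> p = q),
      (forall a b : chart A,
         let O := chart_map A a @` (chart_dom A a `&` chart_dom A b) in
         open O /\ smooth_on O (transition a b)),
      (forall p q, p <> q -> exists U V : set N,
         [/\ chart_open U, chart_open V, U p, V q & U `&` V = set0]) &
      (exists C : set (chart A), countable C /\
         forall p, exists a, C a /\ chart_dom A a p)].

(* A tangent vector at p is the family of its components in the charts around
   p, set to 0 in the other charts so that equality of tangent vectors is
   equality of families. *)
Definition tangent (p : N) (v : chart A -> 'rV[R]_d) : Prop :=
  (forall a, ~ chart_dom A a p -> v a = 0) /\
  (forall a b, chart_dom A a p -> chart_dom A b p ->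
     v b = 'd (transition a b) (chart_map A a p) (v a)).

Lemma tangentZ (p : N) (c : R) (v : chart A -> 'rV[R]_d) :
  tangent p v -> tangent p (c *: v).
Proof.
case=> v0 vt; split=> [a /v0 va|a b ap bp].
  by rewrite fctE va scaler0.
by rewrite fctE (vt a b ap bp) -linearZ.
Qed.

Definition smooth_fun (V : normedModType R) (f : N -> V) : Prop :=
  forall a : chart A, smooth_on (chart_map A a @` chart_dom A a) (in_chart a f).

Definition vector_field (U : set N) (X : N -> chart A -> 'rV[R]_d) : Prop :=
  (forall p, U p -> tangent p (X p)) /\
  (forall a, smooth_on (chart_map A a @` (U `&` chart_dom A a))
               (in_chart a (X^~ a))).

Definition bracket (X Y : N -> chart A -> 'rV[R]_d) (p : N) (a : chart A) :
    'rV[R]_d :=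
  let u := chart_map A a p in
  let x := in_chart a (X^~ a) in
  let y := in_chart a (Y^~ a) in
  if `[< chart_dom A a p >] then 'D_(x u) y u - 'D_(y u) x u else 0.

Implicit Types D : N -> set (chart A -> 'rV[R]_d).
Implicit Types J : N -> (chart A -> 'rV[R]_d) -> (chart A -> 'rV[R]_d).

Definition section_on D (U : set N) (X : N -> chart A -> 'rV[R]_d) : Prop :=
  vector_field U X /\ (forall p, U p -> D p (X p)).

Definition distribution (r : nat) D : Prop :=
  forall p, exists (U : set N) (X : 'I_r -> N -> chart A -> 'rV[R]_d),
    [/\ chart_open U, U p, (forall i, vector_field U (X i)) &
        forall q, U q ->
          (forall c : 'I_r -> R,
             \sum_i c i *: X i q = 0 -> forall i, c i = 0) /\
          D q = [set v | exists c : 'I_r -> R, v = \sum_i c i *: X i q]].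

(* Only the restriction of J p to D p matters. *)
Definition bundle_endomorphism D J : Prop :=
  [/\ (forall p v, D p v -> D p (J p v)),
      (forall p (c : R) v w, D p v -> D p w ->
         J p (c *: v + w) = c *: J p v + J p w) &
      (forall U X, chart_open U -> section_on D U X ->
         vector_field U (fun p => J p (X p)))].

Definition CR_structure (n s : nat) D J : Prop :=
  let app (X : N -> chart A -> 'rV[R]_d) p := J p (X p) in
  [/\ smooth_manifold /\ [/\ (1 <= n)%N, (1 <= s)%N & d = (2 * n + s)%N],
      distribution (2 * n) D,
      bundle_endomorphism D J,
      (forall p v, D p v -> J p (J p v) = - v) &
      forall X Y, section_on D setT X -> section_on D setT Y ->
        section_on D setT
          (fun p => bracket (app X) (app Y) p - bracket X Y p) /\
        (forall p, bracket (app X) (app Y) p - bracket X Y p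
           - J p (bracket X (app Y) p + bracket (app X) Y p) = 0)].

End Manifold.

Arguments in_chart {R d N} A {V} a f u.
Arguments transition {R d N} A a b u.
Arguments chart_open {R d N} A U.
Arguments tangent {R d N} A p v.
Arguments smooth_fun {R d N} A {V} f.
Arguments vector_field {R d N} A U X.
Arguments bracket {R d N} A X Y p a.
Arguments section_on {R d N} A D U X.
Arguments distribution {R d N} A r D.
Arguments bundle_endomorphism {R d N} A D J.
Arguments CR_structure {R d N} A n s D J.

Section TangentBundle.
Context {R : realType} {m : nat} {M : Type}.
Variable A : atlas R m M.

Record TM := MkTM {
  base : M;
  vec : chart A -> 'rV[R]_m;
  vec_tangent : tangent A base vec
}.

Definition scaleTM (c : R) (z : TM) : TM := MkTM (tangentZ c (vec_tangent z)).

Definition T0M := {z : TM | vec z <> 0}.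

(* The induced coordinates (x^i, y^i): x is the left block, y the right one. *)
Definition TM_atlas : atlas R (m + m) TM :=
  Atlas (fun a => [set z | chart_dom A a (base z)])
        (fun a z => row_mx (chart_map A a (base z)) (vec z a)).

Definition T0M_atlas : atlas R (m + m) T0M :=
  Atlas (fun a => [set z : T0M | chart_dom A a (base (sval z))])
        (fun a z => row_mx (chart_map A a (base (sval z))) (vec (sval z) a)).

End TangentBundle.

Arguments scaleTM {R m M A} c z.

(* The Finsler objects in an induced chart; L is F^2 in the coordinates
   (x, y). *)
Section LocalFinsler.
Context {R : realType} {m : nat}.
Variable L : 'rV[R]_(m + m) -> R.
Implicit Types (i j k : 'I_m) (f : 'rV[R]_(m + m) -> R) (u w : 'rV[R]_(m + m)).

Definition ex i : 'rV[R]_(m + m) := row_mx (delta_mx 0 i) 0.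
Definition ey i : 'rV[R]_(m + m) := row_mx 0 (delta_mx 0 i).
Definition ddx i f u : R := 'D_(ex i) f u.
Definition ddy i f u : R := 'D_(ey i) f u.

Definition y_up i u : R := rsubmx u 0 i.

Definition gmx u : 'M[R]_m := \matrix_(i, j) (2^-1 * ddy i (ddy j L) u).
Definition g i j u : R := gmx u i j.
Definition g_inv i j u : R := invmx (gmx u) i j.

Definition y_low i u : R := \sum_j g i j u * y_up j u.

Definition gamma i j k u : R :=
  2^-1 * \sum_a g_inv i a u *
    (ddx j (g a k) u + ddx k (g j a) u - ddx a (g j k) u).

Definition gamma00 i u : R :=
  \sum_j \sum_k gamma i j k u * y_up j u * y_up k u.

(* Nc i j = N^i_j (upper index first) *)
Definition Nc i j u : R := 2^-1 * ddy j (gamma00 i) u.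

Definition delta_x i f u : R := ddx i f u - \sum_j Nc j i u * ddy j f u.

(* curvature i j k = R^i_{jk} *)
Definition curvature i j k u : R :=
  delta_x k (Nc i j) u - delta_x j (Nc i k) u.

(* The frame vector delta/delta x^i and the coframe (dx^i, delta y^i). *)
Definition delta_vec i u : 'rV[R]_(m + m) := ex i - \sum_j Nc j i u *: ey j.
Definition dx i w : R := lsubmx w 0 i.
Definition delta_y i u w : R := rsubmx w 0 i + \sum_j Nc i j u * dx j w.

Definition eta1 u w : R := (L u)^-1 * \sum_i y_low i u * dx i w.
Definition eta2 u w : R := (L u)^-1 * \sum_i y_low i u * delta_y i u w.

Definition Psi_loc u w : 'rV[R]_(m + m) :=
  \sum_i dx i w *: (- ey i) + \sum_i delta_y i u w *: delta_vec i u.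

End LocalFinsler.

Section Finsler.
Context {R : realType} {m : nat} {M : Type}.
Variable A : atlas R m M.
Implicit Types F : TM A -> R.

Definition F2_in_chart F (a : chart A) : 'rV[R]_(m + m) -> R :=
  in_chart (T0M_atlas A) a (fun z => F (sval z) ^+ 2).

Definition finsler F : Prop :=
  [/\ (forall z, 0 <= F z),
      smooth_fun (T0M_atlas A) (fun z => F (sval z) : R^o),
      (forall (z : TM A) (a : chart A), vec z = 0 -> chart_dom A a (base z) ->
         {for chart_map (TM_atlas A) a z,
           continuous (in_chart (TM_atlas A) a F)}),
      (forall (c : R) z, 0 < c -> F (scaleTM c z) = c * F z) &
      (forall (z : T0M A) (a : chart A), chart_dom (T0M_atlas A) a z ->
         let G := gmx (F2_in_chart F a) (chart_map (T0M_atlas A) a z) in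
         G \in unitmx /\
         (forall w : 'rV[R]_m, w <> 0 -> 0 < (w *m G *m w^T) 0 0))].

(* T a z i j = T^i_j at z in the chart a. *)
Definition tensor11 (T : chart A -> T0M A -> 'M[R]_m) : Prop :=
  (forall a, smooth_on (chart_map (T0M_atlas A) a @` chart_dom (T0M_atlas A) a)
               (in_chart (T0M_atlas A) a (T a))) /\
  (forall a b (z : T0M A), let p := base (sval z) in
     chart_dom A a p -> chart_dom A b p ->
     let P := \matrix_(i, k)
       'D_(delta_mx 0 k) (transition A a b) (chart_map A a p) 0 i in
     T b z *m P = P *m T a z).

Definition Psi F (z : T0M A) (v : chart (T0M_atlas A) -> 'rV[R]_(m + m)) :
    chart (T0M_atlas A) -> 'rV[R]_(m + m) :=
  fun a => if `[< chart_dom (T0M_atlas A) a z >]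
           then Psi_loc (F2_in_chart F a) (chart_map (T0M_atlas A) a z) (v a)
           else 0.

Definition D_F F (z : T0M A) : set (chart (T0M_atlas A) -> 'rV[R]_(m + m)) :=
  [set v | tangent (T0M_atlas A) z v /\
     forall a, chart_dom (T0M_atlas A) a z ->
       eta1 (F2_in_chart F a) (chart_map (T0M_atlas A) a z) (v a) = 0 /\
       eta2 (F2_in_chart F a) (chart_map (T0M_atlas A) a z) (v a) = 0].

End Finsler.

Arguments finsler {R m M A} F.
Arguments tensor11 {R m M A} T.
Arguments Psi {R m M A} F z v a.
Arguments D_F {R m M A} F z v.

(* Main.v *)
(* In a chart of TM put L = F^2.  Euler's identity turns the definition of the
   Cartan connection into the Euler-Lagrange equation of L for the geodesic
   spray, whose uniqueness gives the transformation law of N^i_j and hence the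
   invariance of Psi_F.  Differentiating the equation also gives
   delta L / delta x^i = 0, so that y_i delta y^i = dL / 2 and
   delta y_i / delta x^k is symmetric in i and k.

   Write a field x of D_F as (h, v), its components on delta / delta x^i and
   d / d y^i; Psi_F sends (h, v) to (v, -h).  The bracket [x, y] has horizontal
   part x(h_y) - y(h_x), and vertical part x(v_y) - y(v_x) corrected by
   sum (d N^i_j / d y^k) (v_x^k h_y^j - v_y^k h_x^j): the curvature term drops
   because h_x and h_y are orthogonal to y_i and R^i_jk is a combination of y_j
   and y_k.  As d N^i_j / d y^k is symmetric in j and k, the correction is
   invariant under applying Psi_F to both fields, and both integrability
   conditions become identities. *)
Require Import Defs.
From HB Require Import structures.
From mathcomp Require Import all_boot all_order all_algebra.
From mathcomp Require Import all_classical all_reals all_analysis.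
From mathcomp Require Import ring lra.

Set Implicit Arguments.
Unset Strict Implicit.
Unset Printing Implicit Defensive.

Import Order.TTheory GRing.Theory Num.Theory.
Import numFieldNormedType.Exports.

Local Open Scope classical_set_scope.
Local Open Scope ring_scope.

(** * Directional derivatives *)

(** The invariance under Psi_F is used twice. Take functions F_j with d F_j / d y^k symmetric in j
    and k, and with antisymmetrised horizontal derivatives vanishing on the fields at hand. Then the
    two-form dF_j ^ dx^j is unchanged when Psi_F is applied to both arguments; [twist_rotate] proves
    this once. For F_j = N^i_j it handles the vertical part of the brackets. For F_j = y_j, where d
    y_j / d y^k = g_jk, it shows that y_i dx^i annihilates [Jx, Jy] - [x, y]. The other form, y_i
    delta y^i, is half of dL, so its kernel is closed under brackets; hence the difference stays in
    D_F.

    Two further tasks come from the global statement. A tangent vector is a family of components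
    over all charts, so a computation in one chart has a meaning only once the forms, Psi_F and the
    bracket are known to commute with transitions. And D_F must have smooth local frames of 2m - 2
    fields: where some y_i0 is nonzero, a basis of the hyperplane orthogonal to y_i is used once
    horizontally and once vertically. *)

Lemma near_eq_differentiable (R : realType) (V W : normedModType R)
    (f g : V -> W) (a : V) :
  (\near a, f a = g a) -> differentiable f a -> differentiable g a.
Proof.
move=> fg df.
have -> : g = f + (g - f) by rewrite addrC subrK.
apply: differentiableD => //.
set e := g - f.
(* [e] vanishes near [a], so this is a first-order expansion with zero linear part; uniqueness of
   the differential then makes [e] differentiable. *)
have e0 : e \o shift a = cst (e a) + \0 +o_ 0 id.
  apply/eqaddoP => _/posnumP[eps].
  have ea : e a = 0.
    by rewrite /e !fctE (nbhs_singleton fg) subrr.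
  have : \forall x \near 0, f (x + a) = g (x + a).
    move: fg; rewrite (near_shift 0) => H.
    rewrite subr0 in H; exact: H.
  apply: filterS => x fgx; rewrite !fctE /= ea !addr0 /e !fctE fgx subrr subr0.
  by rewrite normr0 mulr_ge0.
apply/diff_locallyP.
have c0 : continuous (\0 : V -> W) by move=> x; exact: cst_continuous.
by have -> := diff_unique c0 e0.
Qed.

Section Deriv.
Context {R : realType} {V W : normedModType R}.
Implicit Types (u v w : V).

Lemma eqon_differentiable (U : set V) (f g : V -> W) u :
  open U -> (forall x, U x -> f x = g x) -> U u ->
  differentiable f u -> differentiable g u.
Proof.
move=> Uo fg Uu; apply: near_eq_differentiable.
by apply: (filterS fg); exact: open_nbhs_nbhs.
Qed.

Lemma eqon_derive (U : set V) (f g : V -> W) u v :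
  open U -> (forall x, U x -> f x = g x) -> U u -> 'D_v f u = 'D_v g u.
Proof.
move=> Uo fg Uu; apply: near_eq_derive.
by apply: (filterS fg); exact: open_nbhs_nbhs.
Qed.

Lemma derive_dirD (f : V -> W) u v w : differentiable f u ->
  'D_(v + w) f u = 'D_v f u + 'D_w f u.
Proof. by move=> df; rewrite !deriveE // linearD. Qed.

Lemma derive_dirZ (f : V -> W) u v (c : R) : differentiable f u ->
  'D_(c *: v) f u = c *: 'D_v f u.
Proof. by move=> df; rewrite !deriveE // linearZ. Qed.

Lemma derive_dirN (f : V -> W) u v : differentiable f u ->
  'D_(- v) f u = - 'D_v f u.
Proof. by move=> df; rewrite !deriveE // linearN. Qed.

Lemma derive_dir_sum (f : V -> W) u I (r : seq I) (P : pred I) (v : I -> V) :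
  differentiable f u ->
  'D_(\sum_(i <- r | P i) v i) f u = \sum_(i <- r | P i) 'D_(v i) f u.
Proof.
move=> df; rewrite deriveE // linear_sum; apply: eq_bigr => i _.
by rewrite deriveE.
Qed.

Lemma derive_comp (X : normedModType R) (f : V -> W) (g : W -> X) u v :
  differentiable f u -> differentiable g (f u) ->
  'D_v (fun x => g (f x)) u = 'D_('D_v f u) g (f u).
Proof.
move=> df dg; rewrite deriveE; last exact: differentiable_comp.
by rewrite (diff_comp df dg) !deriveE.
Qed.

End Deriv.

Section DerivScalar.
Context {R : realType} {V : normedModType R}.
Implicit Types (f g : V -> R) (u v : V).

Lemma derive_add f g u v : differentiable f u -> differentiable g u ->
  'D_v (fun x => f x + g x) u = 'D_v f u + 'D_v g u.
Proof. by move=> df dg; rewrite -deriveD //; exact: diff_derivable. Qed.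

Lemma derive_opp f u v : differentiable f u ->
  'D_v (fun x => - f x) u = - 'D_v f u.
Proof. by move=> df; rewrite -deriveN //; exact: diff_derivable. Qed.

Lemma derive_mul f g u v : differentiable f u -> differentiable g u ->
  'D_v (fun x => f x * g x) u = 'D_v f u * g u + f u * 'D_v g u.
Proof.
move=> df dg; have -> : (fun x => f x * g x) = f * g by [].
rewrite deriveM; try exact: diff_derivable.
by rewrite addrC /GRing.scale /= mulrC.
Qed.

Lemma derive_mulc f (c : R) u v : differentiable f u ->
  'D_v (fun x => c * f x) u = c * 'D_v f u.
Proof.
by move=> df; rewrite derive_mul ?derive_cst ?mul0r ?add0r//; exact: differentiable_cst.
Qed.

Lemma differentiable_bigsum I (r : seq I) (P : pred I) (F : I -> V -> R) u :
  (forall i, differentiable (F i) u) ->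
  differentiable (fun x => \sum_(i <- r | P i) F i x) u.
Proof.
move=> dF; elim: r => [|i r IH].
  rewrite (_ : (fun _ => _) = cst 0); first exact: differentiable_cst.
  by apply/funext => x; rewrite big_nil.
rewrite (_ : (fun _ => _) = (fun x => (if P i then F i x else 0)) +
    (fun x => \sum_(i <- r | P i) F i x)).
  by apply: differentiableD => //; case: (P i) => //; exact: differentiable_cst.
by apply/funext => x; rewrite big_cons fctE; case: (P i); rewrite ?add0r.
Qed.

Lemma derive_bigsum I (r : seq I) (P : pred I) (F : I -> V -> R) u v :
  (forall i, differentiable (F i) u) ->
  'D_v (fun x => \sum_(i <- r | P i) F i x) u = \sum_(i <- r | P i) 'D_v (F i) u.
Proof.
move=> dF; elim: r => [|i r IH].
  rewrite big_nil (_ : (fun _ => _) = cst 0) ?derive_cst //.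
  by apply/funext => x; rewrite big_nil.
rewrite big_cons (_ : (fun _ => _) = fun x => (if P i then F i x else 0) +
    (\sum_(i <- r | P i) F i x)).
  rewrite derive_add ?IH //; last exact: differentiable_bigsum.
    by case: (P i) => //; rewrite derive_cst add0r.
  by case: (P i) => //; exact: differentiable_cst.
by apply/funext => x; rewrite big_cons; case: (P i); rewrite ?add0r.
Qed.

End DerivScalar.

Section RowVector.
Context {R : realType} {d : nat}.

Lemma row_sum_coord (v : 'rV[R]_d) : v = \sum_i v 0 i *: delta_mx 0 i.
Proof. exact: row_sum_delta. Qed.

Lemma derive_coord (V : normedModType R) (f : V -> 'rV[R]_d) u v i :
  differentiable f u -> 'D_v (fun x => f x 0 i) u = 'D_v f u 0 i.
Proof.
move=> df; rewrite derive_mx ?mxE //; exact: diff_derivable.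
Qed.

Lemma derive_proj (u v : 'rV[R]_d) i : 'D_v (fun x : 'rV[R]_d => x 0 i) u = v 0 i.
Proof.
by rewrite derive_coord ?derive_id //; exact: ex_diff.
Qed.

Lemma differentiable_row (V : normedModType R) (f : V -> 'rV[R]_d) u :
  (forall i, differentiable (fun x => f x 0 i) u) -> differentiable f u.
Proof.
move=> df.
rewrite (_ : f = \sum_i (fun x => f x 0 i *: (delta_mx 0 i : 'rV[R]_d))).
  by apply: differentiable_sum => i; exact: differentiableZl.
by apply/funext => x; rewrite fct_sumE [LHS]row_sum_coord.
Qed.

Lemma derive_partials (W : normedModType R) (f : 'rV[R]_d -> W) u v :
  differentiable f u ->
  'D_v f u = \sum_i v 0 i *: 'D_(delta_mx 0 i) f u.
Proof.
move=> df; rewrite [in LHS](row_sum_coord v) derive_dir_sum //.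
by apply: eq_bigr => i _; rewrite derive_dirZ.
Qed.

End RowVector.

(** * Symmetry of second derivatives *)

Lemma close_values (R : realType) (x y a b e : R) : a = b ->
  `|x - a| <= e / 2 -> `|y - b| <= e / 2 -> `|x - y| <= e.
Proof.
move=> -> xa yb; rewrite -(subrKA b) [leRHS]splitr.
by apply: le_trans (ler_normD _ _) _; rewrite lerD // distrC.
Qed.

Section Schwarz.
Context {R : realType} {V : normedModType R}.
Implicit Types (u v w : V).

(** Restriction to a line turns directional derivatives into derivatives in one real variable, for
    the mean value theorem here and for Euler's identity later. *)
Lemma is_derive_line (f : V -> R) (p w : V) (t : R) :
  differentiable f (p + t *: w) ->
  is_derive t 1 (fun s : R => f (p + s *: w)) ('D_w f (p + t *: w)).
Proof.
move=> df.
have dl : is_diff t (fun s : R => p + s *: w) (fun s : R => s *: w).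
  have := is_diffD (is_diff_cst p t) (is_diff_scalel t w).
  by rewrite (_ : 0 + _ = *:%R^~ w) //; apply/funext => s; rewrite !fctE add0r.
case: dl => dl1 dl2.
have dfl : differentiable (fun s : R => f (p + s *: w)) t.
  by apply: (@differentiable_comp _ _ _ _ (fun s : R => p + s *: w) f).
apply: DeriveDef; first exact: diff_derivable.
rewrite (@derive_comp _ _ _ _ (fun s : R => p + s *: w) f) //.
by rewrite [X in 'D_X f _](_ : _ = w) // deriveE // dl2 scale1r.
Qed.

Lemma MVT_diff (k dk : R -> R) (h : R) : 0 < h ->
  (forall t, 0 <= t <= h -> is_derive t 1 k (dk t)) ->
  exists2 t, 0 <= t <= h & k h - k 0 = dk t * h.
Proof.
move=> h0 kd.
have [||t] := @MVT R k dk 0 h h0.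
- by move=> x; rewrite in_itv /= => /andP[x0 xh]; apply: kd; rewrite !ltW.
- apply: derivable_within_continuous => x; rewrite in_itv /= => xh.
  by have [] := kd x xh.
by rewrite in_itv subr0 => /andP[t0 th] e; exists t => //; rewrite !ltW.
Qed.

(* The mean value theorem in the direction [w], then in the direction [v]. *)
Lemma second_difference (f : V -> R) (U : set V) u v w (h : R) : 0 < h ->
  (forall x, U x -> differentiable f x) ->
  (forall x, U x -> differentiable ('D_w f) x) ->
  (forall s t, 0 <= s <= h -> 0 <= t <= h -> U (u + s *: v + t *: w)) ->
  exists2 st : R * R, (0 <= st.1 <= h) && (0 <= st.2 <= h) &
   f (u + h *: v + h *: w) - f (u + h *: w) - f (u + h *: v) + f u
   = 'D_v ('D_w f) (u + st.1 *: v + st.2 *: w) * h * h.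
Proof.
move=> h0 df ddf hU.
have [hh z0] : 0 <= h <= h /\ 0 <= (0 : R) <= h by rewrite !lexx ltW.
have U0 t : 0 <= t <= h -> U (u + t *: w).
  by move=> th; have := hU 0 t z0 th; rewrite scale0r addr0.
have [|t th] := @MVT_diff (fun t => f (u + h *: v + t *: w) - f (u + t *: w))
  (fun t => 'D_w f (u + h *: v + t *: w) - 'D_w f (u + t *: w)) h h0.
  move=> t th; apply: is_deriveB; apply: is_derive_line; apply: df; first exact: hU.
  exact: U0.
rewrite !scale0r !addr0 => e1.
have [|s sh] := @MVT_diff (fun s => 'D_w f ((u + t *: w) + s *: v))
  (fun s => 'D_v ('D_w f) ((u + t *: w) + s *: v)) h h0.
  by move=> s sh; apply: is_derive_line; apply: ddf; rewrite addrAC; exact: hU.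
rewrite !scale0r !addr0 ![u + t *: w + _]addrAC => e2.
exists (s, t); first by rewrite sh th.
by rewrite /= -e2 -e1 opprB !addrA addrAC.
Qed.

Lemma near_parallelogram (P : set V) u v w : nbhs u P ->
  exists2 h : R, 0 < h &
    forall s t, 0 <= s <= h -> 0 <= t <= h -> P (u + s *: v + t *: w).
Proof.
move=> /nbhs_ballP[e /= e0 eP].
(* The summand 1 keeps [n] positive when both vectors vanish. With h = e / 2 / n, the displacement
   has norm at most h * n = e / 2. *)
pose n := `|v| + `|w| + 1.
have n0 : 0 < n by rewrite /n ltr_wpDl ?addr_ge0.
exists (e / 2 / n); first by rewrite !divr_gt0.
move=> s t /andP[s0 sh] /andP[t0 th]; apply: eP.
rewrite -ball_normE /= -addrA opprD addNKr normrN.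
apply: le_lt_trans (ler_normD _ _) _; rewrite !normrZ !ger0_norm //.
apply: (@le_lt_trans _ _ (e / 2 / n * n)).
  rewrite {2}/n !mulrDr mulr1 -[leLHS]addr0 !lerD ?ler_wpM2r //.
  by rewrite ltW // !divr_gt0.
by rewrite divfK ?gt_eqF // ltr_pdivrMr // ltr_pMr // ltr1n.
Qed.

(** The same second difference, divided by h^2, is a value of each mixed derivative at some point of
    a small parallelogram. By continuity at [u] both values are within e / 2 of those at [u], with
    [e] arbitrary. *)
Lemma derive_commute (f : V -> R) (U : set V) u v w : open U -> U u ->
  (forall x, U x -> differentiable f x) ->
  (forall x, U x -> differentiable ('D_w f) x) ->
  (forall x, U x -> differentiable ('D_v f) x) ->
  {for u, continuous ('D_v ('D_w f))} -> {for u, continuous ('D_w ('D_v f))} ->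
  'D_v ('D_w f) u = 'D_w ('D_v f) u.
Proof.
move=> Uo Uu df dwf dvf c1 c2.
apply/eqP; rewrite -subr_eq0 -normr_eq0 eq_le normr_ge0 andbT.
apply/ler_addgt0Pr => e e0; rewrite add0r.
have e20 : 0 < e / 2 by rewrite divr_gt0.
have Un : nbhs u U by exact: open_nbhs_nbhs.
have n1 : \forall x \near u, `|'D_v ('D_w f) u - 'D_v ('D_w f) x| <= e / 2.
  by move/cvgr_dist_le : c1; apply.
have n2 : \forall x \near u, `|'D_w ('D_v f) u - 'D_w ('D_v f) x| <= e / 2.
  by move/cvgr_dist_le : c2; apply.
have [h h0 hP] := near_parallelogram v w (filterI Un (filterI n1 n2)).
have [[s t] /= /andP[sh th] E1] := second_difference h0 df dwf
  (fun s t sh th => (hP s t sh th).1).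
have [|[s' t'] /= /andP[sh' th'] E2] := @second_difference f U u w v h h0 df dvf.
  by move=> a b ha hb; rewrite addrAC; apply: (hP b a hb ha).1.
have {E1 E2} E : 'D_v ('D_w f) (u + s *: v + t *: w) = 'D_w ('D_v f) (u + s' *: w + t' *: v).
  have hn : h != 0 by rewrite gt_eqF.
  move: E1; rewrite (addrAC _ (h *: v)) (addrAC (f _)) E2.
  by set A := 'D_w _ _; set B := 'D_v _ _ => /(mulIf hn)/(mulIf hn) ->.
have /= [_ [a1 _]] := hP _ _ sh th.
have /= [_ [_ a2]] := hP _ _ th' sh'.
rewrite addrAC in a2.
exact: (close_values E a1 a2).
Qed.

End Schwarz.

(** * Smooth functions *)

Section Upto.
Context {R : realType} {d : nat}.
Implicit Types (U : set 'rV[R]_d) (u v : 'rV[R]_d).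

(** Openness of [U] is what lets equality on [U] pass to the derivatives, which depend on a
    neighbourhood of each point. *)
Lemma upto_ext (W : normedModType R) k U (f g : 'rV[R]_d -> W) : open U ->
  (forall u, U u -> f u = g u) -> differentiable_upto k U f ->
  differentiable_upto k U g.
Proof.
move=> Uo; elim: k f g => //= k IH f g fg [df Df]; split.
  by move=> u Uu; apply: (eqon_differentiable Uo fg Uu); exact: df.
move=> i; apply: IH (Df i) => u Uu; exact: (eqon_derive _ Uo fg Uu).
Qed.

Lemma upto_weak (W : normedModType R) k U (f : 'rV[R]_d -> W) :
  differentiable_upto k.+1 U f -> differentiable_upto k U f.
Proof.
by elim: k f => //= k IH f [df Df]; split=> // i; apply: IH; exact: Df.
Qed.

Lemma upto_sub (W : normedModType R) k U U' (f : 'rV[R]_d -> W) : U' `<=` U ->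
  differentiable_upto k U f -> differentiable_upto k U' f.
Proof.
move=> sU; elim: k f => //= k IH f [df Df]; split; last by move=> i; exact: IH.
by move=> u /sU; exact: df.
Qed.

Lemma upto_cst (W : normedModType R) k U (c : W) :
  differentiable_upto k U (fun=> c).
Proof.
elim: k c => //= k IH c; split; first by move=> u _; exact: differentiable_cst.
move=> i; have -> : 'D_(delta_mx 0 i) (fun=> c) = (fun=> 0) :> ('rV[R]_d -> W).
  by apply/funext => u; exact: derive_cst.
exact: IH.
Qed.

Lemma upto_add k U (f g : 'rV[R]_d -> R) : open U ->
  differentiable_upto k U f -> differentiable_upto k U g ->
  differentiable_upto k U (fun u => f u + g u).
Proof.
move=> Uo; elim: k f g => //= k IH f g [df Df] [dg Dg]; split.
  by move=> u Uu; apply: differentiableD; [exact: df|exact: dg].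
move=> i; apply: (upto_ext Uo) (IH _ _ (Df i) (Dg i)) => u Uu.
by rewrite derive_add //; [exact: df|exact: dg].
Qed.

Lemma upto_mul k U (f g : 'rV[R]_d -> R) : open U ->
  differentiable_upto k U f -> differentiable_upto k U g ->
  differentiable_upto k U (fun u => f u * g u).
Proof.
move=> Uo; elim: k f g => // k IH f g sf sg.
have [df Df] := sf; have [dg Dg] := sg; split.
  by move=> u Uu; apply: differentiableM; [exact: df|exact: dg].
move=> i; have := upto_add Uo (IH _ _ (Df i) (upto_weak sg)) (IH _ _ (upto_weak sf) (Dg i)).
by apply: (upto_ext Uo) => u Uu; rewrite derive_mul //; [exact: df|exact: dg].
Qed.

Lemma upto_inv k U (f : 'rV[R]_d -> R) : open U -> (forall u, U u -> f u != 0) ->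
  differentiable_upto k U f -> differentiable_upto k U (fun u => (f u)^-1).
Proof.
move=> Uo f0; elim: k f f0 => // k IH f f0 sf; have [df Df] := sf; split.
  by move=> u Uu; apply: differentiableV; [exact: df|exact: f0].
(* The derivative -(1/f)^2 f' contains 1/f again, but only to order [k], where the induction
   hypothesis applies. *)
move=> i; have sV := IH _ f0 (upto_weak sf).
have := upto_mul Uo (upto_mul Uo (upto_cst k U (- 1 : R)) (upto_mul Uo sV sV)) (Df i).
apply: (upto_ext Uo) => u Uu.
rewrite deriveV; [|exact: f0|by apply: diff_derivable; exact: df].
by rewrite /GRing.scale /= mulN1r expr2 invfM.
Qed.

Lemma upto_sum k U I (r : seq I) (P : pred I) (F : I -> 'rV[R]_d -> R) : open U ->
  (forall i, differentiable_upto k U (F i)) ->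
  differentiable_upto k U (fun u => \sum_(i <- r | P i) F i u).
Proof.
move=> Uo sF; elim: r => [|i r IH].
  by apply: (upto_ext Uo) (upto_cst k U (0 : R)) => u _; rewrite big_nil.
case Pi: (P i); last by apply: (upto_ext Uo) IH => u _; rewrite big_cons Pi.
by apply: (upto_ext Uo) (upto_add Uo (sF i) IH) => u _; rewrite big_cons Pi.
Qed.

Lemma upto_prod k U I (r : seq I) (P : pred I) (F : I -> 'rV[R]_d -> R) : open U ->
  (forall i, differentiable_upto k U (F i)) ->
  differentiable_upto k U (fun u => \prod_(i <- r | P i) F i u).
Proof.
move=> Uo sF; elim: r => [|i r IH].
  by apply: (upto_ext Uo) (upto_cst k U (1 : R)) => u _; rewrite big_nil.
case Pi: (P i); last by apply: (upto_ext Uo) IH => u _; rewrite big_cons Pi.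
by apply: (upto_ext Uo) (upto_mul Uo (sF i) IH) => u _; rewrite big_cons Pi.
Qed.

Lemma upto_proj k U i : differentiable_upto k U (fun u => u 0 i : R).
Proof.
case: k => //= k; split; first by move=> u _; exact: differentiable_coord.
move=> j; have -> : 'D_(delta_mx 0 j) (fun u => u 0 i : R)
    = (fun=> (delta_mx 0 j : 'rV[R]_d) 0 i).
  by apply/funext => u; rewrite derive_proj.
exact: upto_cst.
Qed.

Lemma upto_row e k U (f : 'rV[R]_d -> 'rV[R]_e) : open U ->
  differentiable_upto k U f <->
  forall i, differentiable_upto k U (fun u => f u 0 i : R).
Proof.
move=> Uo; elim: k f => //= k IH f; split.
  move=> [df Df] i; split.
    move=> u Uu; apply: (@differentiable_comp _ _ _ _ f (fun w : 'rV[R]_e => w 0 i : R)).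
      exact: df.
    exact: differentiable_coord.
  move=> j; move/IH: (Df j) => /(_ i); apply: (upto_ext Uo) => u Uu.
  by rewrite derive_coord //; exact: df.
move=> H.
have df u : U u -> differentiable f u.
  by move=> Uu; apply: differentiable_row => i; exact: (H i).1.
split=> // j; apply/IH => i.
apply: (upto_ext Uo) ((H i).2 j) => u Uu.
by rewrite derive_coord //; exact: df.
Qed.

End Upto.

Lemma upto_comp (R : realType) d e k (U : set 'rV[R]_d) (U' : set 'rV[R]_e)
    (f : 'rV[R]_d -> 'rV[R]_e) (g : 'rV[R]_e -> R) : open U -> open U' ->
  (forall u, U u -> U' (f u)) ->
  differentiable_upto k U f -> differentiable_upto k U' g ->
  differentiable_upto k U (fun u => g (f u)).
Proof.
move=> Uo Uo' fU; elim: k f g fU => // k IH f g fU sf sg.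
have [df Df] := sf; have [dg Dg] := sg; split.
  by move=> u Uu; apply: (@differentiable_comp _ _ _ _ f g); [exact: df|exact/dg/fU].
move=> i.
have H : differentiable_upto k U (fun u => \sum_j ('D_(delta_mx 0 i) f u) 0 j *
    'D_(delta_mx 0 j) g (f u)).
  apply: upto_sum => // j; apply: upto_mul => //.
    by move/(upto_row _ _ Uo): (Df i); exact.
  exact: (IH _ _ fU (upto_weak sf) (Dg j)).
apply: (upto_ext Uo) H => u Uu.
have dgu : differentiable g (f u) by exact/dg/fU.
by rewrite (derive_comp _ (df _ Uu)) // (derive_partials _ dgu).
Qed.

Section Smooth.
Context {R : realType} {d : nat}.
Implicit Types (U : set 'rV[R]_d) (u v : 'rV[R]_d).

Section VectorValued.
Context {W : normedModType R}.
Implicit Type f : 'rV[R]_d -> W.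

Lemma smooth_diff U f u : smooth_on U f -> U u -> differentiable f u.
Proof. by move=> /(_ 1) [df _]; exact: df. Qed.

Lemma smooth_ext U f g : open U -> (forall u, U u -> f u = g u) ->
  smooth_on U f -> smooth_on U g.
Proof. by move=> Uo fg sf k; apply: (upto_ext Uo fg). Qed.

Lemma smooth_sub U U' f : U' `<=` U -> smooth_on U f -> smooth_on U' f.
Proof. by move=> sU sf k; apply: (upto_sub sU). Qed.

Lemma smooth_cst U (c : W) : smooth_on U (fun=> c).
Proof. by move=> k; exact: upto_cst. Qed.

End VectorValued.

Implicit Types f g : 'rV[R]_d -> R.

Lemma smooth_add U f g : open U -> smooth_on U f -> smooth_on U g ->
  smooth_on U (fun u => f u + g u).
Proof. by move=> Uo sf sg k; exact: upto_add. Qed.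

Lemma smooth_mul U f g : open U -> smooth_on U f -> smooth_on U g ->
  smooth_on U (fun u => f u * g u).
Proof. by move=> Uo sf sg k; exact: upto_mul. Qed.

Lemma smooth_opp U f : open U -> smooth_on U f -> smooth_on U (fun u => - f u).
Proof.
move=> Uo sf; apply: (smooth_ext Uo) (smooth_mul Uo (smooth_cst U (-1 : R)) sf).
by move=> u _; rewrite mulN1r.
Qed.

Lemma smooth_inv U f : open U -> (forall u, U u -> f u != 0) ->
  smooth_on U f -> smooth_on U (fun u => (f u)^-1).
Proof. by move=> Uo f0 sf k; exact: upto_inv. Qed.

Lemma smooth_sum U I (r : seq I) (P : pred I) (F : I -> 'rV[R]_d -> R) : open U ->
  (forall i, smooth_on U (F i)) ->
  smooth_on U (fun u => \sum_(i <- r | P i) F i u).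
Proof. by move=> Uo sF k; apply: upto_sum => // i; exact: sF. Qed.

Lemma smooth_prod U I (r : seq I) (P : pred I) (F : I -> 'rV[R]_d -> R) : open U ->
  (forall i, smooth_on U (F i)) ->
  smooth_on U (fun u => \prod_(i <- r | P i) F i u).
Proof. by move=> Uo sF k; apply: upto_prod => // i; exact: sF. Qed.

Lemma smooth_proj U i : smooth_on U (fun u => u 0 i : R).
Proof. by move=> k; exact: upto_proj. Qed.

Lemma smooth_row e U (f : 'rV[R]_d -> 'rV[R]_e) : open U ->
  smooth_on U f <-> forall i, smooth_on U (fun u => f u 0 i : R).
Proof.
move=> Uo; split=> [sf i k|sf k]; first by apply/(upto_row _ _ Uo): i; exact: sf.
by apply/(upto_row _ _ Uo) => i; exact: sf.
Qed.

Lemma smooth_derive U f v : open U -> smooth_on U f -> smooth_on U ('D_v f).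
Proof.
move=> Uo sf; have H : smooth_on U (fun u => \sum_i v 0 i * 'D_(delta_mx 0 i) f u).
  apply: smooth_sum => // i; apply: smooth_mul => //; first exact: smooth_cst.
  by move=> k; exact: (sf k.+1).2.
apply: (smooth_ext Uo) H => u Uu.
by rewrite [RHS]derive_partials //; exact: smooth_diff sf _.
Qed.

Lemma smooth_derive_row e U (f : 'rV[R]_d -> 'rV[R]_e) v : open U ->
  smooth_on U f -> smooth_on U ('D_v f).
Proof.
move=> Uo sf; apply/smooth_row => // i.
have := smooth_derive v Uo ((smooth_row _ Uo).1 sf i).
apply: smooth_ext => // u Uu; rewrite derive_coord //; exact: smooth_diff sf _.
Qed.

Lemma smooth_derive_along e U (f : 'rV[R]_d -> 'rV[R]_e) (x : 'rV[R]_d -> 'rV[R]_d) :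
  open U -> smooth_on U f -> smooth_on U x -> smooth_on U (fun u => 'D_(x u) f u).
Proof.
move=> Uo sf sx; apply/smooth_row => // i.
have H : smooth_on U (fun u => \sum_j x u 0 j * ('D_(delta_mx 0 j) f u) 0 i).
  apply: smooth_sum => // j; apply: smooth_mul => //; first exact: (smooth_row _ Uo).1.
  by apply: (smooth_row _ Uo).1; exact: smooth_derive_row.
apply: smooth_ext H => // u Uu.
rewrite [in RHS]derive_partials; last exact: smooth_diff sf _.
by rewrite summxE; apply: eq_bigr => j _; rewrite mxE.
Qed.

Lemma smooth_det U n (A : 'rV[R]_d -> 'M[R]_n) : open U ->
  (forall i j, smooth_on U (fun u => A u i j : R)) ->
  smooth_on U (fun u => \det (A u) : R).
Proof.
move=> Uo sA; rewrite /determinant; apply: smooth_sum => // s.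
by apply: smooth_mul => //; [exact: smooth_cst|apply: smooth_prod].
Qed.

Lemma smooth_invmx U n (A : 'rV[R]_d -> 'M[R]_n) : open U ->
  (forall u, U u -> A u \in unitmx) ->
  (forall i j, smooth_on U (fun u => A u i j : R)) ->
  forall i j, smooth_on U (fun u => invmx (A u) i j : R).
Proof.
move=> Uo uA sA i j.
(* Cramer's rule: the determinant and the cofactors are polynomials in the entries. *)
have H : smooth_on U (fun u => (\det (A u))^-1 * cofactor (A u) j i).
  apply: smooth_mul => //.
    apply: smooth_inv => //; last exact: smooth_det.
    by move=> u Uu; have := uA u Uu; rewrite unitmxE unitfE.
  rewrite /cofactor; apply: smooth_mul => //; first exact: smooth_cst.
  apply: smooth_det => // i' j'.
  by apply: (smooth_ext Uo) (sA (lift j i') (lift i j')) => u _; rewrite !mxE.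
by apply: smooth_ext H => // u Uu; rewrite /invmx uA // !mxE.
Qed.

Lemma smooth_derive_commute U f u v w : open U -> U u -> smooth_on U f ->
  'D_v ('D_w f) u = 'D_w ('D_v f) u.
Proof.
move=> Uo Uu sf; apply: (derive_commute Uo Uu).
- by move=> x; exact: smooth_diff.
- by move=> x; apply: smooth_diff; exact: smooth_derive.
- by move=> x; apply: smooth_diff; exact: smooth_derive.
- apply: differentiable_continuous; apply: smooth_diff Uu.
  by do 2 apply: smooth_derive => //.
- apply: differentiable_continuous; apply: smooth_diff Uu.
  by do 2 apply: smooth_derive => //.
Qed.

End Smooth.

Section SmoothComp.
Context {R : realType} {d e : nat}.

Lemma smooth_comp (U : set 'rV[R]_d) (U' : set 'rV[R]_e)
    (f : 'rV[R]_d -> 'rV[R]_e) (g : 'rV[R]_e -> R) : open U -> open U' ->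
  (forall u, U u -> U' (f u)) -> smooth_on U f -> smooth_on U' g ->
  smooth_on U (fun u => g (f u)).
Proof. by move=> Uo Uo' fU sf sg k; exact: (upto_comp Uo Uo' fU). Qed.

Lemma smooth_comp_row n (U : set 'rV[R]_d) (U' : set 'rV[R]_e)
    (f : 'rV[R]_d -> 'rV[R]_e) (g : 'rV[R]_e -> 'rV[R]_n) : open U -> open U' ->
  (forall u, U u -> U' (f u)) -> smooth_on U f -> smooth_on U' g ->
  smooth_on U (fun u => g (f u)).
Proof.
move=> Uo Uo' fU sf sg; apply/smooth_row => // i.
by apply: (@smooth_comp _ _ _ (fun w => g w 0 i) Uo Uo' fU sf); exact: (smooth_row _ Uo').1.
Qed.

End SmoothComp.

(* ['D_v f] with values in [R] itself rather than in [R] seen as a normed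
   module, and locked so that unification never unfolds the limit. *)
HB.lock Definition dd (R : realType) (d : nat) (v : 'rV[R]_d) (f : 'rV[R]_d -> R)
  (u : 'rV[R]_d) : R := 'D_v f u.

Lemma ddE (R : realType) (d : nat) (v : 'rV[R]_d) (f : 'rV[R]_d -> R) u :
  dd v f u = 'D_v f u.
Proof. by rewrite unlock. Qed.

Lemma ddxE (R : realType) m (i : 'I_m) (f : 'rV[R]_(m + m) -> R) u :
  ddx i f u = dd (ex i) f u.
Proof. by rewrite unlock. Qed.

Lemma ddyE (R : realType) m (i : 'I_m) (f : 'rV[R]_(m + m) -> R) u :
  ddy i f u = dd (ey i) f u.
Proof. by rewrite unlock. Qed.

Section ScalarDerivative.
Context {R : realType} {d : nat} (U : set 'rV[R]_d) (hU : open U).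
Implicit Types (u v w : 'rV[R]_d) (f g : 'rV[R]_d -> R).

Let ddF v f : dd v f = 'D_v f.
Proof. by apply/funext => u; rewrite ddE. Qed.

(** Unfolds [dd] also under the binder of a sum, where the direction or the function is a bound
    variable. *)
Let ddF2 : @dd R d = fun v f u => 'D_v f u.
Proof. by apply/funext => v; apply/funext => f; exact: ddF. Qed.

Lemma smooth_dd f v : smooth_on U f -> smooth_on U (dd v f).
Proof. rewrite ?ddF ?ddE; exact: smooth_derive. Qed.

Lemma dd_ext f g v u : (forall w, U w -> f w = g w) -> U u -> dd v f u = dd v g u.
Proof. rewrite ?ddF ?ddE; exact: eqon_derive. Qed.

Lemma dd_dirD f v w u : smooth_on U f -> U u ->
  dd (v + w) f u = dd v f u + dd w f u.
Proof. by move=> sf Uu; rewrite ?ddF ?ddE; apply: derive_dirD; exact: smooth_diff Uu. Qed.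

Lemma dd_dirZ f (c : R) v u : smooth_on U f -> U u ->
  dd (c *: v) f u = c * dd v f u.
Proof. by move=> sf Uu; rewrite ?ddF ?ddE; apply: derive_dirZ; exact: smooth_diff Uu. Qed.

Lemma dd_dirN f v u : smooth_on U f -> U u -> dd (- v) f u = - dd v f u.
Proof. by move=> sf Uu; rewrite ?ddF ?ddE; apply: derive_dirN; exact: smooth_diff Uu. Qed.

Lemma dd_dirB f v w u : smooth_on U f -> U u ->
  dd (v - w) f u = dd v f u - dd w f u.
Proof. by move=> sf Uu; rewrite dd_dirD // dd_dirN. Qed.

Lemma dd_dir_sum f I (r : seq I) (P : pred I) (v : I -> 'rV[R]_d) u :
  smooth_on U f -> U u ->
  dd (\sum_(i <- r | P i) v i) f u = \sum_(i <- r | P i) dd (v i) f u.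
Proof. by move=> sf Uu; rewrite ddF2; apply: derive_dir_sum; exact: smooth_diff Uu. Qed.

Lemma dd_partials f v u : smooth_on U f -> U u ->
  dd v f u = \sum_i v 0 i * dd (delta_mx 0 i) f u.
Proof. by move=> sf Uu; rewrite ddF2; apply: derive_partials; exact: smooth_diff Uu. Qed.

Lemma dd_add f g v u : smooth_on U f -> smooth_on U g -> U u ->
  dd v (fun w => f w + g w) u = dd v f u + dd v g u.
Proof. by move=> sf sg Uu; rewrite ?ddF ?ddE; apply: derive_add; exact: smooth_diff Uu. Qed.

Lemma dd_opp f v u : smooth_on U f -> U u -> dd v (fun w => - f w) u = - dd v f u.
Proof. by move=> sf Uu; rewrite ?ddF ?ddE; apply: derive_opp; exact: smooth_diff Uu. Qed.

Lemma dd_mul f g v u : smooth_on U f -> smooth_on U g -> U u ->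
  dd v (fun w => f w * g w) u = dd v f u * g u + f u * dd v g u.
Proof. by move=> sf sg Uu; rewrite ?ddF ?ddE; apply: derive_mul; exact: smooth_diff Uu. Qed.

Lemma dd_cst (c : R) v u : dd v (fun=> c) u = 0.
Proof. rewrite ?ddF ?ddE; exact: derive_cst. Qed.

Lemma dd_mulc f (c : R) v u : smooth_on U f -> U u ->
  dd v (fun w => c * f w) u = c * dd v f u.
Proof. by move=> sf Uu; rewrite ?ddF ?ddE; apply: derive_mulc; exact: smooth_diff Uu. Qed.

Lemma dd_sum I (r : seq I) (P : pred I) (F : I -> 'rV[R]_d -> R) v u :
  (forall i, smooth_on U (F i)) -> U u ->
  dd v (fun w => \sum_(i <- r | P i) F i w) u = \sum_(i <- r | P i) dd v (F i) u.
Proof. by move=> sF Uu; rewrite ddF2; apply: derive_bigsum => i; exact: smooth_diff Uu. Qed.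

Lemma dd_proj i v u : dd v (fun w => w 0 i) u = v 0 i.
Proof. rewrite ?ddF ?ddE; exact: derive_proj. Qed.

Lemma derive_rowE e (f : 'rV[R]_d -> 'rV[R]_e) v u i : smooth_on U f -> U u ->
  ('D_v f u) 0 i = dd v (fun w => f w 0 i) u.
Proof. by move=> sf Uu; rewrite ddE derive_coord //; exact: smooth_diff Uu. Qed.

Lemma dd_commute f v w u : smooth_on U f -> U u ->
  dd v (dd w f) u = dd w (dd v f) u.
Proof. by move=> sf Uu; rewrite !ddF; exact: (smooth_derive_commute _ _ hU). Qed.

End ScalarDerivative.

Lemma dd_comp (R : realType) d e (U : set 'rV[R]_d) (U' : set 'rV[R]_e)
    (f : 'rV[R]_d -> 'rV[R]_e) (g : 'rV[R]_e -> R) v u :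
  smooth_on U f -> smooth_on U' g -> U u -> U' (f u) ->
  dd v (fun w => g (f w)) u = dd ('D_v f u) g (f u).
Proof.
move=> sf sg Uu Ufu; rewrite !ddE.
exact: derive_comp (smooth_diff sf Uu) (smooth_diff sg Ufu).
Qed.

Lemma smooth_dd_along (R : realType) d (U : set 'rV[R]_d) (f : 'rV[R]_d -> R)
    (x : 'rV[R]_d -> 'rV[R]_d) : open U ->
  smooth_on U f -> smooth_on U x -> smooth_on U (fun u => dd (x u) f u).
Proof.
move=> Uo sf sx.
have H : smooth_on U (fun u => \sum_i x u 0 i * dd (delta_mx 0 i) f u).
  apply: smooth_sum => // i; apply: smooth_mul => //; last exact: smooth_dd.
  exact: (smooth_row _ Uo).1.
by apply: (smooth_ext Uo) H => u Uu; rewrite [RHS](dd_partials _ sf).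
Qed.

Ltac smooth_step :=
  first [ assumption
        | match goal with H : context [smooth_on] |- _ => exact: H end
        | exact: smooth_cst | exact: smooth_proj
        | apply: smooth_add => // | apply: smooth_opp => //
        | apply: smooth_mul => // | apply: smooth_sum => // ?
        | apply: smooth_dd => // | apply: smooth_dd_along => // ].
Ltac smooth := repeat smooth_step.

(** * The Lie bracket as a commutator of derivations *)

Section LieDerivative.
Context {R : realType} {d : nat} (U : set 'rV[R]_d) (hU : open U).
Implicit Types (u v : 'rV[R]_d).

(** Product rule for the components of [x] against the partial derivatives of [f]; in the last term
    the direction is frozen at [x u]. *)
Lemma dd_dd_along (x : 'rV[R]_d -> 'rV[R]_d) (f : 'rV[R]_d -> R) u v :
  U u -> smooth_on U x -> smooth_on U f ->
  dd v (fun w => dd (x w) f w) u = dd ('D_v x u) f u + dd v (dd (x u) f) u.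
Proof.
move=> Uu sx sf.
have sxi i := (smooth_row _ hU).1 sx i.
rewrite (dd_ext hU (g := fun w => \sum_i x w 0 i * dd (delta_mx 0 i) f w)) //;
  last by move=> w Uw; exact: dd_partials Uw.
rewrite [X in _ = X + _](dd_partials _ sf) //.
rewrite [X in _ = _ + X](dd_ext hU (g := fun w => \sum_i x u 0 i * dd (delta_mx 0 i) f w)) //;
  last by move=> w Uw; exact: dd_partials Uw.
rewrite !(dd_sum _ _ _ _ Uu); try by move=> i; smooth.
rewrite -big_split; apply: eq_bigr => i _ /=.
rewrite (dd_mulc _ _ _ Uu); last by smooth.
rewrite (dd_mul _ _ _ Uu); try by smooth.
by rewrite (derive_rowE _ _ sx Uu).
Qed.

(** The second-order terms cancel by symmetry of second derivatives. *)
Lemma dd_lie (x y : 'rV[R]_d -> 'rV[R]_d) (f : 'rV[R]_d -> R) u :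
  U u -> smooth_on U x -> smooth_on U y -> smooth_on U f ->
  dd ('D_(x u) y u - 'D_(y u) x u) f u =
  dd (x u) (fun w => dd (y w) f w) u - dd (y u) (fun w => dd (x w) f w) u.
Proof.
move=> Uu sx sy sf.
rewrite (dd_dd_along (x u) Uu sy sf) (dd_dd_along (y u) Uu sx sf).
rewrite (dd_commute hU (y u) (x u) sf Uu).
move: ('D_(x u) y u) ('D_(y u) x u) => v w.
by rewrite (dd_dirB _ _ sf Uu) opprD addrACA subrr addr0.
Qed.

End LieDerivative.

(** * The Cartan connection in a chart *)

Section LocalFinslerTheory.
Context {R : realType} {m : nat}.
Variables (U : set 'rV[R]_(m + m)) (L : 'rV[R]_(m + m) -> R).
Hypotheses (hU : open U) (sL : smooth_on U L).
Hypothesis euler : forall u, U u -> dd (row_mx 0 (rsubmx u)) L u = 2 * L u.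
Hypothesis gunit : forall u, U u -> gmx L u \in unitmx.

Implicit Types (i j k a l : 'I_m) (u v : 'rV[R]_(m + m)).
Let Y i u : R := u 0 (rshift m i).

Let sY i : smooth_on U (Y i). Proof. exact: smooth_proj. Qed.
Hint Resolve sY sL : core.

Lemma y_upE i u : y_up i u = u 0 (rshift m i).
Proof. by rewrite /y_up mxE. Qed.

Lemma ddy_fun i (f : 'rV[R]_(m + m) -> R) : ddy i f = dd (ey i) f.
Proof. by apply/funext => u; rewrite ddyE. Qed.

Lemma exY i k : (ex k : 'rV[R]_(m + m)) 0 (rshift m i) = 0.
Proof. by rewrite /ex row_mxEr mxE. Qed.

Lemma eyY i k : (ey k : 'rV[R]_(m + m)) 0 (rshift m i) = (i == k)%:R.
Proof. by rewrite /ey row_mxEr mxE. Qed.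

Lemma exX i k : (ex k : 'rV[R]_(m + m)) 0 (lshift m i) = (i == k)%:R.
Proof. by rewrite /ex row_mxEl mxE. Qed.

Lemma eyX i k : (ey k : 'rV[R]_(m + m)) 0 (lshift m i) = 0.
Proof. by rewrite /ey row_mxEl mxE. Qed.

Lemma row_mx0_sum (v : 'rV[R]_m) : row_mx 0 v = \sum_j v 0 j *: ey j.
Proof.
apply/rowP => i; rewrite summxE; case: (split_ordP i) => k ->.
  by rewrite row_mxEl mxE big1 // => j _; rewrite mxE eyX mulr0.
rewrite row_mxEr (bigD1 k) //= mxE eyY eqxx mulr1 big1 ?addr0 // => j jk.
by rewrite mxE eyY eq_sym (negbTE jk) mulr0.
Qed.

Lemma euler_sum u : U u -> \sum_j Y j u * dd (ey j) L u = 2 * L u.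
Proof.
move=> Uu; rewrite -euler // row_mx0_sum (dd_dir_sum _ _ _ sL Uu).
by apply: eq_bigr => j _; rewrite (dd_dirZ _ _ sL Uu) mxE.
Qed.

(** Euler's identity differentiated in an arbitrary direction; the coordinate directions give the
    next two lemmas. *)
Lemma dd_euler v u : U u ->
  \sum_j (v 0 (rshift m j) * dd (ey j) L u + Y j u * dd v (dd (ey j) L) u)
  = 2 * dd v L u.
Proof.
move=> Uu; rewrite -(dd_mulc _ _ sL Uu) -(dd_ext hU _ euler_sum Uu).
rewrite (dd_sum _ _ _ _ Uu); last by move=> j; smooth.
by apply: eq_bigr => j _; rewrite (dd_mul _ _ _ Uu) ?dd_proj //; smooth.
Qed.

Lemma euler_ex i u : U u -> \sum_j Y j u * dd (ex i) (dd (ey j) L) u = 2 * dd (ex i) L u.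
Proof.
move=> Uu; rewrite -dd_euler //; apply: eq_bigr => j _.
by rewrite exY mul0r add0r.
Qed.

(** Homogeneity of degree one of d L / d y^i: differentiating the factor y^j produces one of the two
    copies on the right of [dd_euler]. *)
Lemma euler_ey i u : U u -> \sum_j Y j u * dd (ey i) (dd (ey j) L) u = dd (ey i) L u.
Proof.
move=> Uu; have := dd_euler (ey i) Uu; rewrite big_split /= (bigD1 i) //=.
rewrite eyY eqxx mul1r big1 ?addr0 => [|j ji]; last by rewrite eyY (negbTE ji) mul0r.
lra.
Qed.

Lemma gE i j u : g L i j u = 2^-1 * dd (ey i) (dd (ey j) L) u.
Proof. by rewrite /g mxE ddyE ddy_fun. Qed.

Lemma gC i j u : U u -> g L i j u = g L j i u.
Proof. by move=> Uu; rewrite !gE (dd_commute hU _ _ sL Uu). Qed.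

Lemma smooth_g i j : smooth_on U (g L i j).
Proof.
have -> : g L i j = fun u => 2^-1 * dd (ey i) (dd (ey j) L) u.
  by apply/funext => u; exact: gE.
by smooth.
Qed.
Hint Resolve smooth_g : core.

Lemma smooth_g_inv i j : smooth_on U (g_inv L i j).
Proof. by apply: smooth_invmx => // k l; exact: smooth_g. Qed.
Hint Resolve smooth_g_inv : core.

(** Trades the contraction with the metric for a derivative of [L], so that derivatives of y_i
    become second derivatives of [L]. *)
Lemma y_lowE i u : U u -> y_low L i u = 2^-1 * dd (ey i) L u.
Proof.
move=> Uu; rewrite /y_low -euler_ey // mulr_sumr; apply: eq_bigr => j _.
by rewrite gE y_upE -mulrA [Y j u * _]mulrC.
Qed.

Lemma y_low_sum u : U u -> \sum_i y_low L i u * Y i u = L u.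
Proof.
move=> Uu; have := euler_sum Uu.
under [in X in _ -> X]eq_bigr => i _ do rewrite y_lowE // -mulrA [_ * Y i u]mulrC.
by rewrite -mulr_sumr => ->; rewrite mulKf // pnatr_eq0.
Qed.

Lemma smooth_y_low i : smooth_on U (y_low L i).
Proof.
have H : smooth_on U (fun u => 2^-1 * dd (ey i) L u) by smooth.
by apply: (smooth_ext hU) H => u Uu; rewrite y_lowE.
Qed.

Lemma smooth_gamma00 i : smooth_on U (gamma00 L i).
Proof.
have -> : gamma00 L i = fun u => \sum_j \sum_k (2^-1 * \sum_a g_inv L i a u *
    (dd (ex j) (g L a k) u + dd (ex k) (g L j a) u + - dd (ex a) (g L j k) u))
    * Y j u * Y k u.
  apply/funext => u; apply: eq_bigr => j _; apply: eq_bigr => k _.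
  rewrite !y_upE /gamma; congr (_ * _ * _ * _); apply: eq_bigr => a _.
  by rewrite !ddxE.
by smooth; do ?[exact: sY]; do ?[exact: smooth_g]; exact: smooth_g_inv.
Qed.

Lemma smooth_Nc i j : smooth_on U (Nc L i j).
Proof.
have -> : Nc L i j = fun u => 2^-1 * dd (ey j) (gamma00 L i) u.
  by apply/funext => u; rewrite /Nc ddyE.
by have sg := smooth_gamma00; smooth.
Qed.

(* The Euler-Lagrange equation of [L]; as [g] is invertible, it determines the
   spray coefficients [gamma00]. *)
Lemma spray_eq k u : U u -> \sum_i 2 * g L k i u * gamma00 L i u =
  \sum_j Y j u * dd (ex j) (dd (ey k) L) u - dd (ex k) L u.
Proof.
move=> Uu.
pose T a j l := dd (ex j) (g L a l) u + dd (ex l) (g L j a) u - dd (ex a) (g L j l) u.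
(* [T] is twice the Christoffel symbol of the first kind. The spray coefficients are half of g^-1 S,
   so the left-hand side is the entry [k] of [S]. *)
pose S : 'cV[R]_m := \col_a \sum_j \sum_l T a j l * Y j u * Y l u.
have gam i : gamma00 L i u = 2^-1 * (invmx (gmx L u) *m S) i 0.
  rewrite /gamma00 mxE mulr_sumr.
  under [RHS]eq_bigr => a _ do rewrite mxE !mulr_sumr.
  rewrite [RHS]exchange_big; apply: eq_bigr => j _ /=.
  under [RHS]eq_bigr => a _ do rewrite !mulr_sumr.
  rewrite [RHS]exchange_big; apply: eq_bigr => l _ /=.
  rewrite /gamma !y_upE mulr_sumr !mulr_suml; apply: eq_bigr => a _.
  by rewrite /g_inv /T !ddxE !mulrA.
have -> : \sum_i 2 * g L k i u * gamma00 L i u = S k 0.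
  rewrite -[S](mulKVmx (gunit Uu)) mxE; apply: eq_bigr => i _.
  by rewrite gam -/(g L k i u); field.
have dg v i j : dd v (g L i j) u = 2^-1 * dd v (dd (ey i) (dd (ey j) L)) u.
  rewrite -(dd_mulc _ _ _ Uu); last by smooth.
  by apply: (dd_ext hU) Uu => w _; exact: gE.
have e1 v i : \sum_l (v 0 (rshift m l) * dd (ey i) (dd (ey l) L) u +
    Y l u * dd v (dd (ey i) (dd (ey l) L)) u) = dd v (dd (ey i) L) u.
  rewrite -(dd_ext hU _ (@euler_ey i) Uu) (dd_sum _ _ _ _ Uu); last by move=> j; smooth.
  by apply: eq_bigr => j _; rewrite (dd_mul _ _ _ Uu) ?dd_proj //; smooth.
have e2 i j : \sum_l Y l u * dd (ex j) (g L i l) u = 2^-1 * dd (ex j) (dd (ey i) L) u.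
  rewrite -e1 mulr_sumr; apply: eq_bigr => l _; rewrite dg exY mul0r add0r.
  by rewrite mulrCA.
have gs v i j : dd v (g L i j) u = dd v (g L j i) u.
  by apply: (dd_ext hU) Uu => w; exact: gC.
rewrite mxE.
(* Exchanging [j] and [l] shows that the two positive terms of [T] have the same sum. *)
have -> : \sum_j \sum_l T k j l * Y j u * Y l u =
   \sum_j Y j u * (\sum_l Y l u * dd (ex j) (g L k l) u)
   + \sum_j Y j u * (\sum_l Y l u * dd (ex j) (g L k l) u)
   - \sum_j Y j u * (\sum_l Y l u * dd (ex k) (g L j l) u).
  have -> : \sum_j Y j u * (\sum_l Y l u * dd (ex j) (g L k l) u) +
     \sum_j Y j u * (\sum_l Y l u * dd (ex j) (g L k l) u) =
     \sum_j \sum_l (Y j u * Y l u * dd (ex j) (g L k l) u + Y j u * Y l u * dd (ex l) (g L j k) u).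
    under [RHS]eq_bigr => j _ do rewrite big_split.
    rewrite [RHS]big_split; congr (_ + _); last rewrite exchange_big;
      apply: eq_bigr => j _; rewrite mulr_sumr; apply: eq_bigr => l _.
      by rewrite mulrA.
    by rewrite gs mulrA [Y l u * _]mulrC.
  rewrite -sumrB; apply: eq_bigr => j _; rewrite mulr_sumr -sumrB.
  by apply: eq_bigr => l _; rewrite /T; ring.
under eq_bigr => j _ do rewrite e2 mulrCA.
under [X in _ - X]eq_bigr => j _ do rewrite e2 mulrCA.
rewrite -!mulr_sumr euler_ex //; lra.
Qed.

(** Contraction of [spray_eq] with y^k: by [euler_ex] the right-hand side becomes two copies of y^j
    d L / d x^j minus one. *)
Lemma y_gamma00 u : U u ->
  \sum_k 2 * y_low L k u * gamma00 L k u = \sum_j Y j u * dd (ex j) L u.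
Proof.
move=> Uu.
have -> : \sum_k 2 * y_low L k u * gamma00 L k u =
    \sum_k Y k u * (\sum_i 2 * g L k i u * gamma00 L i u).
  rewrite /y_low; under [RHS]eq_bigr => k _ do rewrite mulr_sumr.
  rewrite [RHS]exchange_big; apply: eq_bigr => k _ /=.
  move: (gamma00 L k u) => c; rewrite mulr_sumr mulr_suml.
  by apply: eq_bigr => i _; rewrite y_upE gC // /Y; ring.
under eq_bigr => k _ do rewrite spray_eq // mulrBr mulr_sumr.
rewrite sumrB exchange_big /=.
have -> : \sum_j \sum_i Y i u * (Y j u * dd (ex j) (dd (ey i) L) u) =
   \sum_j Y j u * (2 * dd (ex j) L u).
  apply: eq_bigr => j _; rewrite -euler_ex // mulr_sumr.
  by apply: eq_bigr => i _; ring.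
rewrite -sumrB; apply: eq_bigr => j _; ring.
Qed.

(* Differentiate [y_gamma00] in [y^a] and subtract [spray_eq]. *)
Lemma y_low_N a u : U u -> \sum_i y_low L i u * Nc L i a u = 2^-1 * dd (ex a) L u.
Proof.
move=> Uu.
have sl := smooth_y_low; have sg := smooth_gamma00.
have := dd_ext hU (ey a) y_gamma00 Uu.
rewrite (dd_sum _ _ _ _ Uu); last by move=> i; smooth; exact: sl.
rewrite (dd_sum _ _ _ _ Uu); last by move=> i; smooth; exact: sY.
under eq_bigr => k _.
  rewrite (dd_mul _ _ _ Uu); [|by smooth; exact: sl|by smooth].
  rewrite (dd_mulc _ _ (sl k) Uu).
  have -> : dd (ey a) (y_low L k) u = g L a k u.
    rewrite (dd_ext hU _ (@y_lowE k) Uu) (dd_mulc _ _ _ Uu) ?gE //; smooth.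
  over.
under [in X in _ = X -> _]eq_bigr => j _.
  rewrite (dd_mul _ _ _ Uu) ?dd_proj; [|exact: sY|by smooth].
  rewrite eyY (dd_commute hU _ _ sL Uu); over.
rewrite !big_split /= spray_eq //.
have -> : \sum_j (j == a)%:R * dd (ex j) L u = dd (ex a) L u.
  rewrite (bigD1 a) //= eqxx mul1r big1 ?addr0 // => j ja.
  by rewrite (negbTE ja) mul0r.
(* The factor 4 appears because N^i_a is half the derivative of gamma^i_00; after the subtraction it
   equals two copies of d L / d x^a. *)
have -> : \sum_i 2 * y_low L i u * dd (ey a) (gamma00 L i) u =
  4 * \sum_i y_low L i u * Nc L i a u.
  by rewrite mulr_sumr; apply: eq_bigr => i _; rewrite /Nc ddyE; field.
lra.
Qed.

Lemma delta_vecE i (f : 'rV[R]_(m + m) -> R) u : smooth_on U f -> U u ->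
  dd (delta_vec L i u) f u = dd (ex i) f u - \sum_j Nc L j i u * dd (ey j) f u.
Proof.
move=> sf Uu; rewrite /delta_vec (dd_dirB _ _ sf Uu) (dd_dir_sum _ _ _ sf Uu).
by congr (_ - _); apply: eq_bigr => j _; rewrite (dd_dirZ _ _ sf Uu).
Qed.

(** The horizontal distribution is tangent to the level sets of F: this is [y_low_N] with y_i
    replaced by half of d L / d y^i. *)
Lemma delta_x_L i u : U u -> dd (delta_vec L i u) L u = 0.
Proof.
move=> Uu; rewrite delta_vecE //; have := y_low_N i Uu.
under eq_bigr => j _ do rewrite y_lowE // -mulrA [_ * Nc _ _ _ _]mulrC.
rewrite -mulr_sumr; lra.
Qed.

(** For fixed [i], N^i_j is a gradient in y, that of gamma^i_00 / 2. *)
Lemma ddyN_sym i j k u : U u -> dd (ey k) (Nc L i j) u = dd (ey j) (Nc L i k) u.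
Proof.
move=> Uu; have sg := smooth_gamma00.
have N j' : Nc L i j' = fun u => 2^-1 * dd (ey j') (gamma00 L i) u.
  by apply/funext => w; rewrite /Nc ddyE.
rewrite !N !(dd_mulc _ _ _ Uu); [|by smooth|by smooth].
by rewrite (dd_commute hU _ _ (sg i) Uu).
Qed.

(** Differentiating [delta_x_L] in y^b gives delta_a (d L / d y^b) = sum_j (d N^j_a / d y^b) (d L /
    d y^j), which is symmetric in a and b by [ddyN_sym]. *)
Lemma delta_y_low_sym i k u : U u ->
  dd (delta_vec L k u) (y_low L i) u = dd (delta_vec L i u) (y_low L k) u.
Proof.
move=> Uu; have sN := smooth_Nc.
have dyl v j : dd v (y_low L j) u = 2^-1 * dd v (dd (ey j) L) u.
  by rewrite (dd_ext hU _ (@y_lowE j) Uu) (dd_mulc _ _ _ Uu) //; smooth.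
have H a b : dd (ex a) (dd (ey b) L) u - \sum_j Nc L j a u * dd (ey j) (dd (ey b) L) u
    = \sum_j dd (ey b) (Nc L j a) u * dd (ey j) L u.
  have e w : U w -> dd (ex a) L w - \sum_j Nc L j a w * dd (ey j) L w = 0.
    by move=> Uw; rewrite -delta_vecE // delta_x_L.
  have := dd_ext hU (ey b) e Uu; rewrite dd_cst (dd_add _ _ _ Uu); [|by smooth|]; last first.
    by smooth; exact: sN.
  rewrite (dd_opp _ _ Uu); last by smooth; exact: sN.
  rewrite (dd_sum _ _ _ _ Uu); last by move=> j; smooth; exact: sN.
  under eq_bigr => j _.
    rewrite (dd_mul _ _ _ Uu); [|exact: sN|by smooth].
    rewrite (dd_commute hU (ey b) (ey j) sL Uu); over.
  rewrite big_split /= (dd_commute hU (ey b) (ex a) sL Uu) opprD addrCA addrC => /eqP.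
  by rewrite subr_eq0 => /eqP.
have sD j : smooth_on U (dd (ey j) L) by smooth.
have e a b : dd (delta_vec L a u) (y_low L b) u
    = 2^-1 * \sum_j dd (ey b) (Nc L j a) u * dd (ey j) L u.
  by apply: (etrans (dyl _ _)); rewrite -(H a b) (delta_vecE a (sD b) Uu).
apply: (etrans (e k i)); apply: (etrans _ (esym (e i k))).
have sym j := congr1 (fun c => c * dd (ey j) L u) (ddyN_sym j k i Uu).
exact: (congr1 (fun c => 2^-1 * c) (eq_bigr _ (fun j _ => sym j))).
Qed.

End LocalFinslerTheory.

(** * Brackets in the adapted frame *)

HB.lock Definition lie (R : realType) (d : nat)
    (x y : 'rV[R]_d -> 'rV[R]_d) (u : 'rV[R]_d) : 'rV[R]_d :=
  'D_(x u) y u - 'D_(y u) x u.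

(* [d (F_j dx^j) (x, y)], up to the terms that differentiate [x] and [y]. *)
HB.lock Definition twist (R : realType) (m : nat)
    (F : 'I_m -> 'rV[R]_(m + m) -> R) (x y : 'rV[R]_(m + m) -> 'rV[R]_(m + m))
    (u : 'rV[R]_(m + m)) : R :=
  \sum_j (dd (x u) (F j) u * y u 0 (lshift m j) - dd (y u) (F j) u * x u 0 (lshift m j)).

Section FrameCalculus.
Context {R : realType} {m : nat}.
Variables (U : set 'rV[R]_(m + m)) (N : 'I_m -> 'I_m -> 'rV[R]_(m + m) -> R).
Hypotheses (hU : open U) (sN : forall i j, smooth_on U (N i j)).

Implicit Types (i j k : 'I_m) (u w : 'rV[R]_(m + m)) (f : 'rV[R]_(m + m) -> R).
Implicit Types (x y : 'rV[R]_(m + m) -> 'rV[R]_(m + m)).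

(** The form delta y^i of a connection with arbitrary coefficients [N], so that the bracket formulas
    below do not involve the Finsler function. *)
Definition vert i u w : R := w 0 (rshift m i) + \sum_j N i j u * w 0 (lshift m j).

Definition horiz_derive i f u : R := dd (ex i) f u - \sum_j N j i u * dd (ey j) f u.

Lemma vertD i u v w : vert i u (v + w) = vert i u v + vert i u w.
Proof.
rewrite /vert mxE addrACA -big_split; congr (_ + _); apply: eq_bigr => j _.
by rewrite mxE mulrDr.
Qed.

Lemma vertN i u w : vert i u (- w) = - vert i u w.
Proof.
rewrite /vert mxE opprD -sumrN; congr (_ + _); apply: eq_bigr => j _.
by rewrite mxE mulrN.
Qed.

Lemma vert_inj u w : (forall i, w 0 (lshift m i) = 0) -> (forall i, vert i u w = 0) -> w = 0.
Proof.
move=> hw vw; apply/rowP => i; rewrite mxE; case: (split_ordP i) => j -> //.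
by have := vw j; rewrite /vert big1 ?addr0 // => k _; rewrite hw mulr0.
Qed.

Lemma delta_lshift i : delta_mx 0 (lshift m i) = ex i :> 'rV[R]_(m + m).
Proof.
apply/rowP => j; rewrite mxE eqxx /=; case: (split_ordP j) => k ->.
  by rewrite exX (inj_eq (@lshift_inj _ _)).
by rewrite exY eq_rlshift.
Qed.

Lemma delta_rshift i : delta_mx 0 (rshift m i) = ey i :> 'rV[R]_(m + m).
Proof.
apply/rowP => j; rewrite mxE eqxx /=; case: (split_ordP j) => k ->.
  by rewrite eyX eq_lrshift.
by rewrite eyY (inj_eq (@rshift_inj _ _)).
Qed.

Lemma dd_xy f w u : smooth_on U f -> U u -> dd w f u =
  \sum_k w 0 (lshift m k) * dd (ex k) f u + \sum_k w 0 (rshift m k) * dd (ey k) f u.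
Proof.
move=> sf Uu; rewrite (dd_partials _ sf Uu) big_split_ord /=.
by congr (_ + _); apply: eq_bigr => k _; rewrite ?delta_lshift ?delta_rshift.
Qed.

Lemma dd_frame f w u : smooth_on U f -> U u -> dd w f u =
  \sum_k w 0 (lshift m k) * horiz_derive k f u + \sum_k vert k u w * dd (ey k) f u.
Proof.
move=> sf Uu; rewrite (dd_xy _ sf Uu).
have -> : \sum_k vert k u w * dd (ey k) f u =
   \sum_k w 0 (rshift m k) * dd (ey k) f u
   + \sum_k \sum_j w 0 (lshift m k) * (N j k u * dd (ey j) f u).
  rewrite [X in _ = _ + X]exchange_big -big_split; apply: eq_bigr => k _ /=.
  by rewrite /vert mulrDl mulr_suml; congr (_ + _); apply: eq_bigr => j _; ring.
rewrite addrCA addrC; congr (_ + _); rewrite -big_split; apply: eq_bigr => k _ /=.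
by rewrite /horiz_derive mulrBr -mulr_sumr subrK.
Qed.

Lemma smooth_lshift x i : smooth_on U x -> smooth_on U (fun w => x w 0 (lshift m i)).
Proof. by move=> sx; exact: (smooth_row _ hU).1. Qed.

Lemma smooth_rshift x i : smooth_on U x -> smooth_on U (fun w => x w 0 (rshift m i)).
Proof. by move=> sx; exact: (smooth_row _ hU).1. Qed.

Lemma smooth_vert x i : smooth_on U x -> smooth_on U (fun w => vert i w (x w)).
Proof.
move=> sx; rewrite /vert; have sl j := smooth_lshift j sx; have sr j := smooth_rshift j sx.
by smooth.
Qed.

Lemma lie_h x y i u : smooth_on U x -> smooth_on U y -> U u ->
  lie x y u 0 (lshift m i) =
  dd (x u) (fun w => y w 0 (lshift m i)) u - dd (y u) (fun w => x w 0 (lshift m i)) u.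
Proof.
by move=> sx sy Uu; rewrite lie.unlock mxE (derive_rowE _ _ sy Uu) mxE (derive_rowE _ _ sx Uu).
Qed.

(** Cartan's formula for the exterior derivative of delta y^i: since d(delta y^i) = dN^i_j ^ dx^j,
    the terms that differentiate the coefficients of [vert] add up to the twist. *)
Lemma lie_vert x y i u : smooth_on U x -> smooth_on U y -> U u ->
  vert i u (lie x y u) =
  dd (x u) (fun w => vert i w (y w)) u - dd (y u) (fun w => vert i w (x w)) u
  - twist (N i) x y u.
Proof.
move=> sx sy Uu.
have H z v : smooth_on U z -> dd v (fun w => vert i w (z w)) u =
   dd v (fun w => z w 0 (rshift m i)) u + \sum_j (dd v (N i j) u * z u 0 (lshift m j)
     + N i j u * dd v (fun w => z w 0 (lshift m j)) u).
  move=> sz; have sl j := smooth_lshift j sz; have sr j := smooth_rshift j sz.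
  rewrite /vert (dd_add _ (sr i) _ Uu); last by smooth.
  rewrite (dd_sum _ _ _ _ Uu); last by move=> j; smooth.
  by congr (_ + _); apply: eq_bigr => j _; rewrite (dd_mul _ _ _ Uu).
rewrite !H // /vert.
rewrite {1}lie.unlock mxE (derive_rowE _ _ sy Uu) mxE (derive_rowE _ _ sx Uu).
under eq_bigr => j _ do rewrite lie_h // mulrBr.
rewrite twist.unlock !big_split /= !sumrN.
set a := dd _ _ _; set b := dd _ _ _.
move: (\sum_i0 _) (\sum_i0 _) (\sum_i0 _) (\sum_i0 _) => p q r s.
by ring.
Qed.

(** In the adapted frame x(F_j) and y(F_j) split into horizontal and vertical derivatives. After an
    exchange of [j] and [k] the horizontal ones form the sum assumed to vanish. *)
Lemma twistE F x y u : (forall j, smooth_on U (F j)) -> U u ->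
  \sum_j \sum_k x u 0 (lshift m k) * y u 0 (lshift m j) *
    (horiz_derive k (F j) u - horiz_derive j (F k) u) = 0 ->
  twist F x y u =
  \sum_j \sum_k dd (ey k) (F j) u *
    (vert k u (x u) * y u 0 (lshift m j) - vert k u (y u) * x u 0 (lshift m j)).
Proof.
move=> sF Uu flat; rewrite twist.unlock.
have -> : \sum_j (dd (x u) (F j) u * y u 0 (lshift m j) - dd (y u) (F j) u * x u 0 (lshift m j)) =
  \sum_j \sum_k (x u 0 (lshift m k) * y u 0 (lshift m j) - y u 0 (lshift m k) * x u 0 (lshift m j))
     * horiz_derive k (F j) u +
  \sum_j \sum_k dd (ey k) (F j) u *
    (vert k u (x u) * y u 0 (lshift m j) - vert k u (y u) * x u 0 (lshift m j)).
  rewrite -big_split; apply: eq_bigr => j _ /=.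
  rewrite (dd_frame (x u) (sF j) Uu) (dd_frame (y u) (sF j) Uu) !mulrDl !mulr_suml.
  by rewrite opprD addrACA -!sumrB; congr (_ + _); apply: eq_bigr => k _; ring.
rewrite -[RHS]add0r; congr (_ + _); rewrite -[RHS]flat.
under eq_bigr => j _ do under eq_bigr => k _ do rewrite mulrBl.
under [RHS]eq_bigr => j _ do under eq_bigr => k _ do rewrite mulrBr.
rewrite -!(eq_bigr _ (fun j _ => esym (sumrB _ _ _ _))) !sumrB; congr (_ - _).
rewrite exchange_big; apply: eq_bigr => k _; apply: eq_bigr => j _ /=; ring.
Qed.

(* [x'] and [y'] stand for the images of [x] and [y] under Psi_F. *)
Variables (x y x' y' : 'rV[R]_(m + m) -> 'rV[R]_(m + m)).
Hypotheses (sx : smooth_on U x) (sy : smooth_on U y).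
Hypotheses (sx' : smooth_on U x') (sy' : smooth_on U y').
Hypothesis hx' : forall u i, U u -> x' u 0 (lshift m i) = vert i u (x u).
Hypothesis hy' : forall u i, U u -> y' u 0 (lshift m i) = vert i u (y u).
Hypothesis vx' : forall u i, U u -> vert i u (x' u) = - x u 0 (lshift m i).
Hypothesis vy' : forall u i, U u -> vert i u (y' u) = - y u 0 (lshift m i).

(** What [twistE] leaves is the two-form a_jk delta y^k ^ dx^j with a_jk = d F_j / d y^k. For
    symmetric a it is invariant under (h, v) |-> (v, -h), as one sees by exchanging j and k; the
    second claim is the polarised form. The flatness assumption covers the four pairs of fields
    whose twists occur. *)
Lemma twist_rotate F u : (forall j, smooth_on U (F j)) -> U u ->
  (forall j k, dd (ey k) (F j) u = dd (ey j) (F k) u) ->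
  (forall z t, z \in [:: x; x'] -> t \in [:: y; y'] ->
     \sum_j \sum_k z u 0 (lshift m k) * t u 0 (lshift m j) *
     (horiz_derive k (F j) u - horiz_derive j (F k) u) = 0) ->
  twist F x' y' u = twist F x y u /\ twist F x y' u + twist F x' y u = 0.
Proof.
move=> sF Uu sym flat.
rewrite !twistE //; try by apply: flat; rewrite !inE eqxx ?orbT.
split.
  rewrite exchange_big; apply: eq_bigr => j _; apply: eq_bigr => k _ /=.
  by rewrite sym !vx' // !vy' // !hx' // !hy' //; ring.
rewrite [X in _ + X]exchange_big -big_split big1 //= => j _.
rewrite -big_split big1 //= => k _.
by rewrite sym !vx' // !vy' // !hx' // !hy' //; ring.
Qed.

(** Since x' and y' have the vertical parts of x and y as horizontal parts, and minus their
    horizontal parts as vertical parts, the same four derivatives occur on both sides. Only twists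
    could separate them, and these cancel. The next lemma is the vertical counterpart. *)
Lemma nijenhuis_h i u : U u -> twist (N i) x y' u + twist (N i) x' y u = 0 ->
  (lie x' y' u - lie x y u) 0 (lshift m i) = vert i u (lie x y' u + lie x' y u).
Proof.
move=> Uu tw; rewrite vertD mxE [X in _ + X = _]mxE.
rewrite (lie_h i sx' sy' Uu) (lie_h i sx sy Uu) (lie_vert i sx sy' Uu) (lie_vert i sx' sy Uu).
rewrite (dd_ext hU (x' u) (fun w Uw => hy' i Uw) Uu) (dd_ext hU (y' u) (fun w Uw => hx' i Uw) Uu).
rewrite (dd_ext hU (x u) (fun w Uw => vy' i Uw) Uu) (dd_ext hU (y u) (fun w Uw => vx' i Uw) Uu).
have shx := smooth_lshift i sx; have shy := smooth_lshift i sy.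
rewrite (dd_opp _ shx Uu) (dd_opp _ shy Uu).
move: tw; do 2 move: (twist _ _ _ _) => ?.
by do 4 move: (dd _ _ _) => ?; move=> tw; lra.
Qed.

Lemma nijenhuis_vert i u : U u -> twist (N i) x' y' u = twist (N i) x y u ->
  vert i u (lie x' y' u - lie x y u) = - (lie x y' u + lie x' y u) 0 (lshift m i).
Proof.
move=> Uu tw; rewrite vertD vertN mxE.
rewrite (lie_h i sx sy' Uu) (lie_h i sx' sy Uu) (lie_vert i sx' sy' Uu) (lie_vert i sx sy Uu) tw.
rewrite (dd_ext hU (y u) (fun w Uw => hx' i Uw) Uu) (dd_ext hU (x u) (fun w Uw => hy' i Uw) Uu).
rewrite (dd_ext hU (x' u) (fun w Uw => vy' i Uw) Uu) (dd_ext hU (y' u) (fun w Uw => vx' i Uw) Uu).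
have shx := smooth_lshift i sx; have shy := smooth_lshift i sy.
rewrite (dd_opp _ shx Uu) (dd_opp _ shy Uu).
move: (twist _ _ _ _) => ?.
by do 4 move: (dd _ _ _) => ?; lra.
Qed.

End FrameCalculus.

Section ContactForm.
Context {R : realType} {m : nat}.
Variables (U : set 'rV[R]_(m + m)) (F : 'I_m -> 'rV[R]_(m + m) -> R).
Hypotheses (hU : open U) (sF : forall j, smooth_on U (F j)).

(** For a one-form alpha and fields in its kernel, d alpha(x, y) = - alpha([x, y]); differentiating
    alpha(x) = 0 and alpha(y) = 0 removes the derivatives of the fields. *)
Lemma form_lie (x y : 'rV[R]_(m + m) -> 'rV[R]_(m + m)) u :
  smooth_on U x -> smooth_on U y -> U u ->
  (forall w, U w -> \sum_i F i w * x w 0 (lshift m i) = 0) ->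
  (forall w, U w -> \sum_i F i w * y w 0 (lshift m i) = 0) ->
  \sum_i F i u * lie x y u 0 (lshift m i) = - twist F x y u.
Proof.
move=> sx sy Uu x0 y0.
have H (z : 'rV[R]_(m + m) -> 'rV[R]_(m + m)) v : smooth_on U z ->
    (forall w, U w -> \sum_i F i w * z w 0 (lshift m i) = 0) ->
    \sum_i F i u * dd v (fun w => z w 0 (lshift m i)) u
    = - \sum_i dd v (F i) u * z u 0 (lshift m i).
  move=> sz z0; have sl j := smooth_lshift hU j sz.
  have := dd_ext hU v z0 Uu; rewrite dd_cst (dd_sum _ _ _ _ Uu); last by move=> i; smooth.
  under eq_bigr => i _ do rewrite (dd_mul _ _ _ Uu) //.
  by rewrite big_split /= addrC => /eqP; rewrite addr_eq0 => /eqP.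
under eq_bigr => i _ do rewrite (lie_h i sx sy Uu) mulrBr.
by rewrite sumrB !H // twist.unlock sumrB opprB opprK addrC.
Qed.

End ContactForm.

(** * The almost complex structure in the adapted frame *)

Section PsiLocal.
Context {R : realType} {m : nat}.
Variable L : 'rV[R]_(m + m) -> R.
Implicit Types (i j k : 'I_m) (u w : 'rV[R]_(m + m)).

Lemma dxE i w : dx i w = w 0 (lshift m i).
Proof. by rewrite /dx mxE. Qed.

Lemma delta_yE i u w : delta_y L i u w = vert (Nc L) i u w.
Proof.
by rewrite /delta_y /vert mxE; congr (_ + _); apply: eq_bigr => j _; rewrite dxE.
Qed.

Lemma delta_vec_l i k u : delta_vec L i u 0 (lshift m k) = (k == i)%:R.
Proof.
rewrite /delta_vec mxE exX mxE summxE big1 ?subr0 // => j _.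
by rewrite mxE eyX mulr0.
Qed.

Lemma delta_vec_r i k u : delta_vec L i u 0 (rshift m k) = - Nc L k i u.
Proof.
rewrite /delta_vec mxE exY mxE summxE add0r (bigD1 k) //= mxE eyY eqxx mulr1.
by rewrite big1 ?addr0 // => j jk; rewrite mxE eyY eq_sym (negbTE jk) mulr0.
Qed.

Lemma sum_delta (c : 'I_m -> R) k : \sum_i c i * (k == i)%:R = c k.
Proof.
rewrite (bigD1 k) //= eqxx mulr1 big1 ?addr0 // => j jk.
by rewrite eq_sym (negbTE jk) mulr0.
Qed.

Lemma Psi_loc_h k u w : Psi_loc L u w 0 (lshift m k) = vert (Nc L) k u w.
Proof.
rewrite /Psi_loc mxE !summxE big1 ?add0r => [|i _]; last by rewrite mxE [X in _ * X]mxE eyX oppr0 mulr0.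
rewrite -[RHS](sum_delta (fun i => vert (Nc L) i u w)); apply: eq_bigr => i _.
by rewrite mxE delta_yE delta_vec_l.
Qed.

Lemma Psi_loc_r k u w : Psi_loc L u w 0 (rshift m k) =
  - w 0 (lshift m k) - \sum_i Nc L k i u * vert (Nc L) i u w.
Proof.
rewrite /Psi_loc mxE !summxE -sumrN; congr (_ + _).
  rewrite -[RHS](sum_delta (fun i => - w 0 (lshift m i))); apply: eq_bigr => i _.
  by rewrite mxE [X in _ * X]mxE eyY mulrN mulNr dxE.
by apply: eq_bigr => i _; rewrite mxE delta_yE delta_vec_r mulrN mulrC.
Qed.

Lemma Psi_loc_vert k u w : vert (Nc L) k u (Psi_loc L u w) = - w 0 (lshift m k).
Proof.
rewrite {1}/vert Psi_loc_r.
by under [X in _ + X]eq_bigr => j _ do rewrite Psi_loc_h; rewrite subrK.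
Qed.

(** Characterises Psi_F by adapted components. The square of Psi_F, its invariance and the Nijenhuis
    identity are all obtained through this criterion. *)
Lemma Psi_loc_eq u w (z : 'rV[R]_(m + m)) : (forall i, z 0 (lshift m i) = vert (Nc L) i u w) ->
  (forall i, vert (Nc L) i u z = - w 0 (lshift m i)) -> z = Psi_loc L u w.
Proof.
move=> hz vz; apply/eqP; rewrite -subr_eq0; apply/eqP.
apply: (vert_inj (N := Nc L) (u := u)) => i.
  by rewrite mxE [X in _ + X]mxE hz Psi_loc_h subrr.
by rewrite vertD vertN vz Psi_loc_vert subrr.
Qed.

Lemma Psi_locK u w : Psi_loc L u (Psi_loc L u w) = - w.
Proof.
apply/esym/Psi_loc_eq => i; last by rewrite vertN Psi_loc_h.
by rewrite Psi_loc_vert mxE.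
Qed.

Lemma Psi_locD (c : R) u v w : Psi_loc L u (c *: v + w) = c *: Psi_loc L u v + Psi_loc L u w.
Proof.
have vertZ i (z : 'rV[R]_(m + m)) : vert (Nc L) i u (c *: z) = c * vert (Nc L) i u z.
  rewrite /vert mxE mulrDr mulr_sumr; congr (_ + _); apply: eq_bigr => j _.
  by rewrite mxE mulrCA.
apply/esym/Psi_loc_eq => i.
  by rewrite mxE [X in X + _]mxE !Psi_loc_h vertD vertZ.
by rewrite vertD vertZ !Psi_loc_vert !mxE opprD mulrN.
Qed.

Lemma smooth_Psi_loc (U : set 'rV[R]_(m + m)) (x : 'rV[R]_(m + m) -> 'rV[R]_(m + m)) :
  open U -> (forall i j, smooth_on U (Nc L i j)) -> smooth_on U x ->
  smooth_on U (fun u => Psi_loc L u (x u)).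
Proof.
move=> hU sN sx; apply/(smooth_row _ hU) => i.
have sv j := smooth_vert hU sN j sx; have sl j := smooth_lshift hU j sx.
case: (split_ordP i) => k ->.
  by apply: (smooth_ext hU) (sv k) => u _; rewrite Psi_loc_h.
have H : smooth_on U (fun u => - x u 0 (lshift m k) +
   - \sum_i Nc L k i u * vert (Nc L) i u (x u)) by smooth.
by apply: (smooth_ext hU) H => u _; rewrite Psi_loc_r.
Qed.

End PsiLocal.

(** * The integrability conditions in one chart *)

Section LocalCR.
Context {R : realType} {m : nat}.
Variables (U : set 'rV[R]_(m + m)) (L : 'rV[R]_(m + m) -> R).
Hypotheses (hU : open U) (sL : smooth_on U L).
Hypothesis euler : forall u, U u -> dd (row_mx 0 (rsubmx u)) L u = 2 * L u.
Hypothesis gunit : forall u, U u -> gmx L u \in unitmx.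

Implicit Types (i j k : 'I_m) (u w : 'rV[R]_(m + m)) (f : 'rV[R]_(m + m) -> R).

Let sN i j : smooth_on U (Nc L i j). Proof. exact: smooth_Nc. Qed.
Let sy i : smooth_on U (y_low L i). Proof. exact: smooth_y_low. Qed.

(** [theta] and [phi] are F^2 eta^1 and F^2 eta^2. Without the denominator, [phi] is half of dL, and
    Psi_F carries one form to the other up to sign. *)
Definition theta u w : R := \sum_i y_low L i u * w 0 (lshift m i).
Definition phi u w : R := \sum_i y_low L i u * vert (Nc L) i u w.

Lemma horiz_deriveE k f u : smooth_on U f -> U u ->
  horiz_derive (Nc L) k f u = dd (delta_vec L k u) f u.
Proof. by move=> sf Uu; rewrite (delta_vecE L k sf Uu). Qed.

Lemma phiE u w : U u -> phi u w = 2^-1 * dd w L u.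
Proof.
move=> Uu; rewrite (dd_frame (Nc L) w sL Uu) big1 ?add0r => [|k _]; last first.
  by rewrite (horiz_deriveE k sL Uu) (delta_x_L hU sL euler gunit) ?mulr0.
rewrite /phi mulr_sumr; apply: eq_bigr => i _.
by rewrite (y_lowE hU sL euler i Uu) -mulrA [dd _ _ _ * _]mulrC.
Qed.

Lemma theta_Psi u w : theta u (Psi_loc L u w) = phi u w.
Proof. by rewrite /theta /phi; apply: eq_bigr => i _; rewrite Psi_loc_h. Qed.

Lemma phi_Psi u w : phi u (Psi_loc L u w) = - theta u w.
Proof.
rewrite /theta /phi -sumrN; apply: eq_bigr => i _.
by rewrite Psi_loc_vert mulrN.
Qed.

Variables (lam : 'rV[R]_(m + m) -> R) (X : 'rV[R]_(m + m) -> 'M[R]_m).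
Hypothesis curv : forall u, U u -> forall i j k, curvature L i j k u =
  lam u * (X u i k * y_low L j u - X u i j * y_low L k u).

Variables x y : 'rV[R]_(m + m) -> 'rV[R]_(m + m).
Hypotheses (sx : smooth_on U x) (sY : smooth_on U y).
Hypotheses (tx : forall u, U u -> theta u (x u) = 0) (ty : forall u, U u -> theta u (y u) = 0).
Hypotheses (px : forall u, U u -> phi u (x u) = 0) (py : forall u, U u -> phi u (y u) = 0).

Let x' u := Psi_loc L u (x u).
Let y' u := Psi_loc L u (y u).

Let sx' : smooth_on U x'. Proof. exact: smooth_Psi_loc. Qed.
Let sy' : smooth_on U y'. Proof. exact: smooth_Psi_loc. Qed.
Let tx' u : U u -> theta u (x' u) = 0. Proof. by move=> Uu; rewrite theta_Psi px. Qed.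
Let ty' u : U u -> theta u (y' u) = 0. Proof. by move=> Uu; rewrite theta_Psi py. Qed.
Let px' u : U u -> phi u (x' u) = 0. Proof. by move=> Uu; rewrite phi_Psi tx ?oppr0. Qed.
Let py' u : U u -> phi u (y' u) = 0. Proof. by move=> Uu; rewrite phi_Psi ty ?oppr0. Qed.

Let hx' u i : U u -> x' u 0 (lshift m i) = vert (Nc L) i u (x u).
Proof. by rewrite /x' Psi_loc_h. Qed.
Let hy' u i : U u -> y' u 0 (lshift m i) = vert (Nc L) i u (y u).
Proof. by rewrite /y' Psi_loc_h. Qed.
Let vx' u i : U u -> vert (Nc L) i u (x' u) = - x u 0 (lshift m i).
Proof. by rewrite /x' Psi_loc_vert. Qed.
Let vy' u i : U u -> vert (Nc L) i u (y' u) = - y u 0 (lshift m i).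
Proof. by rewrite /y' Psi_loc_vert. Qed.

Lemma curvatureE i j k u : curvature L i j k u =
  horiz_derive (Nc L) k (Nc L i j) u - horiz_derive (Nc L) j (Nc L i k) u.
Proof.
rewrite /curvature /delta_x /horiz_derive !ddxE.
congr (_ - _ - (_ - _)); apply: eq_bigr => l _; congr (_ * _); exact: ddyE.
Qed.

Lemma curvature_contract i u (z t : 'rV[R]_(m + m)) : U u -> theta u z = 0 -> theta u t = 0 ->
  \sum_j \sum_k z 0 (lshift m k) * t 0 (lshift m j) *
     (horiz_derive (Nc L) k (Nc L i j) u - horiz_derive (Nc L) j (Nc L i k) u) = 0.
Proof.
move=> Uu tz tt.
under eq_bigr => j _ do under eq_bigr => k _ do rewrite -curvatureE curv //.
have -> : \sum_j \sum_k z 0 (lshift m k) * t 0 (lshift m j) *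
     (lam u * (X u i k * y_low L j u - X u i j * y_low L k u)) =
   \sum_j (y_low L j u * t 0 (lshift m j)) * (lam u * \sum_k z 0 (lshift m k) * X u i k)
   - \sum_j (lam u * t 0 (lshift m j) * X u i j) * theta u z.
  rewrite -sumrB; apply: eq_bigr => j _; rewrite /theta !mulr_sumr -sumrB.
  by apply: eq_bigr => k _; move: (y_low L j u) (y_low L k u) => a b; ring.
rewrite -!mulr_suml tz mulr0 subr0.
by rewrite -/(theta u t) tt mul0r.
Qed.

Let twN i u : U u -> twist (Nc L i) x' y' u = twist (Nc L i) x y u /\
  twist (Nc L i) x y' u + twist (Nc L i) x' y u = 0.
Proof.
move=> Uu; apply: (twist_rotate hx' hy' vx' vy' (sN i) Uu).
  by move=> j k; exact: (ddyN_sym hU sL gunit).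
move=> z t; rewrite !inE => /orP[]/eqP -> /orP[]/eqP ->; apply: curvature_contract => //;
  by [exact: tx|exact: tx'|exact: ty|exact: ty'].
Qed.

Lemma local_nijenhuis u : U u ->
  lie x' y' u - lie x y u = Psi_loc L u (lie x y' u + lie x' y u).
Proof.
move=> Uu; apply: Psi_loc_eq => i.
  by apply: (nijenhuis_h hU sN) => //; exact: (twN i Uu).2.
by apply: (nijenhuis_vert hU sN) => //; exact: (twN i Uu).1.
Qed.

(** By [form_lie] this compares two twists of the covector y_i. Its vertical derivatives are the
    symmetric g_ij, and its horizontal ones are symmetric by [delta_y_low_sym], so [twist_rotate]
    applies. *)
Lemma theta_lie u : U u -> theta u (lie x' y' u - lie x y u) = 0.
Proof.
move=> Uu.
have -> : theta u (lie x' y' u - lie x y u) = theta u (lie x' y' u) - theta u (lie x y u).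
  rewrite /theta -sumrB; apply: eq_bigr => i _.
  by rewrite mxE [X in _ + X]mxE mulrBr.
rewrite /theta !(form_lie hU sy) //.
have [-> _] : twist (y_low L) x' y' u = twist (y_low L) x y u /\
  twist (y_low L) x y' u + twist (y_low L) x' y u = 0.
  apply: (twist_rotate hx' hy' vx' vy' sy Uu) => [j k|z t _ _].
    have e a b : dd (ey a) (y_low L b) u = g L a b u.
      rewrite (dd_ext hU _ (fun w Uw => y_lowE hU sL euler b Uw) Uu) (dd_mulc _ _ _ Uu) ?gE //.
      by smooth.
    by rewrite !e (gC hU sL _ _ Uu).
  rewrite big1 // => j _; rewrite big1 // => k _.
  rewrite (horiz_deriveE k (sy j) Uu) (horiz_deriveE j (sy k) Uu).
  apply/eqP; rewrite mulf_eq0 subr_eq0; apply/orP; right; apply/eqP.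
  exact: (delta_y_low_sym hU sL euler gunit j k Uu).
by rewrite addrN.
Qed.

(** As [phi] is half of dL, the four fields annihilate [L], and so do the brackets of fields that
    annihilate it. *)
Lemma phi_lie u : U u -> phi u (lie x' y' u - lie x y u) = 0.
Proof.
have lieL (z t : 'rV[R]_(m + m) -> 'rV[R]_(m + m)) v : U v -> smooth_on U z -> smooth_on U t ->
    (forall w, U w -> phi w (z w) = 0) -> (forall w, U w -> phi w (t w) = 0) ->
    dd (lie z t v) L v = 0.
  move=> Uv sz st pz pt; rewrite lie.unlock (dd_lie hU Uv sz st sL).
  have H s : (forall w, U w -> phi w (s w) = 0) -> forall w, U w -> dd (s w) L w = 0.
    move=> ps w Uw; have := ps w Uw; rewrite phiE // => /eqP.
    by rewrite mulf_eq0 invr_eq0 pnatr_eq0 /= => /eqP.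
  rewrite (dd_ext hU _ (H _ pt) Uv) (dd_ext hU _ (H _ pz) Uv) !dd_cst.
  by rewrite subrr.
move=> Uu; rewrite phiE // (dd_dirB _ _ sL Uu) !lieL // ?subrr ?mulr0 //.
Qed.

End LocalCR.

(** * Change of coordinates *)

Section CoordinateChange.
Context {R : realType} {m : nat}.
Variables (U U' : set 'rV[R]_(m + m)) (La Lb : 'rV[R]_(m + m) -> R).
Variable T : 'rV[R]_(m + m) -> 'rV[R]_(m + m).
Hypotheses (hU : open U) (sLa : smooth_on U La).
Hypothesis eulera : forall u, U u -> dd (row_mx 0 (rsubmx u)) La u = 2 * La u.
Hypothesis gunita : forall u, U u -> gmx La u \in unitmx.
Hypotheses (hU' : open U') (sLb : smooth_on U' Lb).
Hypothesis eulerb : forall u, U' u -> dd (row_mx 0 (rsubmx u)) Lb u = 2 * Lb u.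
Hypothesis gunitb : forall u, U' u -> gmx Lb u \in unitmx.
Hypotheses (sT : smooth_on U T) (TU : forall u, U u -> U' (T u)).
Hypothesis LT : forall u, U u -> La u = Lb (T u).

Implicit Types (i j k l : 'I_m) (u w : 'rV[R]_(m + m)).

Let H l w : R := T w 0 (lshift m l).
Let r l w : R := T w 0 (rshift m l).
Let Y l w : R := w 0 (rshift m l).

(* [T] has the form (x, y) |-> (phi x, dphi(x) y) with [dphi] invertible; only
   the following consequences are used. *)
Hypothesis T1 : forall k l u, U u -> dd (ey k) (H l) u = 0.
Hypothesis T2 : forall k l u, U u -> dd (ey k) (r l) u = dd (ex k) (H l) u.
Hypothesis T3 : forall l u, U u -> r l u = \sum_j Y j u * dd (ex j) (H l) u.
Hypothesis T4 : forall u, U u -> forall c : 'I_m -> R,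
  (forall k, \sum_l dd (ex k) (H l) u * c l = 0) -> forall l, c l = 0.

Let sH l : smooth_on U (H l). Proof. exact: smooth_lshift. Qed.
Let sr l : smooth_on U (r l). Proof. exact: smooth_rshift. Qed.
Let sY l : smooth_on U (Y l). Proof. exact: smooth_proj. Qed.

Lemma change_h l u w : U u ->
  ('D_w T u) 0 (lshift m l) = \sum_k w 0 (lshift m k) * dd (ex k) (H l) u.
Proof.
move=> Uu; rewrite (derive_rowE _ _ sT Uu) (dd_xy _ (sH l) Uu).
by rewrite [X in _ + X]big1 ?addr0 // => k _; rewrite T1 ?mulr0.
Qed.

Lemma change_r l u w : U u -> ('D_w T u) 0 (rshift m l) =
  \sum_k w 0 (lshift m k) * dd (ex k) (r l) u + \sum_k w 0 (rshift m k) * dd (ex k) (H l) u.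
Proof.
move=> Uu; rewrite (derive_rowE _ _ sT Uu) (dd_xy _ (sr l) Uu).
by congr (_ + _); apply: eq_bigr => k _; rewrite T2.
Qed.

Lemma dd_change (f : 'rV[R]_(m + m) -> R) u w : smooth_on U' f -> U u ->
  dd w (fun v => f (T v)) u =
  \sum_l ('D_w T u) 0 (lshift m l) * dd (ex l) f (T u) +
  \sum_l ('D_w T u) 0 (rshift m l) * dd (ey l) f (T u).
Proof.
by move=> sf Uu; rewrite (dd_comp w sT sf Uu (TU Uu)) (dd_xy _ sf (TU Uu)).
Qed.

Lemma sum_exl (c : 'I_m -> R) k : \sum_j (ex k : 'rV[R]_(m + m)) 0 (lshift m j) * c j = c k.
Proof.
rewrite (bigD1 k) //= exX eqxx mul1r big1 ?addr0 // => j jk.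
by rewrite exX (negbTE jk) mul0r.
Qed.

Lemma sum_eyr (c : 'I_m -> R) k : \sum_j (ey k : 'rV[R]_(m + m)) 0 (rshift m j) * c j = c k.
Proof.
rewrite (bigD1 k) //= eyY eqxx mul1r big1 ?addr0 // => j jk.
by rewrite eyY (negbTE jk) mul0r.
Qed.

Lemma sum_exr (c : 'I_m -> R) k : \sum_j (ex k : 'rV[R]_(m + m)) 0 (rshift m j) * c j = 0.
Proof. by rewrite big1 // => j _; rewrite exY mul0r. Qed.

Lemma sum_eyl (c : 'I_m -> R) k : \sum_j (ey k : 'rV[R]_(m + m)) 0 (lshift m j) * c j = 0.
Proof. by rewrite big1 // => j _; rewrite eyX mul0r. Qed.

Lemma dd_ey_change (f : 'rV[R]_(m + m) -> R) k u : smooth_on U' f -> U u ->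
  dd (ey k) (fun v => f (T v)) u = \sum_l dd (ex k) (H l) u * dd (ey l) f (T u).
Proof.
move=> sf Uu; rewrite (dd_change _ sf Uu) big1 ?add0r => [|l _]; last first.
  by rewrite (change_h l _ Uu) sum_eyl mul0r.
by apply: eq_bigr => l _; rewrite (change_r l _ Uu) sum_eyl sum_eyr add0r.
Qed.

Lemma dd_ex_change (f : 'rV[R]_(m + m) -> R) k u : smooth_on U' f -> U u ->
  dd (ex k) (fun v => f (T v)) u = \sum_l dd (ex k) (H l) u * dd (ex l) f (T u)
    + \sum_l dd (ex k) (r l) u * dd (ey l) f (T u).
Proof.
move=> sf Uu; rewrite (dd_change _ sf Uu).
congr (_ + _); apply: eq_bigr => l _; first by rewrite (change_h l _ Uu) sum_exl.
by rewrite (change_r l _ Uu) sum_exl sum_exr addr0.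
Qed.

Lemma smooth_pull (f : 'rV[R]_(m + m) -> R) : smooth_on U' f -> smooth_on U (fun v => f (T v)).
Proof. by move=> sf; exact: (smooth_comp hU hU' TU). Qed.

Lemma dd_ey_ex_H j k l u : U u -> dd (ey j) (dd (ex k) (H l)) u = 0.
Proof.
move=> Uu; rewrite (dd_commute hU _ _ (sH l) Uu).
by rewrite (dd_ext hU _ (fun w Uw => T1 j l Uw) Uu) dd_cst.
Qed.

Lemma dd_ex_r k l u : U u -> dd (ex k) (r l) u = \sum_j Y j u * dd (ex k) (dd (ex j) (H l)) u.
Proof.
move=> Uu; rewrite (dd_ext hU _ (fun w Uw => T3 l Uw) Uu).
rewrite (dd_sum _ _ _ _ Uu); last by move=> j; smooth.
apply: eq_bigr => j _; rewrite (dd_mul _ _ _ Uu) ?dd_proj //; last by smooth.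
by rewrite exY mul0r add0r.
Qed.

Let spray (L : 'rV[R]_(m + m) -> R) u : 'rV[R]_(m + m) :=
  row_mx (rsubmx u) (\row_j (- gamma00 L j u)).

Lemma dd_spray (L f : 'rV[R]_(m + m) -> R) (W : set 'rV[R]_(m + m)) u :
  smooth_on W f -> W u -> dd (spray L u) f u =
  \sum_j Y j u * dd (ex j) f u - \sum_j gamma00 L j u * dd (ey j) f u.
Proof.
move=> sf Wu; rewrite (dd_xy _ sf Wu) -sumrN.
by congr (_ + _); apply: eq_bigr => j _; rewrite ?row_mxEl ?row_mxEr !mxE ?mulNr.
Qed.

(** The Euler-Lagrange equation as a derivative along the spray, a form that can be transported by
    [T] with the chain rule. *)
Lemma dd_spray_L k u : U u -> dd (spray La u) (dd (ey k) La) u = dd (ex k) La u.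
Proof.
move=> Uu; rewrite (dd_spray _ _ Uu); last by smooth.
have := spray_eq hU sLa eulera gunita k Uu.
under eq_bigr => i _ do rewrite (gE La) mulVKf ?pnatr_eq0 // (dd_commute hU _ _ sLa Uu) mulrC.
by rewrite /Y => ->; rewrite opprB addrC subrK.
Qed.

(* The image under [T] of the spray of [La] satisfies the Euler-Lagrange
   equation of [Lb], so it is the spray of [Lb]. *)
Lemma gamma00_change i u : U u ->
  gamma00 Lb i (T u) = - \sum_j Y j u * dd (ex j) (r i) u
    + \sum_j gamma00 La j u * dd (ex j) (H i) u.
Proof.
move=> Uu; have Tu := TU Uu.
(* Minus the vertical components of the image of the spray, hence the candidate for gamma00 of
   [Lb]. *)
pose c l := - \sum_j Y j u * dd (ex j) (r l) u + \sum_j gamma00 La j u * dd (ex j) (H l) u.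
set s := spray La u.
have sh l : ('D_s T u) 0 (lshift m l) = Y l (T u).
  rewrite (change_h l _ Uu) [RHS](T3 l Uu); apply: eq_bigr => j _.
  by rewrite row_mxEl mxE.
have sr' l : ('D_s T u) 0 (rshift m l) = - c l.
  rewrite (change_r l _ Uu) /c opprD opprK -sumrN; congr (_ + _); apply: eq_bigr => j _.
    by rewrite row_mxEl mxE.
  by rewrite row_mxEr mxE mulNr.
(* In the chain rule for [dd_spray_L] the terms with derivatives of [r] occur on both sides and
   cancel; the rest is the Jacobian applied to this family, and [T4] removes the Jacobian. *)
have key l : dd ('D_s T u) (dd (ey l) Lb) (T u) - dd (ex l) Lb (T u) = 0.
  apply: (T4 Uu (c := fun l => dd ('D_s T u) (dd (ey l) Lb) (T u) - dd (ex l) Lb (T u))) => k.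
  have e w : U w -> dd (ey k) La w = \sum_l dd (ex k) (H l) w * dd (ey l) Lb (T w).
    by move=> Uw; rewrite -(dd_ey_change _ sLb Uw); exact: (dd_ext hU).
  have E := dd_spray_L k Uu.
  rewrite -/s (dd_ext hU _ e Uu) in E.
  have sp l' : smooth_on U (fun w => dd (ey l') Lb (T w)).
    by apply: smooth_pull; smooth.
  rewrite (dd_sum _ _ _ _ Uu) in E; last by move=> l'; smooth.
  have e2 : dd (ex k) La u = \sum_l' dd (ex k) (H l') u * dd (ex l') Lb (T u)
    + \sum_l' dd (ex k) (r l') u * dd (ey l') Lb (T u).
    by rewrite -(dd_ex_change _ sLb Uu); exact: (dd_ext hU).
  rewrite {}e2 in E.
  have e3 l' : dd s (fun w => dd (ex k) (H l') w * dd (ey l') Lb (T w)) u =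
     dd (ex k) (r l') u * dd (ey l') Lb (T u)
     + dd (ex k) (H l') u * dd ('D_s T u) (dd (ey l') Lb) (T u).
    rewrite (dd_mul _ _ _ Uu) //; last by smooth.
    rewrite (dd_comp s sT _ Uu Tu); last by smooth.
    congr (_ * _ + _); rewrite (dd_spray _ _ Uu); last by smooth.
    rewrite [X in _ - X]big1 ?subr0 => [|j _]; last by rewrite dd_ey_ex_H ?mulr0.
    rewrite dd_ex_r //; apply: eq_bigr => j _.
    by rewrite (dd_commute hU _ _ (sH l') Uu).
  under eq_bigr => l' _ do rewrite mulrBr.
  rewrite (eq_bigr _ (fun l' _ => e3 l')) big_split /= addrC in E.
  by rewrite sumrB (addIr _ E) subrr.
(* Both families solve the Euler-Lagrange equation of [Lb], so the invertible metric annihilates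
   their difference. *)
pose v : 'cV[R]_m := \col_j (gamma00 Lb j (T u) - c j).
suff v0 : v = 0.
  have : v i 0 = 0 by rewrite v0 mxE.
  by rewrite mxE => /eqP; rewrite subr_eq0 => /eqP.
rewrite -[v](mulKmx (gunitb Tu)); suff -> : gmx Lb (T u) *m v = 0 by rewrite mulmx0.
apply/colP => k; rewrite mxE [RHS]mxE.
have := key k; rewrite (dd_xy _ _ Tu); last by smooth.
under eq_bigr => j _ do rewrite sh.
under [X in _ + X - _]eq_bigr => j _ do rewrite sr' (dd_commute hU' _ _ sLb Tu).
move=> E2; have := spray_eq hU' sLb eulerb gunitb k Tu.
under eq_bigr => j _ do rewrite (gE Lb) mulVKf ?pnatr_eq0 //.
rewrite -/Y => E1.
have -> : \sum_j gmx Lb (T u) k j * v j 0 = 2^-1 *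
  (\sum_j dd (ey k) (dd (ey j) Lb) (T u) * gamma00 Lb j (T u)
   + \sum_j - c j * dd (ey k) (dd (ey j) Lb) (T u)).
  rewrite -big_split mulr_sumr; apply: eq_bigr => j _ /=.
  rewrite -/(g Lb k j (T u)) (gE Lb) [v j 0]mxE.
  by move: (gamma00 Lb j (T u)) (c j) (dd _ _ _) => p q t; ring.
by rewrite E1 addrAC E2 mulr0.
Qed.

(** The y^k-derivative of [gamma00_change]. The term y^j d r^i / d x^j contributes d r^i / d x^k
    twice, once through y^j and once through [T2] and [dd_ex_r], which matches the factor 1/2 in
    N. *)
Lemma Nc_change i k u : U u ->
  \sum_l dd (ex k) (H l) u * Nc Lb i l (T u) + dd (ex k) (r i) u
  = \sum_j dd (ex j) (H i) u * Nc La j k u.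
Proof.
move=> Uu.
have sga := smooth_gamma00 hU sLa gunita; have sgb := smooth_gamma00 hU' sLb gunitb.
have := dd_ext hU (ey k) (fun w Uw => gamma00_change i Uw) Uu.
rewrite (dd_ey_change _ (sgb i) Uu).
rewrite (dd_add _ _ _ Uu); [|by smooth|by smooth].
rewrite (dd_opp _ _ Uu); last by smooth.
rewrite (dd_sum _ _ _ _ Uu); last by move=> j; smooth.
rewrite (dd_sum _ _ _ _ Uu); last by move=> j; smooth.
have e1 j : dd (ey k) (fun w => Y j w * dd (ex j) (r i) w) u =
    (ey k : 'rV[R]_(m + m)) 0 (rshift m j) * dd (ex j) (r i) u
    + Y j u * dd (ex k) (dd (ex j) (H i)) u.
  rewrite (dd_mul _ _ _ Uu) ?dd_proj //; last by smooth.
  congr (_ + _ * _); rewrite (dd_commute hU _ _ (sr i) Uu).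
  rewrite (dd_ext hU _ (fun w Uw => T2 k i Uw) Uu).
  exact: (dd_commute hU _ _ (sH i) Uu).
have e2 j : dd (ey k) (fun w => gamma00 La j w * dd (ex j) (H i) w) u =
    dd (ey k) (gamma00 La j) u * dd (ex j) (H i) u.
  rewrite (dd_mul _ _ _ Uu) //; last by smooth.
  by rewrite dd_ey_ex_H // mulr0 addr0.
rewrite (eq_bigr _ (fun j _ => e1 j)) (eq_bigr _ (fun j _ => e2 j)).
rewrite big_split /= sum_eyr -(dd_ex_r _ _ Uu) => E.
have -> : \sum_l dd (ex k) (H l) u * Nc Lb i l (T u) = 2^-1 *
   \sum_l dd (ex k) (H l) u * dd (ey l) (gamma00 Lb i) (T u).
  by rewrite mulr_sumr; apply: eq_bigr => l _; rewrite /Nc ddyE mulrCA.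
rewrite E.
have -> : \sum_j dd (ex j) (H i) u * Nc La j k u = 2^-1 *
   \sum_j dd (ey k) (gamma00 La j) u * dd (ex j) (H i) u.
  by rewrite mulr_sumr; apply: eq_bigr => l _; rewrite /Nc ddyE mulrCA [_ * dd (ey k) _ _]mulrC.
by move: (dd _ _ _) (\sum_j _) => p q; field.
Qed.

(** The second derivatives of the coordinate change in [change_r] are cancelled by the inhomogeneous
    term of [Nc_change], so delta y^i transforms like dx^i. *)
Lemma vert_change i u w : U u ->
  vert (Nc Lb) i (T u) ('D_w T u) = \sum_k dd (ex k) (H i) u * vert (Nc La) k u w.
Proof.
move=> Uu; rewrite {1}/vert (change_r _ _ Uu).
under [X in _ + X = _]eq_bigr => l _ do rewrite (change_h _ _ Uu) mulr_sumr.
rewrite exchange_big /= addrAC -big_split /=.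
have -> : \sum_k dd (ex k) (H i) u * vert (Nc La) k u w =
   \sum_k w 0 (lshift m k) * (\sum_j dd (ex j) (H i) u * Nc La j k u)
   + \sum_k w 0 (rshift m k) * dd (ex k) (H i) u.
  under [X in _ = X + _]eq_bigr => k _ do rewrite mulr_sumr.
  rewrite exchange_big -big_split; apply: eq_bigr => k _ /=.
  rewrite /vert mulrDr mulr_sumr addrC [_ * w _ _]mulrC; congr (_ + _).
  by apply: eq_bigr => j _; rewrite mulrCA mulrC -mulrA mulrCA.
congr (_ + _); apply: eq_bigr => k _; rewrite -(Nc_change _ _ Uu) mulrDr addrC mulr_sumr.
by congr (_ + _); apply: eq_bigr => l _; rewrite mulrCA mulrA mulrA mulrAC.
Qed.

(** Horizontal and vertical components are multiplied by the same Jacobian, so exchanging them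
    commutes with the differential of [T]. *)
Lemma Psi_loc_change u w : U u ->
  'D_(Psi_loc La u w) T u = Psi_loc Lb (T u) ('D_w T u).
Proof.
move=> Uu; apply: Psi_loc_eq => i.
  rewrite (change_h _ _ Uu) (vert_change _ _ Uu); apply: eq_bigr => k _.
  by rewrite Psi_loc_h mulrC.
rewrite (change_h _ _ Uu) (vert_change _ _ Uu) -sumrN; apply: eq_bigr => k _.
by rewrite Psi_loc_vert mulrN mulrC.
Qed.

Lemma theta_change u w : U u -> theta Lb (T u) ('D_w T u) = theta La u w.
Proof.
move=> Uu; rewrite /theta.
have e k : y_low La k u = \sum_l dd (ex k) (H l) u * y_low Lb l (T u).
  rewrite (y_lowE hU sLa eulera k Uu) (dd_ext hU _ LT Uu) (dd_ey_change _ sLb Uu).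
  rewrite mulr_sumr; apply: eq_bigr => l _.
  by rewrite (y_lowE hU' sLb eulerb l (TU Uu)) mulrCA.
under eq_bigr => l _ do rewrite (change_h _ _ Uu) mulr_sumr.
rewrite exchange_big; apply: eq_bigr => k _ /=; rewrite e mulr_suml.
apply: eq_bigr => l _; move: (y_low _ _ _) (dd _ _ _) (w _ _) => a b c; ring.
Qed.

Lemma phi_change u w : U u -> phi Lb (T u) ('D_w T u) = phi La u w.
Proof.
move=> Uu; have Tu := TU Uu.
rewrite (phiE hU sLa eulera gunita _ Uu) (phiE hU' sLb eulerb gunitb _ Tu).
by rewrite (dd_ext hU _ LT Uu) (dd_comp w sT sLb Uu Tu).
Qed.

End CoordinateChange.

(** * Vector fields on a manifold given by an atlas *)

Lemma open_preimage_within (R : realType) (V W : normedModType R) (f : V -> W)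
    (O : set V) (B : set W) :
  open O -> (forall u, O u -> {for u, continuous f}) -> open B ->
  open [set u | O u /\ B (f u)].
Proof.
move=> Oo fc Bo; rewrite openE => u [Ou Bu].
have n1 : nbhs u O by exact: open_nbhs_nbhs.
have n2 : nbhs u (f @^-1` B) by apply: (fc u Ou); exact: open_nbhs_nbhs.
exact: filterI n1 n2.
Qed.

(** Related fields have related brackets: both sides are compared through the derivation that the
    bracket induces on each coordinate of [T]. *)
Lemma lie_change (R : realType) d (O O' : set 'rV[R]_d) (T xa ya xb yb : 'rV[R]_d -> 'rV[R]_d) :
  open O -> open O' -> smooth_on O T -> (forall u, O u -> O' (T u)) ->
  smooth_on O xa -> smooth_on O ya -> smooth_on O' xb -> smooth_on O' yb ->
  (forall u, O u -> xb (T u) = 'D_(xa u) T u) ->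
  (forall u, O u -> yb (T u) = 'D_(ya u) T u) ->
  forall u, O u -> lie xb yb (T u) = 'D_(lie xa ya u) T u.
Proof.
move=> Oo Oo' sT TO sxa sya sxb syb xT yT u Ou.
have sTi i := (smooth_row _ Oo).1 sT i.
have sxbi i := (smooth_row _ Oo').1 sxb i.
have sybi i := (smooth_row _ Oo').1 syb i.
apply/rowP => i; rewrite (derive_rowE _ _ sT Ou).
rewrite {2}lie.unlock (dd_lie Oo Ou sxa sya (sTi i)).
have e (z zb : 'rV[R]_d -> 'rV[R]_d) :
    (forall w, O w -> zb (T w) = 'D_(z w) T w) ->
    forall w, O w -> dd (z w) (fun v => T v 0 i) w = zb (T w) 0 i.
  by move=> H w Ow; rewrite H // (derive_rowE _ _ sT Ow).
rewrite (dd_ext Oo _ (e _ _ yT) Ou) (dd_ext Oo _ (e _ _ xT) Ou).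
rewrite (dd_comp _ sT (sybi i) Ou (TO u Ou)) (dd_comp _ sT (sxbi i) Ou (TO u Ou)).
rewrite -xT // -yT // lie.unlock mxE (derive_rowE _ _ syb (TO u Ou)) mxE.
by rewrite (derive_rowE _ _ sxb (TO u Ou)).
Qed.

Section Charts.
Context {R : realType} {d : nat} {N : Type}.
Variable A : atlas R d N.
Hypothesis chart_inj : forall (a : chart A) p q,
  chart_dom A a p -> chart_dom A a q -> chart_map A a p = chart_map A a q -> p = q.
Let ovl (a b : chart A) := chart_map A a @` (chart_dom A a `&` chart_dom A b).
Hypothesis trans_open : forall a b, open (ovl a b).
Hypothesis trans_smooth : forall a b, smooth_on (ovl a b) (transition A a b).

Implicit Types (a b c : chart A) (p q : N).

Lemma in_chartE (V : zmodType) a (f : N -> V) p : chart_dom A a p ->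
  in_chart A a f (chart_map A a p) = f p.
Proof.
move=> ap; rewrite /in_chart; apply: xget_unique; first by exists p.
by move=> _ [q [aq e] <-]; congr f; exact: (chart_inj aq ap e).
Qed.

Lemma transitionE a b p : chart_dom A a p ->
  transition A a b (chart_map A a p) = chart_map A b p.
Proof. exact: in_chartE. Qed.

Lemma ovl_in a b p : chart_dom A a p -> chart_dom A b p -> ovl a b (chart_map A a p).
Proof. by move=> ap bp; exists p. Qed.

Lemma open_chart_image a : open (chart_map A a @` chart_dom A a).
Proof. by have := @trans_open a a; rewrite /ovl setIid. Qed.

Lemma open_chart_imageT a : open (chart_map A a @` (setT `&` chart_dom A a)).
Proof. by rewrite setTI; exact: open_chart_image. Qed.

Lemma trans_diff a b p : chart_dom A a p -> chart_dom A b p ->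
  differentiable (transition A a b) (chart_map A a p).
Proof. by move=> ap bp; exact: (smooth_diff (@trans_smooth a b)) (ovl_in ap bp). Qed.

Lemma transD a b p w : chart_dom A a p -> chart_dom A b p ->
  'd (transition A a b) (chart_map A a p) w = 'D_w (transition A a b) (chart_map A a p).
Proof. by move=> ap bp; rewrite deriveE //; exact: trans_diff. Qed.

Lemma trans_id a p w : chart_dom A a p -> 'D_w (transition A a a) (chart_map A a p) = w.
Proof.
move=> ap; rewrite (eqon_derive (U := ovl a a) (g := id)) ?derive_id //.
- by move=> _ [q [aq _] <-]; rewrite transitionE.
- exact: ovl_in.
Qed.

Lemma trans_cocycle a b c p w : chart_dom A a p -> chart_dom A b p -> chart_dom A c p ->
  'D_('D_w (transition A a b) (chart_map A a p)) (transition A b c) (chart_map A b p)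
  = 'D_w (transition A a c) (chart_map A a p).
Proof.
move=> ap bp cp.
rewrite -(eqon_derive (U := ovl a b `&` ovl a c)
   (f := fun u => transition A b c (transition A a b u)) (g := transition A a c)).
- rewrite (derive_comp (g := transition A b c) w (trans_diff ap bp)) ?transitionE //.
  exact: trans_diff.
- exact: openI.
- move=> _ [[q [aq bq] <-] [q' [aq' cq'] e]].
  by rewrite !transitionE.
- by split; exact: ovl_in.
Qed.

(** In any other chart the image of [U] is a preimage under a transition map, which is continuous on
    an open set. *)
Lemma chart_open_of a (U : set N) : U `<=` chart_dom A a ->
  open (chart_map A a @` U) -> chart_open A U.
Proof.
move=> Ua Uo b.
have -> : chart_map A b @` (U `&` chart_dom A b) =
    [set w | ovl b a w /\ (chart_map A a @` U) (transition A b a w)].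
  apply/seteqP; split.
    move=> _ [p [Up bp] <-]; split; first by apply: ovl_in => //; exact: Ua.
    by exists p => //; rewrite transitionE.
  move=> _ [[p [bp ap] <-]]; rewrite transitionE // => -[q Uq e].
  have qp : q = p by apply: (@chart_inj a) => //; exact: Ua.
  by exists p => //; split => //; rewrite -qp.
apply: open_preimage_within => // u Ou.
by apply: differentiable_continuous; exact: smooth_diff (@trans_smooth b a) Ou.
Qed.

(** Extends components given in the chart [a] to all charts around [q]; the value 0 elsewhere is the
    convention of [tangent]. A constant [xi] yields a single tangent vector with prescribed
    components. *)
Definition push_field a (xi : 'rV[R]_d -> 'rV[R]_d) q : chart A -> 'rV[R]_d :=
  fun b => if `[< chart_dom A b q >]
    then 'D_(xi (chart_map A a q)) (transition A a b) (chart_map A a q) else 0.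

Lemma push_fieldE a xi q : chart_dom A a q -> push_field a xi q a = xi (chart_map A a q).
Proof. by move=> aq; rewrite /push_field; case: asboolP => // _; rewrite trans_id. Qed.

Lemma push_field_tangent a xi q : chart_dom A a q -> tangent A q (push_field a xi q).
Proof.
move=> aq; split=> [b bq|b c bq cq]; first by rewrite /push_field; case: asboolP.
rewrite /push_field; case: asboolP => // _; case: asboolP => // _.
by rewrite (transD _ bq cq) (trans_cocycle _ aq bq cq).
Qed.

Lemma vector_field_push a (U : set N) xi : U `<=` chart_dom A a ->
  open (chart_map A a @` U) -> smooth_on (chart_map A a @` U) xi ->
  vector_field A U (push_field a xi).
Proof.
move=> Ua Uo sxi; split=> [p /Ua|b]; first exact: push_field_tangent.
have Ub : open (chart_map A b @` (U `&` chart_dom A b)) by exact: (@chart_open_of a U Ua Uo b).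
pose W := (chart_map A a @` U) `&` ovl a b.
have Wo : open W by exact: openI.
(* The field in chart [b], still written as a function of the coordinates of [a]; composing with the
   transition from [b] to [a] gives its expression in [b]. *)
have sG : smooth_on W (fun u => 'D_(xi u) (transition A a b) u).
  apply: smooth_derive_along => //.
    by apply: smooth_sub (@trans_smooth a b) => u [].
  by apply: smooth_sub sxi => u [].
have sT : smooth_on (chart_map A b @` (U `&` chart_dom A b)) (transition A b a).
  apply: smooth_sub (@trans_smooth b a) => _ [p [Up bp] <-].
  by apply: ovl_in => //; exact: Ua.
have TW u : (chart_map A b @` (U `&` chart_dom A b)) u -> W (transition A b a u).
  move=> [p [Up bp] <-]; rewrite transitionE //.
  by split; [exists p|apply: ovl_in => //; exact: Ua].
apply: smooth_ext (smooth_comp_row Ub Wo TW sT sG) => //.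
move=> _ [p [Up bp] <-]; rewrite in_chartE // transitionE //.
by rewrite /push_field; case: asboolP.
Qed.

Lemma tangentD p (v w : chart A -> 'rV[R]_d) : tangent A p v -> tangent A p w ->
  tangent A p (v + w).
Proof.
move=> [v0 vt] [w0 wt]; split=> [a na|a b ap bp].
  by rewrite fctE v0 // w0 // addr0.
by rewrite !fctE (vt _ _ ap bp) (wt _ _ ap bp) linearD.
Qed.

Lemma tangentN p (v : chart A -> 'rV[R]_d) : tangent A p v -> tangent A p (- v).
Proof.
move=> [v0 vt]; split=> [a na|a b ap bp]; first by rewrite fctE v0 // oppr0.
by rewrite !fctE (vt _ _ ap bp) linearN.
Qed.

Section Bracket.
Variables X Y : N -> chart A -> 'rV[R]_d.
Hypotheses (hX : vector_field A setT X) (hY : vector_field A setT Y).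

Lemma bracketE a p : chart_dom A a p ->
  bracket A X Y p a = lie (in_chart A a (X^~ a)) (in_chart A a (Y^~ a)) (chart_map A a p).
Proof. by move=> ap; rewrite /bracket lie.unlock; case: asboolP. Qed.

Lemma bracket_out a p : ~ chart_dom A a p -> bracket A X Y p a = 0.
Proof. by move=> ap; rewrite /bracket; case: asboolP. Qed.

Let ovlT a b u : ovl a b u -> (chart_map A a @` (setT `&` chart_dom A a)) u.
Proof. by move=> [p [ap bp] <-]; exists p. Qed.

Lemma bracket_tangent p : tangent A p (bracket A X Y p).
Proof.
split=> [a|a b ap bp]; first exact: bracket_out.
have field_change (Z : N -> chart A -> 'rV[R]_d) : vector_field A setT Z ->
    forall u, ovl a b u -> in_chart A b (Z^~ b) (transition A a b u)
      = 'D_(in_chart A a (Z^~ a) u) (transition A a b) u.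
  move=> [tZ _] _ [q [aq bq] <-]; rewrite transitionE // !in_chartE //.
  by have [_ /(_ a b aq bq)] := tZ q I; rewrite transD.
rewrite transD // !bracketE // -(transitionE b ap).
apply: (lie_change (O := ovl a b) (O' := ovl b a)) => //.
- by move=> _ [q [aq bq] <-]; rewrite transitionE //; exact: ovl_in.
- exact: smooth_sub (@ovlT a b) (hX.2 a).
- exact: smooth_sub (@ovlT a b) (hY.2 a).
- exact: smooth_sub (@ovlT b a) (hX.2 b).
- exact: smooth_sub (@ovlT b a) (hY.2 b).
- exact: field_change.
- exact: field_change.
- exact: ovl_in.
Qed.

Lemma bracket_smooth a : smooth_on (chart_map A a @` (setT `&` chart_dom A a))
  (lie (in_chart A a (X^~ a)) (in_chart A a (Y^~ a))).
Proof.
have Oo := @open_chart_imageT a.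
apply/(smooth_row _ Oo) => i.
have sx := hX.2 a; have sy := hY.2 a.
have s1 := (smooth_row _ Oo).1 (smooth_derive_along Oo sy sx) i.
have s2 := (smooth_row _ Oo).1 (smooth_derive_along Oo sx sy) i.
apply: smooth_ext (smooth_add Oo s1 (smooth_opp Oo s2)) => // u _.
by rewrite lie.unlock mxE [X in _ = _ + X]mxE.
Qed.

End Bracket.

End Charts.

(** * The slit tangent bundle *)

Lemma lsubmx_derive (R : realType) m1 m2 (v w : 'rV[R]_(m1 + m2)) :
  'D_v (fun u : 'rV[R]_(m1 + m2) => lsubmx u) w = lsubmx v.
Proof.
apply/rowP => i; rewrite -derive_coord; last exact: differentiable_lsubmx.
rewrite (_ : (fun _ => _) = fun u : 'rV[R]_(m1 + m2) => u 0 (lshift m2 i)).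
  by rewrite derive_proj mxE.
by apply/funext => u; rewrite mxE.
Qed.

Section SlitTangentBundle.
Context {R : realType} {m : nat} {M : Type}.
Variable A : atlas R m M.
Hypothesis hM : smooth_manifold A.
Let B := T0M_atlas A.

Implicit Types (a b c : chart A) (p q : M) (z : T0M A).

Lemma baseA_inj a p q : chart_dom A a p -> chart_dom A a q ->
  chart_map A a p = chart_map A a q -> p = q.
Proof. by have [_ inj _ _ _] := hM; exact: inj. Qed.

Definition overlap a b : set 'rV[R]_m := chart_map A a @` (chart_dom A a `&` chart_dom A b).

Lemma overlap_open a b : open (overlap a b).
Proof. by have [_ _ tr _ _] := hM; have [] := tr a b. Qed.

Lemma overlap_smooth a b : smooth_on (overlap a b) (transition A a b).
Proof. by have [_ _ tr _ _] := hM; have [] := tr a b. Qed.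

Definition lift_point a p (y : 'rV[R]_m) (ap : chart_dom A a p) : TM A :=
  MkTM (push_field_tangent baseA_inj overlap_open overlap_smooth (fun=> y) ap).

Lemma lift_point_neq0 a p y (ap : chart_dom A a p) : y != 0 -> vec (lift_point y ap) <> 0.
Proof.
move=> y0 e; have : vec (lift_point y ap) a = 0 by rewrite e.
rewrite /= (push_fieldE baseA_inj overlap_open (fun=> y) ap).
by move/eqP: y0.
Qed.

Lemma vec_trans a b (z : TM A) : chart_dom A a (base z) -> chart_dom A b (base z) ->
  vec z b = 'D_(vec z a) (transition A a b) (chart_map A a (base z)).
Proof.
move=> az bz; have [_ /(_ a b az bz) ->] := vec_tangent z.
exact: (transD overlap_smooth).
Qed.

Lemma vec_eq a (z z' : TM A) : chart_dom A a (base z) -> base z = base z' ->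
  vec z a = vec z' a -> vec z = vec z'.
Proof.
move=> az bb e; apply/funext => b.
have [bz|nb] := pselect (chart_dom A b (base z)); last first.
  by rewrite (vec_tangent z).1 // (vec_tangent z').1 // -bb.
have az' : chart_dom A a (base z') by rewrite -bb.
have bz' : chart_dom A b (base z') by rewrite -bb.
by rewrite (vec_trans az bz) (vec_trans az' bz') e bb.
Qed.

Lemma TM_eq (z z' : TM A) : base z = base z' -> vec z = vec z' -> z = z'.
Proof.
case: z => p v vt; case: z' => p' v' vt' /= e1 e2; subst p' v'.
by rewrite (Prop_irrelevance vt vt').
Qed.

Lemma T0M_eq z z' : sval z = sval z' -> z = z'.
Proof.
case: z => p h; case: z' => p' h' /= e; subst p'.
by rewrite (Prop_irrelevance h h').
Qed.

(** All other components are linear images of this one, so its vanishing would kill the whole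
    family. *)
Lemma vec_chart_neq0 a z : chart_dom A a (base (sval z)) -> vec (sval z) a != 0.
Proof.
move=> az; apply/eqP => e; case: (svalP z); apply/funext => b.
have [bz|nb] := pselect (chart_dom A b (base (sval z))); last first.
  by rewrite (vec_tangent (sval z)).1.
by rewrite (vec_trans az bz) e derive0.
Qed.

(** Every nonzero [y] over a point of the chart is realised by [lift_point]; openness questions on
    the slit bundle thus reduce to those on [M]. *)
Lemma chart_imageT0 a (P : set M) :
  chart_map B a @` ([set z | P (base (sval z))] `&` chart_dom B a) =
  [set w | (chart_map A a @` (P `&` chart_dom A a)) (lsubmx w) /\ rsubmx w != 0].
Proof.
apply/seteqP; split.
  move=> _ [z [Pz az] <-] /=; rewrite row_mxKl row_mxKr.
  by split; [exists (base (sval z))|exact: vec_chart_neq0].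
move=> w [[p [Pp ap] e] w0].
exists (exist _ (lift_point (rsubmx w) ap) (lift_point_neq0 (ap := ap) w0)) => //=.
by rewrite (push_fieldE baseA_inj overlap_open (fun=> rsubmx w) ap) e hsubmxK.
Qed.

Lemma continuous_lsubmx : continuous (fun u : 'rV[R]_(m + m) => lsubmx u).
Proof. by move=> u; apply: differentiable_continuous; exact: differentiable_lsubmx. Qed.

Lemma continuous_rsubmx : continuous (fun u : 'rV[R]_(m + m) => rsubmx u).
Proof. by move=> u; apply: differentiable_continuous; exact: differentiable_rsubmx. Qed.

Lemma open_slit (O : set 'rV[R]_m) : open O ->
  open [set w : 'rV[R]_(m + m) | O (lsubmx w) /\ rsubmx w != 0].
Proof.
move=> Oo.
have -> : [set w : 'rV[R]_(m + m) | O (lsubmx w) /\ rsubmx w != 0] =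
   (fun w : 'rV[R]_(m + m) => lsubmx w) @^-1` O `&`
   (fun w : 'rV[R]_(m + m) => rsubmx w) @^-1` ~` [set 0].
  by apply/seteqP; split => w [Ow /eqP w0].
apply: openI; apply: open_comp => //.
- by move=> u _; exact: continuous_lsubmx.
- by move=> u _; exact: continuous_rsubmx.
- apply: closed_openC; apply: compact_closed; [exact: norm_hausdorff|exact: compact_set1].
Qed.

Lemma T0M_inj a z z' : chart_dom B a z -> chart_dom B a z' ->
  chart_map B a z = chart_map B a z' -> z = z'.
Proof.
move=> /= az az' /eq_row_mx[e1 e2]; have bb := baseA_inj az az' e1.
by apply: T0M_eq; apply: TM_eq => //; exact: vec_eq az bb e2.
Qed.

Definition slit a b : set 'rV[R]_(m + m) :=
  chart_map B a @` (chart_dom B a `&` chart_dom B b).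

Lemma slitE a b : slit a b = [set w | overlap a b (lsubmx w) /\ rsubmx w != 0].
Proof. by rewrite /slit setIC (chart_imageT0 a (chart_dom A b)) /overlap setIC. Qed.

Lemma slit_open a b : open (slit a b).
Proof. by rewrite slitE; apply: open_slit; exact: overlap_open. Qed.

Lemma T0M_transition a b w : slit a b w -> transition B a b w =
  row_mx (transition A a b (lsubmx w)) ('D_(rsubmx w) (transition A a b) (lsubmx w)).
Proof.
move=> [z [az bz] <-]; rewrite (transitionE (A := B) T0M_inj b az) /= row_mxKl row_mxKr.
by rewrite (transitionE baseA_inj b az) (vec_trans az bz).
Qed.

Section Transition.
Variables a b : chart A.
Let f l x : R := transition A a b x 0 l.
Let P k l (w : 'rV[R]_(m + m)) : R := dd (delta_mx 0 k) (f l) (lsubmx w).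

Let sf l : smooth_on (overlap a b) (f l).
Proof. exact: (smooth_row _ (@overlap_open a b)).1 (@overlap_smooth a b) l. Qed.

Let slO w : slit a b w -> overlap a b (lsubmx w).
Proof. by rewrite slitE => -[]. Qed.

Lemma smooth_lsubmx : smooth_on (slit a b) (fun w : 'rV[R]_(m + m) => lsubmx w).
Proof.
apply/(smooth_row _ (@slit_open a b)) => i.
apply: smooth_ext (@smooth_proj _ _ _ (lshift m i)); first exact: slit_open.
by move=> u _; rewrite mxE.
Qed.

Lemma smooth_base (h : 'rV[R]_m -> R) : smooth_on (overlap a b) h ->
  smooth_on (slit a b) (fun w => h (lsubmx w)).
Proof.
exact: (smooth_comp (@slit_open a b) (@overlap_open a b) slO smooth_lsubmx).
Qed.

Let sP k l : smooth_on (slit a b) (P k l).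
Proof. by apply: smooth_base; apply: smooth_dd => //; exact: overlap_open. Qed.

Lemma T0M_trans_l l w : slit a b w -> transition B a b w 0 (lshift m l) = f l (lsubmx w).
Proof. by move=> sw; rewrite T0M_transition // row_mxEl. Qed.

Lemma T0M_trans_r l w : slit a b w -> transition B a b w 0 (rshift m l) =
  \sum_j w 0 (rshift m j) * P j l w.
Proof.
move=> sw; rewrite T0M_transition // row_mxEr.
rewrite (derive_rowE _ _ (@overlap_smooth a b) (slO sw)) (dd_partials _ (sf l) (slO sw)).
by apply: eq_bigr => j _; rewrite mxE.
Qed.

Lemma T0M_trans_smooth : smooth_on (slit a b) (transition B a b).
Proof.
have So := @slit_open a b.
apply/(smooth_row _ So) => i; case: (split_ordP i) => l ->.
  apply: smooth_ext (smooth_base (sf l)) => // w sw.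
  by rewrite T0M_trans_l.
have H : smooth_on (slit a b) (fun w => \sum_j w 0 (rshift m j) * P j l w) by smooth.
by apply: smooth_ext H => // w sw; rewrite T0M_trans_r.
Qed.

Lemma dd_base (h : 'rV[R]_m -> R) v w : smooth_on (overlap a b) h -> slit a b w ->
  dd v (fun w => h (lsubmx w)) w = dd (lsubmx v) h (lsubmx w).
Proof.
move=> sh sw; rewrite (dd_comp v smooth_lsubmx sh sw (slO sw)).
by rewrite lsubmx_derive.
Qed.

Lemma lsubmx_ex k : lsubmx (ex k : 'rV[R]_(m + m)) = delta_mx 0 k.
Proof. by rewrite /ex row_mxKl. Qed.

Lemma lsubmx_ey k : lsubmx (ey k : 'rV[R]_(m + m)) = 0.
Proof. by rewrite /ey row_mxKl. Qed.

Lemma dd_dir0 d (h : 'rV[R]_d -> R) u : dd 0 h u = 0.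
Proof. by rewrite ddE derive0. Qed.

Lemma dd_ex_trans_l k l w : slit a b w ->
  dd (ex k) (fun w => transition B a b w 0 (lshift m l)) w = P k l w.
Proof.
move=> sw; rewrite (dd_ext (@slit_open a b) _ (T0M_trans_l l) sw).
by rewrite dd_base // lsubmx_ex.
Qed.

(** This lemma and the next three supply the hypotheses [T1] to [T4] of the coordinate change, in
    this order. *)
Lemma dd_ey_trans_l k l w : slit a b w ->
  dd (ey k) (fun w => transition B a b w 0 (lshift m l)) w = 0.
Proof.
move=> sw; rewrite (dd_ext (@slit_open a b) _ (T0M_trans_l l) sw).
by rewrite dd_base // lsubmx_ey dd_dir0.
Qed.

Lemma dd_ey_trans_r k l w : slit a b w ->
  dd (ey k) (fun w => transition B a b w 0 (rshift m l)) w
  = dd (ex k) (fun w => transition B a b w 0 (lshift m l)) w.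
Proof.
move=> sw; rewrite dd_ex_trans_l //.
rewrite (dd_ext (@slit_open a b) _ (T0M_trans_r l) sw).
rewrite (dd_sum _ _ _ _ sw); last by move=> j; smooth; exact: slit_open.
rewrite (bigD1 k) //= big1 ?addr0 => [|j jk]; rewrite (dd_mul _ _ _ sw) //; try exact: smooth_proj.
  rewrite dd_proj eyY eqxx mul1r dd_base //; last first.
    by apply: smooth_dd => //; exact: overlap_open.
  by rewrite lsubmx_ey dd_dir0 mulr0 addr0.
rewrite dd_proj eyY (negbTE jk) mul0r dd_base //; last first.
  by apply: smooth_dd => //; exact: overlap_open.
by rewrite lsubmx_ey dd_dir0 mulr0 addr0.
Qed.

Lemma T0M_trans_r_spray l w : slit a b w -> transition B a b w 0 (rshift m l) =
  \sum_j w 0 (rshift m j) * dd (ex j) (fun w => transition B a b w 0 (lshift m l)) w.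
Proof.
move=> sw; rewrite T0M_trans_r //; apply: eq_bigr => j _.
by rewrite dd_ex_trans_l.
Qed.

Lemma T0M_trans_nondegenerate w (c : 'I_m -> R) : slit a b w ->
  (forall k, \sum_l dd (ex k) (fun w => transition B a b w 0 (lshift m l)) w * c l = 0) ->
  forall l, c l = 0.
Proof.
move=> sw H l0; have [p [ap bp] e] := slO sw.
have K v : \sum_l ('D_v (transition A a b) (lsubmx w)) 0 l * c l = 0.
  have E l : ('D_v (transition A a b) (lsubmx w)) 0 l = \sum_k v 0 k * P k l w.
    by rewrite (derive_rowE _ _ (@overlap_smooth a b) (slO sw)) (dd_partials _ (sf l) (slO sw)).
  under eq_bigr => l _ do rewrite E mulr_suml.
  rewrite exchange_big big1 //= => k _.
  under eq_bigr => l _ do rewrite -mulrA.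
  rewrite -mulr_sumr -[RHS](mulr0 (v 0 k)) -[in RHS](H k); congr (_ * _).
  by apply: eq_bigr => l _; rewrite dd_ex_trans_l.
(* By the cocycle identity, the differential of the transition from [a] to [b] sends this direction
   to the basis vector [l0], which isolates [c l0]. *)
have := K ('D_(delta_mx 0 l0) (transition A b a) (chart_map A b p)).
rewrite -e (trans_cocycle baseA_inj overlap_open overlap_smooth _ bp ap bp).
rewrite (trans_id baseA_inj overlap_open _ bp).
rewrite (bigD1 l0) //= mxE !eqxx mul1r big1 ?addr0 // => l ll0.
by rewrite mxE (negbTE ll0) andbF mul0r.
Qed.

End Transition.

Lemma T0M_manifold : smooth_manifold B.
Proof.
have [cov _ _ haus [C [Cc Ccov]]] := hM.
have baseopen U : chart_open A U -> chart_open B [set z | U (base (sval z))].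
  by move=> Uo a; rewrite chart_imageT0; apply: open_slit; exact: Uo.
split.
- by move=> z; have [a az] := cov (base (sval z)); exists a.
- exact: T0M_inj.
- by move=> a b; split; [exact: slit_open|exact: T0M_trans_smooth].
- move=> z z' zz'.
  (* Distinct base points are separated by open sets pulled back from [M]; two vectors at the same
     point lie in one chart and are separated in its image. *)
  have [bb|bb] := pselect (base (sval z) = base (sval z')); last first.
    have [U [V [Uo Vo Uz Vz UV]]] := haus _ _ bb.
    exists [set z | U (base (sval z))], [set z | V (base (sval z))].
    split=> //; [exact: baseopen|exact: baseopen|].
    apply/seteqP; split => // t [Ut Vt].
    by have : (U `&` V) (base (sval t)) by []; rewrite UV.
  have [a az] := cov (base (sval z)).
  have az' : chart_dom A a (base (sval z')) by rewrite -bb.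
  have ne : chart_map B a z != chart_map B a z'.
    by apply/eqP => e; apply: zz'; exact: T0M_inj e.
  have : hausdorff_space 'rV[R]_(m + m) by exact: norm_hausdorff.
  rewrite open_hausdorff => /(_ _ _ ne)[[P Q] /= [Pz Qz] [Po Qo PQ]].
  have op S : open S -> chart_open B [set t | chart_dom B a t /\ S (chart_map B a t)].
    move=> So; apply: (@chart_open_of _ _ _ B T0M_inj slit_open T0M_trans_smooth a) => [t []//|].
    have -> : chart_map B a @` [set t | chart_dom B a t /\ S (chart_map B a t)]
      = slit a a `&` S.
      apply/seteqP; split.
        by move=> _ [t [at_ St] <-]; split => //; exists t.
      by move=> _ [[t [at_ _] <-] St]; exists t.
    by apply: openI => //; exact: slit_open.
  exists [set t | chart_dom B a t /\ P (chart_map B a t)],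
    [set t | chart_dom B a t /\ Q (chart_map B a t)].
  split; [exact: op|exact: op| | |].
  + by split => //; move: Pz; rewrite inE.
  + by split => //; move: Qz; rewrite inE.
  + apply/seteqP; split => // t [[_ Pt] [_ Qt]].
    by have : (P `&` Q) (chart_map B a t) by []; rewrite (eqP PQ).
- by exists C; split => // z; exact: Ccov.
Qed.

End SlitTangentBundle.

(** * The structural distribution *)

Section FinslerCharts.
Context {R : realType} {m : nat} {M : Type}.
Variable A : atlas R m M.
Hypothesis hM : smooth_manifold A.
Variable F : TM A -> R.
Hypothesis hF : finsler F.
Let B := T0M_atlas A.

Implicit Types (a b c : chart A) (z : T0M A).
Let L a := F2_in_chart F a.
Let O a := chart_map B a @` chart_dom B a.

Lemma slit_chart a : slit (A := A) a a = O a.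
Proof. by rewrite /slit setIid. Qed.

Lemma slit_sub a b : slit (A := A) a b `<=` O a.
Proof. by move=> _ [z [az _] <-]; exists z. Qed.

Lemma image_open a : open (O a).
Proof. by rewrite -slit_chart; exact: (slit_open hM). Qed.

Lemma F2E a z : chart_dom B a z -> L a (chart_map B a z) = F (sval z) ^+ 2.
Proof. by move=> az; rewrite /L /F2_in_chart (in_chartE (A := B) (T0M_inj hM)). Qed.

Lemma F2_smooth a : smooth_on (O a) (L a).
Proof.
have [_ sF _ _ _] := hF; have {}sF := sF a.
have sF' : smooth_on (O a) (in_chart B a (fun z => F (sval z)) : 'rV[R]_(m + m) -> R) by exact: sF.
apply: (smooth_ext (image_open (a := a)) _ (smooth_mul (image_open (a := a)) sF' sF')).
move=> _ [z az <-]; rewrite F2E // expr2.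
by rewrite (in_chartE (A := B) (T0M_inj hM)).
Qed.

Lemma F2_transition a b u : slit a b u -> L a u = L b (transition B a b u).
Proof.
move=> [z [az bz] <-]; rewrite (transitionE (A := B) (T0M_inj hM) b az).
by rewrite !F2E.
Qed.

Lemma F2_scale a u (c : R) : 0 < c -> O a u ->
  L a (row_mx (lsubmx u) (c *: rsubmx u)) = c ^+ 2 * L a u.
Proof.
move=> c0 [z az <-].
have [_ _ _ homF _] := hF.
have zc0 : vec (scaleTM c (sval z)) <> 0.
  move=> e; have : vec (scaleTM c (sval z)) a = 0 by rewrite e.
  rewrite /= fctE => /eqP; rewrite scaler_eq0 (gt_eqF c0) /=.
  by rewrite (negbTE (vec_chart_neq0 hM az)).
pose z' : T0M A := exist (fun t : TM A => vec t <> 0) _ zc0.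
have az' : chart_dom B a z' by [].
have -> : row_mx (lsubmx (chart_map B a z)) (c *: rsubmx (chart_map B a z)) = chart_map B a z'.
  by rewrite /= row_mxKl row_mxKr.
by rewrite !F2E // homF // exprMn.
Qed.

Lemma F2_euler a u : O a u -> dd (row_mx 0 (rsubmx u)) (L a) u = 2 * L a u.
Proof.
move=> Ou; set v := row_mx 0 (rsubmx u).
have dL : differentiable (L a) (u + 0 *: v).
  by rewrite scale0r addr0; exact: smooth_diff (@F2_smooth a) Ou.
have H1 := is_derive_line dL; rewrite scale0r addr0 in H1.
(* Homogeneity only concerns positive factors, hence the restriction to s > -1; differentiating both
   sides at s = 0 gives Euler's identity. *)
have near0 : \forall s \near (0 : R), (1 + s) * (1 + s) * L a u = L a (u + s *: v).
  have : \forall s \near (0 : R), - 1 < s by apply: lt_nbhsr; rewrite ltrN10.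
  apply: filterS => s s1; have s0 : 0 < 1 + s by rewrite -ltrBlDl sub0r.
  rewrite -expr2 -F2_scale //; congr (L a _).
  rewrite /v scale_row_mx scaler0 scalerDl scale1r.
  by rewrite -[X in _ = X + _](hsubmxK u) add_row_mx addr0.
rewrite ddE -(@derive_val _ _ _ _ _ _ _ H1) -(near_eq_derive _ near0).
have did (x : R) : differentiable (fun s : R => 1 + s) x.
  by apply: differentiableD => //; exact: differentiable_cst.
have d1 (x : R) : 'D_1 (fun s : R => 1 + s) x = 1.
  rewrite derive_add ?derive_cst ?derive_id ?add0r //; exact: differentiable_cst.
rewrite derive_mul; [|by apply: differentiableM|exact: differentiable_cst].
rewrite derive_mul // derive_cst !d1 mulr0 /= !addr0 !mulr1.
by [].
Qed.

Lemma F2_gunit a u : O a u -> gmx (L a) u \in unitmx.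
Proof. by have [_ _ _ _ hG] := hF; move=> [z az <-]; have [] := hG z a az. Qed.

(** By [y_low_sum], F^2 is the positive definite form g_ij evaluated at y, which is nonzero on the
    slit bundle. *)
Lemma F2_pos a u : O a u -> 0 < L a u.
Proof.
move=> Ou; have [_ _ _ _ hG] := hF; have [z az e] := Ou.
have [_ pos] := hG z a az.
have /eqP w0 := vec_chart_neq0 hM az; have := pos _ w0; rewrite e.
rewrite -(y_low_sum (@image_open a) (@F2_smooth a) (@F2_euler a) Ou).
rewrite mxE; congr (0 < _); apply: eq_bigr => i _.
rewrite !mxE -e /= row_mxEr; congr (_ * _); apply: eq_bigr => j _.
rewrite y_upE row_mxEr mulrC; congr (_ * _).
have := gC (@image_open a) (@F2_smooth a) j i Ou; rewrite -e; exact.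
Qed.

Section Transition.
Variables a b : chart A.

Let smLa : smooth_on (slit a b) (L a).
Proof. exact: smooth_sub (@slit_sub a b) (@F2_smooth a). Qed.

Let image_trans u : slit a b u -> O b (transition B a b u).
Proof.
move=> [z [az bz] <-]; exists z => //.
by rewrite (transitionE (A := B) (T0M_inj hM) b az).
Qed.

Let eulerS u (Ou : slit a b u) := F2_euler (slit_sub Ou).
Let gunitS u (Ou : slit a b u) := F2_gunit (slit_sub Ou).

Lemma F2_Psi_change u w : slit a b u ->
  'D_(Psi_loc (L a) u w) (transition B a b) u
  = Psi_loc (L b) (transition B a b u) ('D_w (transition B a b) u).
Proof.
apply: (Psi_loc_change (@slit_open _ _ _ A hM a b) smLa eulerS gunitS (@image_open b) (@F2_smooth b)
  (@F2_euler b) (@F2_gunit b) (@T0M_trans_smooth _ _ _ A hM a b) image_trans (@F2_transition a b)).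
- by move=> k l v; exact: dd_ey_trans_l.
- by move=> k l v; exact: dd_ey_trans_r.
- by move=> l v; exact: T0M_trans_r_spray.
- by move=> v sv c; exact: T0M_trans_nondegenerate.
Qed.

Lemma F2_theta_change u w : slit a b u ->
  theta (L b) (transition B a b u) ('D_w (transition B a b) u) = theta (L a) u w.
Proof.
apply: (theta_change (@slit_open _ _ _ A hM a b) smLa eulerS (@image_open b) (@F2_smooth b)
  (@F2_euler b) (@T0M_trans_smooth _ _ _ A hM a b) image_trans (@F2_transition a b)).
- by move=> k l v; exact: dd_ey_trans_l.
- by move=> k l v; exact: dd_ey_trans_r.
Qed.

Lemma F2_phi_change u w : slit a b u ->
  phi (L b) (transition B a b u) ('D_w (transition B a b) u) = phi (L a) u w.
Proof.
apply: (phi_change (@slit_open _ _ _ A hM a b) smLa eulerS gunitS (@image_open b) (@F2_smooth b)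
  (@F2_euler b) (@F2_gunit b) (@T0M_trans_smooth _ _ _ A hM a b) image_trans (@F2_transition a b)).
Qed.

End Transition.

End FinslerCharts.

Lemma lie_ext (R : realType) d (U : set 'rV[R]_d) (x y x' y' : 'rV[R]_d -> 'rV[R]_d) u :
  open U -> (forall w, U w -> x w = x' w) -> (forall w, U w -> y w = y' w) -> U u ->
  lie x y u = lie x' y' u.
Proof.
move=> Uo xx yy Uu; rewrite lie.unlock (xx u Uu) (yy u Uu).
by rewrite (eqon_derive (x' u) Uo yy Uu) (eqon_derive (y' u) Uo xx Uu).
Qed.

Lemma smooth_row_sub (R : realType) d e (U : set 'rV[R]_d) (f g : 'rV[R]_d -> 'rV[R]_e) :
  open U -> smooth_on U f -> smooth_on U g -> smooth_on U (fun u => f u - g u).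
Proof.
move=> Uo sf sg; apply/(smooth_row _ Uo) => i.
have sfi := (smooth_row _ Uo).1 sf i; have sgi := (smooth_row _ Uo).1 sg i.
apply: (smooth_ext Uo _ (smooth_add Uo sfi (smooth_opp Uo sgi))) => u _.
by rewrite mxE [X in _ = _ + X]mxE.
Qed.

Section StructuralDistribution.
Context {R : realType} {m : nat} {M : Type}.
Variable A : atlas R m M.
Hypothesis hM : smooth_manifold A.
Variable F : TM A -> R.
Hypothesis hF : finsler F.
Let B := T0M_atlas A.

Implicit Types (a b c : chart A) (z : T0M A) (v : chart A -> 'rV[R]_(m + m)).
Let L a := F2_in_chart F a.
Let O a := chart_map B a @` chart_dom B a.

Let Binj := T0M_inj hM.
Let Bopen : forall a b, open (chart_map B a @` (chart_dom B a `&` chart_dom B b)).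
Proof. exact: slit_open. Qed.
Let Bsmooth : forall a b, smooth_on (chart_map B a @` (chart_dom B a `&` chart_dom B b))
  (transition B a b).
Proof. exact: T0M_trans_smooth. Qed.

Let Oopen a : open (O a). Proof. exact: image_open. Qed.
Let sL a : smooth_on (O a) (L a). Proof. exact: F2_smooth. Qed.
Let eL a u : O a u -> dd (row_mx 0 (rsubmx u)) (L a) u = 2 * L a u.
Proof. exact: F2_euler. Qed.
Let gL a u : O a u -> gmx (L a) u \in unitmx.
Proof. exact: F2_gunit. Qed.
Let sN a i j : smooth_on (O a) (Nc (L a) i j).
Proof. exact: smooth_Nc (@Oopen a) (@sL a) (@gL a) _ _. Qed.
Let inO a z : chart_dom B a z -> O a (chart_map B a z). Proof. by exists z. Qed.
Let inS a b z : chart_dom B a z -> chart_dom B b z -> slit a b (chart_map B a z).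
Proof. by exists z. Qed.

Lemma eta1E a u w : O a u -> (eta1 (L a) u w = 0) <-> (theta (L a) u w = 0).
Proof.
move=> Ou; have L0 := F2_pos hM hF Ou; rewrite /eta1 /theta.
under eq_bigr => i _ do rewrite dxE.
split=> [/eqP|->]; last by rewrite mulr0.
by rewrite mulf_eq0 invr_eq0 (gt_eqF L0) /= => /eqP.
Qed.

Lemma eta2E a u w : O a u -> (eta2 (L a) u w = 0) <-> (phi (L a) u w = 0).
Proof.
move=> Ou; have L0 := F2_pos hM hF Ou; rewrite /eta2 /phi.
under eq_bigr => i _ do rewrite delta_yE.
split=> [/eqP|->]; last by rewrite mulr0.
by rewrite mulf_eq0 invr_eq0 (gt_eqF L0) /= => /eqP.
Qed.

Lemma D_F_in_chart a z v : D_F F z v -> chart_dom B a z ->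
  theta (L a) (chart_map B a z) (v a) = 0 /\ phi (L a) (chart_map B a z) (v a) = 0.
Proof.
move=> [_ H] az; have [e1 e2] := H a az.
by split; [apply/(eta1E _ (inO az))|apply/(eta2E _ (inO az))].
Qed.

Lemma tangent_trans a b z v : tangent B z v -> chart_dom B a z -> chart_dom B b z ->
  v b = 'D_(v a) (transition B a b) (chart_map B a z).
Proof.
move=> [_ /(_ a b)] vt az bz; rewrite (vt az bz).
exact: (transD (A := B) Bsmooth _ az bz).
Qed.

(** Invariance of [theta] and [phi] under transitions reduces the condition over all charts to a
    single one. *)
Lemma D_F_of_chart a z v : chart_dom B a z -> tangent B z v ->
  theta (L a) (chart_map B a z) (v a) = 0 -> phi (L a) (chart_map B a z) (v a) = 0 ->
  D_F F z v.
Proof.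
move=> az vt tv pv; split=> // b bz.
have e := tangent_trans vt az bz.
have u_b : transition B a b (chart_map B a z) = chart_map B b z.
  exact: (transitionE (A := B) Binj b az).
split; [apply/(eta1E _ (inO bz))|apply/(eta2E _ (inO bz))].
  by rewrite e -u_b (F2_theta_change hM hF _ (inS az bz)).
by rewrite e -u_b (F2_phi_change hM hF _ (inS az bz)).
Qed.

Lemma PsiE a z v : chart_dom B a z -> Psi F z v a = Psi_loc (L a) (chart_map B a z) (v a).
Proof. by move=> az; rewrite /Psi; case: asboolP. Qed.

Lemma Psi_out a z v : ~ chart_dom B a z -> Psi F z v a = 0.
Proof. by move=> az; rewrite /Psi; case: asboolP. Qed.

Lemma Psi_tangent z v : tangent B z v -> tangent B z (Psi F z v).
Proof.
move=> vt; split=> [a|a b az bz]; first exact: Psi_out.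
rewrite (transD (A := B) Bsmooth _ az bz) !PsiE //.
rewrite (F2_Psi_change hM hF _ (inS az bz)) -(tangent_trans vt az bz).
by rewrite (transitionE (A := B) Binj b az).
Qed.

Lemma Psi_D_F z v : D_F F z v -> D_F F z (Psi F z v).
Proof.
move=> Dv; have [vt _] := Dv.
have [cov _ _ _ _] := T0M_manifold hM; have [a az] := cov z.
have [tv pv] := D_F_in_chart Dv az.
apply: (D_F_of_chart az); first exact: Psi_tangent.
  by rewrite PsiE // theta_Psi.
by rewrite PsiE // phi_Psi tv oppr0.
Qed.

Lemma PsiD z (c : R) v w : Psi F z (c *: v + w) = c *: Psi F z v + Psi F z w.
Proof.
apply/funext => a; have [az|az] := pselect (chart_dom B a z).
  by rewrite !fctE !PsiE // Psi_locD.
by rewrite !fctE !Psi_out // scaler0 addr0.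
Qed.

Lemma Psi_Psi z v : tangent B z v -> Psi F z (Psi F z v) = - v.
Proof.
move=> [v0 _]; apply/funext => a; have [az|az] := pselect (chart_dom B a z).
  by rewrite !PsiE // Psi_locK.
by rewrite Psi_out // fctE v0 // oppr0.
Qed.

Lemma Psi_in_chart a (x : T0M A -> chart A -> 'rV[R]_(m + m)) u : O a u ->
  in_chart B a (fun z => Psi F z (x z) a) u = Psi_loc (L a) u (in_chart B a (x^~ a) u).
Proof. by move=> [z az <-]; rewrite !(in_chartE (A := B) Binj) // PsiE. Qed.

Lemma Psi_vector_field (U : set (T0M A)) x : chart_open B U -> vector_field B U x ->
  vector_field B U (fun z => Psi F z (x z)).
Proof.
move=> Uo [tx sx]; split=> [z Uz|a]; first by apply: Psi_tangent; exact: tx.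
have UO : chart_map B a @` (U `&` chart_dom B a) `<=` O a by move=> _ [z [_ az] <-]; exists z.
have Uao : open (chart_map B a @` (U `&` chart_dom B a)) by exact: Uo.
have sNU i j := smooth_sub UO (@sN a i j).
apply: (smooth_ext Uao _ (smooth_Psi_loc Uao sNU (sx a))) => u /UO Ou.
by rewrite Psi_in_chart.
Qed.

Lemma chart_openT : chart_open B setT.
Proof. by move=> a; exact: (open_chart_imageT (A := B)). Qed.

Lemma Psi_bundle_endomorphism : bundle_endomorphism B (D_F F) (Psi F).
Proof.
split; [exact: Psi_D_F|by move=> *; exact: PsiD|].
by move=> U x Uo [vx _]; exact: Psi_vector_field.
Qed.

(** * Brackets of sections of the structural distribution *)

Section Integrability.
Variables (lam : T0M A -> R) (X : chart A -> T0M A -> 'M[R]_m).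
Hypothesis hR : forall a z, chart_dom B a z -> forall i j k : 'I_m,
  curvature (L a) i j k (chart_map B a z) =
  lam z * (X a z i k * y_low (L a) j (chart_map B a z) - X a z i j * y_low (L a) k (chart_map B a z)).
Variables x y : T0M A -> chart A -> 'rV[R]_(m + m).
Hypotheses (sx : section_on B (D_F F) setT x) (sy : section_on B (D_F F) setT y).

Let x' z := Psi F z (x z).
Let y' z := Psi F z (y z).

Let vfx' : vector_field B setT x'.
Proof. by case: sx => vx _; exact: Psi_vector_field chart_openT vx. Qed.
Let vfy' : vector_field B setT y'.
Proof. by case: sy => vy _; exact: Psi_vector_field chart_openT vy. Qed.

Let loc a (z : T0M A -> chart A -> 'rV[R]_(m + m)) := in_chart B a (z^~ a).

Let loc_smooth a (f : T0M A -> chart A -> 'rV[R]_(m + m)) : vector_field B setT f -> smooth_on (O a) (loc a f).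
Proof. by move=> [_ /(_ a)]; rewrite setTI. Qed.

Let loc_D a (f : T0M A -> chart A -> 'rV[R]_(m + m)) :
  section_on B (D_F F) setT f -> forall u, O a u ->
  theta (L a) u (loc a f u) = 0 /\ phi (L a) u (loc a f u) = 0.
Proof.
move=> [_ Dz] _ [p ap <-]; rewrite /loc (in_chartE (A := B) Binj) //.
exact: (D_F_in_chart (Dz p I)).
Qed.

Let loc_t a f (sf : section_on B (D_F F) setT f) u (Ou : O a u) := (loc_D sf Ou).1.
Let loc_p a f (sf : section_on B (D_F F) setT f) u (Ou : O a u) := (loc_D sf Ou).2.

Let curv a u : O a u -> forall i j k, curvature (L a) i j k u =
  in_chart B a lam u * (in_chart B a (X a) u i k * y_low (L a) j u
    - in_chart B a (X a) u i j * y_low (L a) k u).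
Proof. by move=> [z az <-] i j k; rewrite !(in_chartE (A := B) Binj) // hR. Qed.

(** The chart expression of Psi_F x is known to be [Psi_loc] only on the image of the chart; as this
    image is open, that determines the bracket. *)
Let brE a p (z t : T0M A -> chart A -> 'rV[R]_(m + m)) zl tl : chart_dom B a p ->
  (forall u, O a u -> loc a z u = zl u) -> (forall u, O a u -> loc a t u = tl u) ->
  bracket B z t p a = lie zl tl (chart_map B a p).
Proof.
move=> ap ez et; rewrite (bracketE (A := B)) //.
exact: (lie_ext (@Oopen a) ez et (inO ap)).
Qed.

Let Pl a (f : T0M A -> chart A -> 'rV[R]_(m + m)) u := Psi_loc (L a) u (loc a f u).

Lemma bracket_Psi_section : section_on B (D_F F) setT
  (fun p => bracket B x' y' p - bracket B x y p).
Proof.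
have [vx _] := sx; have [vy _] := sy.
have tb p : tangent B p (bracket B x' y' p - bracket B x y p).
  apply: tangentD; last apply: tangentN.
    exact: (bracket_tangent (A := B) Binj Bopen Bsmooth vfx' vfy').
  exact: (bracket_tangent (A := B) Binj Bopen Bsmooth vx vy).
split; [split=> [p _|a]|].
- exact: tb.
- have s1 := bracket_smooth (A := B) Bopen vfx' vfy' a.
  have s2 := bracket_smooth (A := B) Bopen vx vy a.
  have Oo := @open_chart_imageT _ _ _ B Bopen a.
  apply: (smooth_ext Oo _ (smooth_row_sub Oo s1 s2)) => _ [p [_ ap] <-].
  by rewrite (in_chartE (A := B) Binj) // !fctE !(bracketE (A := B)).
- move=> p _; have [cov _ _ _ _] := T0M_manifold hM; have [a ap] := cov p.
  have e : (bracket B x' y' p - bracket B x y p) a =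
      lie (Pl a x) (Pl a y) (chart_map B a p) - lie (loc a x) (loc a y) (chart_map B a p).
    rewrite !fctE (brE (zl := Pl a x) (tl := Pl a y)) //; try exact: Psi_in_chart.
    by rewrite (brE (zl := loc a x) (tl := loc a y)).
  apply: (D_F_of_chart ap (tb p)); rewrite e.
    exact: (theta_lie (@Oopen a) (@sL a) (@eL a) (@gL a) (@loc_smooth a _ vx) (@loc_smooth a _ vy)
      (loc_t sx) (loc_t sy) (loc_p sx) (loc_p sy) (inO ap)).
  exact: (phi_lie (@Oopen a) (@sL a) (@eL a) (@gL a) (@loc_smooth a _ vx) (@loc_smooth a _ vy)
      (loc_t sx) (loc_t sy) (loc_p sx) (loc_p sy) (inO ap)).
Qed.

Lemma Psi_nijenhuis p : bracket B x' y' p - bracket B x y p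
  - Psi F p (bracket B x y' p + bracket B x' y p) = 0.
Proof.
have [vx _] := sx; have [vy _] := sy.
apply/funext => a.
change (bracket B x' y' p a - bracket B x y p a
  - Psi F p (bracket B x y' p + bracket B x' y p) a = 0).
have [ap|ap] := pselect (chart_dom B a p); last first.
  by rewrite (Psi_out _ ap) !(bracket_out (A := B) _ _ ap) !subr0.
rewrite (PsiE _ ap).
change ((bracket B x y' p + bracket B x' y p) a) with (bracket B x y' p a + bracket B x' y p a).
rewrite (brE (zl := Pl a x) (tl := Pl a y)) //; try exact: Psi_in_chart.
rewrite (brE (zl := loc a x) (tl := loc a y)) //.
rewrite (brE (zl := loc a x) (tl := Pl a y)) //; try exact: Psi_in_chart.
rewrite (brE (zl := Pl a x) (tl := loc a y)) //; try exact: Psi_in_chart.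
apply/eqP; rewrite subr_eq0; apply/eqP.
exact: (local_nijenhuis (@Oopen a) (@sL a) (@gL a) (@curv a)
  (@loc_smooth a _ vx) (@loc_smooth a _ vy)
  (loc_t sx) (loc_t sy) (loc_p sx) (loc_p sy) (inO ap)).
Qed.

End Integrability.

End StructuralDistribution.

(** * Local frames of the structural distribution *)

Section HyperplaneBasis.
Context {R : realType} {n : nat} (i0 : 'I_n.+1) (Y : 'I_n.+1 -> R).

(* The [k]-th entry of [e_l - (Y_l / Y_i0) e_i0] with [l = lift i0 j]; these
   vectors form a basis of the hyperplane [Y^perp]. *)
Definition hyperplane_coef (j : 'I_n) (k : 'I_n.+1) : R :=
  (k == lift i0 j)%:R - Y (lift i0 j) / Y i0 * (k == i0)%:R.

Lemma hyperplane_coef_lift j j' : hyperplane_coef j (lift i0 j') = (j' == j)%:R.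
Proof.
rewrite /hyperplane_coef (inj_eq (@lift_inj _ i0)) eq_sym [lift _ _ == i0]eq_sym.
by rewrite (negbTE (neq_lift _ _)) mulr0 subr0 eq_sym.
Qed.

Lemma hyperplane_coef_orth j : Y i0 != 0 -> \sum_k Y k * hyperplane_coef j k = 0.
Proof.
move=> Y0; rewrite (bigD1_ord i0) //= (bigD1 j) //= hyperplane_coef_lift eqxx mulr1.
rewrite big1 ?addr0 => [|k kj]; last by rewrite hyperplane_coef_lift (negbTE kj) mulr0.
rewrite /hyperplane_coef eqxx (negbTE (neq_lift _ _)) mulr1 sub0r.
by rewrite mulrN mulrC divfK // addNr.
Qed.

(** The entries other than [i0] serve as coordinates; orthogonality to [Y] determines the remaining
    one. *)
Lemma hyperplane_expand (q : 'I_n.+1 -> R) k : Y i0 != 0 -> \sum_k Y k * q k = 0 ->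
  q k = \sum_j q (lift i0 j) * hyperplane_coef j k.
Proof.
move=> Y0 q0; case: (unliftP i0 k) => [j ->|->].
  rewrite (bigD1 j) //= hyperplane_coef_lift eqxx mulr1 big1 ?addr0 // => j' jj'.
  by rewrite hyperplane_coef_lift eq_sym (negbTE jj') mulr0.
apply: (mulfI Y0); move: q0; rewrite (bigD1_ord i0) //= => /eqP.
rewrite addr_eq0 => /eqP ->; rewrite mulr_sumr -sumrN; apply: eq_bigr => j _.
rewrite /hyperplane_coef eqxx (negbTE (neq_lift _ _)) mulr1 sub0r.
by rewrite !mulrN mulrCA [Y i0 * _]mulrC divfK // mulrC.
Qed.

End HyperplaneBasis.

Section LocalFrame.
Context {R : realType} {n : nat}.
Variables (L : 'rV[R]_(n.+1 + n.+1) -> R) (i0 : 'I_n.+1).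
Implicit Types (s : bool * 'I_n) (u w : 'rV[R]_(n.+1 + n.+1)).

Let Y u k := y_low L k u.

(** [theta] and [phi] apply one covector y_i to the horizontal and to the vertical components, so
    D_F consists of two copies of its kernel; [s.1] selects the copy, horizontal when true. *)
Definition frame_vec s u : 'rV[R]_(n.+1 + n.+1) :=
  \sum_k hyperplane_coef i0 (Y u) s.2 k *: (if s.1 then delta_vec L k u else ey k).

Lemma frame_h s u k : frame_vec s u 0 (lshift n.+1 k) =
  if s.1 then hyperplane_coef i0 (Y u) s.2 k else 0.
Proof.
rewrite /frame_vec summxE; case: s => -[] j /=.
  rewrite -[RHS](sum_delta (hyperplane_coef i0 (Y u) j)); apply: eq_bigr => l _.
  by rewrite mxE delta_vec_l.
by rewrite big1 // => l _; rewrite mxE eyX mulr0.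
Qed.

Lemma frame_r s u k : frame_vec s u 0 (rshift n.+1 k) =
  if s.1 then - \sum_l hyperplane_coef i0 (Y u) s.2 l * Nc L k l u
  else hyperplane_coef i0 (Y u) s.2 k.
Proof.
rewrite /frame_vec summxE; case: s => -[] j /=.
  rewrite -sumrN; apply: eq_bigr => l _.
  by rewrite mxE delta_vec_r mulrN.
rewrite -[RHS](sum_delta (hyperplane_coef i0 (Y u) j)); apply: eq_bigr => l _.
by rewrite mxE eyY.
Qed.

Lemma frame_vert s u k : vert (Nc L) k u (frame_vec s u) =
  if s.1 then 0 else hyperplane_coef i0 (Y u) s.2 k.
Proof.
rewrite /vert frame_r; under [X in _ + X]eq_bigr => l _ do rewrite frame_h.
case: s => -[] j /=; last by rewrite big1 ?addr0 // => l _; rewrite mulr0.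
by rewrite addrC -sumrB big1 // => l _; rewrite mulrC subrr.
Qed.

Lemma sum_frame_index (V : nmodType) (f : bool * 'I_n -> V) :
  \sum_s f s = \sum_j f (true, j) + \sum_j f (false, j).
Proof.
have -> : \sum_s f s = \sum_s (fun b j => f (b, j)) s.1 s.2.
  by apply: eq_bigr => -[].
rewrite -(pair_bigA _ (fun b j => f (b, j))) /= (bigD1 true) //=; congr (_ + _).
by rewrite (bigD1 false) //= [X in _ + X]big1 ?addr0 // => -[].
Qed.

Lemma vertZ (N : 'I_n.+1 -> 'I_n.+1 -> 'rV[R]_(n.+1 + n.+1) -> R) k u c w :
  vert N k u (c *: w) = c * vert N k u w.
Proof.
rewrite /vert mxE mulrDr mulr_sumr; congr (_ + _); apply: eq_bigr => l _.
by rewrite mxE mulrCA.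
Qed.

Lemma vert_sum (N : 'I_n.+1 -> 'I_n.+1 -> 'rV[R]_(n.+1 + n.+1) -> R) k u I (r : seq I)
    (f : I -> 'rV[R]_(n.+1 + n.+1)) :
  vert N k u (\sum_(i <- r) f i) = \sum_(i <- r) vert N k u (f i).
Proof.
elim: r => [|i r IH]; last by rewrite !big_cons vertD IH.
rewrite !big_nil /vert mxE add0r big1 // => l _.
by rewrite mxE mulr0.
Qed.

Lemma frame_sum_h c u k : (\sum_s c s *: frame_vec s u) 0 (lshift n.+1 k) =
  \sum_j c (true, j) * hyperplane_coef i0 (Y u) j k.
Proof.
rewrite sum_frame_index mxE !summxE [X in _ + X]big1 ?addr0 => [|j _]; last first.
  by rewrite mxE frame_h mulr0.
by apply: eq_bigr => j _; rewrite mxE frame_h.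
Qed.

Lemma frame_sum_vert c u k : vert (Nc L) k u (\sum_s c s *: frame_vec s u) =
  \sum_j c (false, j) * hyperplane_coef i0 (Y u) j k.
Proof.
rewrite sum_frame_index vertD !vert_sum big1 ?add0r => [|j _]; last first.
  by rewrite vertZ frame_vert mulr0.
by apply: eq_bigr => j _; rewrite vertZ frame_vert.
Qed.

Lemma frame_theta c u : Y u i0 != 0 -> theta L u (\sum_s c s *: frame_vec s u) = 0.
Proof.
move=> Y0; rewrite /theta; under eq_bigr => k _ do rewrite frame_sum_h mulr_sumr.
rewrite exchange_big big1 //= => j _.
under eq_bigr => k _ do rewrite mulrCA.
by rewrite -mulr_sumr hyperplane_coef_orth ?mulr0.
Qed.

Lemma frame_phi c u : Y u i0 != 0 -> phi L u (\sum_s c s *: frame_vec s u) = 0.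
Proof.
move=> Y0; rewrite /phi; under eq_bigr => k _ do rewrite frame_sum_vert mulr_sumr.
rewrite exchange_big big1 //= => j _.
under eq_bigr => k _ do rewrite mulrCA.
by rewrite -mulr_sumr hyperplane_coef_orth ?mulr0.
Qed.

(** At the indices [lift i0 j] the hyperplane basis is a Kronecker symbol, so the coefficients can
    be read off the adapted components. *)
Lemma frame_free c u : \sum_s c s *: frame_vec s u = 0 -> forall s, c s = 0.
Proof.
move=> e; have E b j : \sum_j' c (b, j') * hyperplane_coef i0 (Y u) j' (lift i0 j) = c (b, j).
  rewrite (bigD1 j) //= hyperplane_coef_lift eqxx mulr1 big1 ?addr0 // => j' jj'.
  by rewrite hyperplane_coef_lift eq_sym (negbTE jj') mulr0.
move=> [[] j]; rewrite -E.
  by rewrite -frame_sum_h e mxE.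
(* Writing the zero vector as 0 times itself lets [vertZ] evaluate [vert] on it. *)
by rewrite -frame_sum_vert e -(scale0r 0) vertZ mul0r.
Qed.

Lemma frame_span u w : Y u i0 != 0 -> theta L u w = 0 -> phi L u w = 0 ->
  w = \sum_s (if s.1 then w 0 (lshift n.+1 (lift i0 s.2))
              else vert (Nc L) (lift i0 s.2) u w) *: frame_vec s u.
Proof.
move=> Y0 tw pw; apply/eqP; rewrite -subr_eq0; apply/eqP.
set c := fun s : bool * 'I_n => _.
apply: (vert_inj (N := Nc L) (u := u)) => k.
  rewrite mxE [X in _ + X]mxE frame_sum_h /c /=.
  by rewrite -(hyperplane_expand (q := fun k => w 0 (lshift n.+1 k)) _ Y0 tw) subrr.
rewrite vertD vertN frame_sum_vert /c /=.
by rewrite -(hyperplane_expand (q := fun k => vert (Nc L) k u w) _ Y0 pw) subrr.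
Qed.

Lemma frame_smooth (W : set 'rV[R]_(n.+1 + n.+1)) s : open W ->
  (forall k, smooth_on W (y_low L k)) -> (forall i j, smooth_on W (Nc L i j)) ->
  (forall u, W u -> Y u i0 != 0) -> smooth_on W (frame_vec s).
Proof.
move=> Wo sy sN Y0.
have sV : smooth_on W (fun u => (y_low L i0 u)^-1) by exact: smooth_inv.
have sc j k : smooth_on W (fun u => hyperplane_coef i0 (Y u) j k).
  by rewrite /hyperplane_coef /Y; smooth.
apply/(smooth_row _ Wo) => i; case: (split_ordP i) => k ->.
  have H : smooth_on W (fun u => if s.1 then hyperplane_coef i0 (Y u) s.2 k else 0).
    by case: s.1 => //; exact: smooth_cst.
  by apply: (smooth_ext Wo _ H) => u _; rewrite frame_h.
have H : smooth_on W (fun u => if s.1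
    then - \sum_l hyperplane_coef i0 (Y u) s.2 l * Nc L k l u
    else hyperplane_coef i0 (Y u) s.2 k).
  by case: s.1 => //; smooth.
by apply: (smooth_ext Wo _ H) => u _; rewrite frame_r.
Qed.

End LocalFrame.

Section FrameOfD.
Context {R : realType} {n : nat} {M : Type}.
Variable A : atlas R n.+1 M.
Hypothesis hM : smooth_manifold A.
Variable F : TM A -> R.
Hypothesis hF : finsler F.
Let B := T0M_atlas A.

Let Bopen : forall a b, open (chart_map B a @` (chart_dom B a `&` chart_dom B b)).
Proof. exact: (slit_open hM). Qed.
Let Bsmooth : forall a b, smooth_on (chart_map B a @` (chart_dom B a `&` chart_dom B b))
  (transition B a b).
Proof. exact: (T0M_trans_smooth hM). Qed.

Lemma tangent_inj (a : chart B) z v w : chart_dom B a z -> tangent B z v -> tangent B z w ->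
  v a = w a -> v = w.
Proof.
move=> az tv tw e; apply/funext => b.
have [bz|bz] := pselect (chart_dom B b z); last by rewrite tv.1 // tw.1.
by rewrite (tangent_trans hM tv az bz) (tangent_trans hM tw az bz) e.
Qed.

Lemma tangent_sum z I (r : seq I) (c : I -> R) (v : I -> chart B -> 'rV[R]_(n.+1 + n.+1)) :
  (forall i, tangent B z (v i)) -> tangent B z (\sum_(i <- r) c i *: v i).
Proof.
move=> tv; elim: r => [|i r IH].
  rewrite big_nil; split=> // a b az bz.
  by rewrite [LHS]/(0 : 'rV[R]_(n.+1 + n.+1)) linear0.
by rewrite big_cons; apply: tangentD IH; exact: tangentZ.
Qed.

Lemma D_F_distribution : Defs.distribution B (2 * n) (D_F F).
Proof.
move=> p; have [cov _ _ _ _] := T0M_manifold hM; have [a ap] := cov p.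
set L := F2_in_chart F a.
have Oopen := @image_open _ _ _ A hM a.
have sL := @F2_smooth _ _ _ A hM F hF a.
have eL := @F2_euler _ _ _ A hM F hF a.
have gL := @F2_gunit _ _ _ A F hF a.
have sN i j := smooth_Nc Oopen sL gL i j.
have sy i := smooth_y_low Oopen sL eL i.
have Ou : (chart_map B a @` chart_dom B a) (chart_map B a p) by exists p.
(* The y_i cannot all vanish, since their contraction with y^i is F^2 > 0. The frame is then built
   on the open set where y_i0 stays nonzero. *)
have [i0 y0] : exists i0, y_low L i0 (chart_map B a p) != 0.
  apply: contrapT => H; have := F2_pos hM hF Ou.
  rewrite -(y_low_sum Oopen sL eL Ou) big1 ?ltxx // => i _.
  have [->|ne] := eqVneq (y_low L i (chart_map B a p)) 0; first by rewrite mul0r.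
  by case: H; exists i.
pose U := [set z | chart_dom B a z /\ y_low L i0 (chart_map B a z) != 0].
have Ua : U `<=` chart_dom B a by move=> z [].
have imU : chart_map B a @` U = [set u | (chart_map B a @` chart_dom B a) u /\
    (~` [set 0]) (y_low L i0 u)].
  apply/seteqP; split => [_ [z [az /eqP yz] <-]|_ [[z az <-] /eqP yz]].
    by split => //; exists z.
  by exists z.
have Uo : open (chart_map B a @` U).
  rewrite imU; apply: open_preimage_within => //.
    by move=> u Ou'; apply: differentiable_continuous; exact: smooth_diff (sy i0) Ou'.
  apply: closed_openC; apply: compact_closed; [exact: norm_hausdorff|exact: compact_set1].
have UO : chart_map B a @` U `<=` chart_map B a @` chart_dom B a.
  by move=> _ [z [az _] <-]; exists z.
(* [distribution] indexes frames by ordinals below 2 * n, the frame above by pairs; [f] and [f'] are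
   the two directions of an enumeration. *)
have E : #|{: bool * 'I_n}| = (2 * n)%N by rewrite card_prod card_bool card_ord.
pose f (i : 'I_(2 * n)) : bool * 'I_n := enum_val (cast_ord (esym E) i).
pose f' (s : bool * 'I_n) : 'I_(2 * n) := cast_ord E (enum_rank s).
have fK : cancel f f' by move=> i; rewrite /f /f' enum_valK cast_ordKV.
have f'K : cancel f' f by move=> s; rewrite /f /f' cast_ordK enum_rankK.
have fsum (V : nmodType) (G : bool * 'I_n -> V) : \sum_i G (f i) = \sum_s G s.
  by rewrite [RHS](reindex f) //; exists f' => ? _; [exact: fK|exact: f'K].
pose X (s : bool * 'I_n) := push_field (A := B) a (frame_vec L i0 s).
have XE s z : chart_dom B a z -> X s z a = frame_vec L i0 s (chart_map B a z).
  by move=> az; exact: (push_fieldE (A := B) (T0M_inj hM) Bopen (frame_vec L i0 s) az).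
have tX s z : chart_dom B a z -> tangent B z (X s z).
  exact: (push_field_tangent (A := B) (T0M_inj hM) Bopen Bsmooth (frame_vec L i0 s)).
have sumE (c : bool * 'I_n -> R) z : chart_dom B a z ->
    (\sum_s c s *: X s z) a = \sum_s c s *: frame_vec L i0 s (chart_map B a z).
  move=> az; rewrite fct_sumE; apply: eq_bigr => s _.
  by rewrite -(XE s z az).
exists U, (fun i => X (f i)); split.
- exact: (chart_open_of (A := B) (T0M_inj hM) Bopen Bsmooth Ua Uo).
- by split.
- move=> i; apply: (vector_field_push (A := B) (T0M_inj hM) Bopen Bsmooth Ua Uo).
  apply: frame_smooth => //.
  + by move=> k; exact: smooth_sub UO (sy k).
  + by move=> k l; exact: smooth_sub UO (sN k l).
  + by move=> _ [z [_ yz] <-].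
- move=> z [az yz]; split.
    move=> c e i; have {}e : \sum_s c (f' s) *: X s z = 0.
      rewrite -[RHS]e -[LHS]fsum; apply: eq_bigr => j _; by rewrite fK.
    have e' := sumE (c \o f') z az; rewrite /= e in e'.
    by have := frame_free (esym e') (f i); rewrite /= fK.
  apply/seteqP; split => v.
    move=> Dv; have [tv pv] := D_F_in_chart hM hF Dv az.
    pose u := chart_map B a z.
    pose c (s : bool * 'I_n) := if s.1 then v a 0 (lshift n.+1 (lift i0 s.2))
      else vert (Nc L) (lift i0 s.2) u (v a).
    have ev : v a = \sum_s c s *: frame_vec L i0 s u := frame_span yz tv pv.
    exists (fun i => c (f i)); rewrite (fsum _ (fun s => c s *: X s z)).
    apply: (tangent_inj az Dv.1).
      by apply: tangent_sum => s; exact: tX.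
    by rewrite sumE.
  move=> [c ->].
  have -> : \sum_i c i *: X (f i) z = \sum_s c (f' s) *: X s z.
    by rewrite -[RHS]fsum; apply: eq_bigr => j _; rewrite fK.
  apply: (D_F_of_chart hM hF az).
  + by apply: tangent_sum => s; exact: tX.
  + by rewrite sumE //; exact: frame_theta.
  + by rewrite sumE //; exact: frame_phi.
Qed.

End FrameOfD.

Theorem theorem3p1 (R : realType) (m : nat) (M : Type) (A : atlas R m M)
    (F : TM A -> R) (lam : T0M A -> R) (X : chart A -> T0M A -> 'M[R]_m)
    (hm : (2 <= m)%N) (hM : smooth_manifold A) (hF : finsler F)
    (hlam : smooth_fun (T0M_atlas A) (lam : T0M A -> R^o))
    (hX : tensor11 X)
    (hR : forall (a : chart (T0M_atlas A)) (z : T0M A),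
       chart_dom (T0M_atlas A) a z ->
       forall i j k : 'I_m,
         let L := F2_in_chart F a in let u := chart_map (T0M_atlas A) a z in
         curvature L i j k u
         = lam z * (X a z i k * y_low L j u - X a z i j * y_low L k u))
    (hyX : forall (a : chart (T0M_atlas A)) (z : T0M A),
       chart_dom (T0M_atlas A) a z ->
       forall j : 'I_m,
         let L := F2_in_chart F a in let u := chart_map (T0M_atlas A) a z in
         \sum_i y_low L i u * X a z i j = y_low L j u) :
  CR_structure (T0M_atlas A) m.-1 2 (D_F F) (Psi F).
Proof.
split.
- split; first exact: T0M_manifold.
  split=> //; first by rewrite -ltnS prednK // ltnW.
  by case: m hm {A F lam X hM hF hlam hX hR hyX} => // m _; rewrite mul2n -addnn addnS addSn addn2.
(* Writing m as n.+1 turns m.-1 into [n], the form in which the local frame is stated. *)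
- move: hm; case: m A F lam X hM hF {hlam hX hR hyX} => // n A F _ _ hM hF _.
  exact: D_F_distribution.
- exact: Psi_bundle_endomorphism.
- by move=> z v [tv _]; exact: Psi_Psi.
- move=> x y sx sy; split; first exact: bracket_Psi_section.
  exact: (Psi_nijenhuis hM hF hR sx sy).
Qed.
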